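(* Let $n\ge4$ be even. A complete list of pairwise inequivalent simple ($\mathbb{Z}_2$-graded) $\mathbb{C}D_n^-$-modules consists of the modules $D^{\{\lambda,\lambda'\}}$, one for each unordered pair $\{\lambda,\lambda'\}$ of distinct conjugate partitions of $n$, together with the modules $D^\lambda_+$ and $D^\lambda_-$ for each partition $\lambda\vdash n$ with $\lambda=\lambda'$. All these simple $\mathbb{C}D_n^-$-modules are of type $\mathtt{M}$.
   Context: All algebras and modules are finite-dimensional over $\mathbb{C}$. Modules over a superalgebra $A$ are $\mathbb{Z}_2$-graded, simple means no proper nonzero graded submodule, $\mathrm{Hom}_A(M,N)$ is spanned by all homogeneous (even and odd) linear maps $f$ with $f(am)=(-1)^{|f||a|}af(m)$; isomorphisms may be even or odd. A simple $M$ is of type $\mathtt{M}$ if $\dim\mathrm{Hom}_A(M,M)=1$ and of type $\mathtt{Q}$ if this dimension is $2$. $\mathbb{C}B_n^-$: odd generators $t_1,\dots,t_n$, relations $t_i^2=1$; $t_it_{i+1}t_i=t_{i+1}t_it_{i+1}$ ($1\le i\le n-2$); $(t_it_j)^2=-1$ ($|i-j|>1$); $(t_{n-1}t_n)^4=-1$. $\mathbb{C}D_n^-$: odd generators $t_1,\dots,t_n$, relations $t_i^2=1$; $t_it_{i+1}t_i=t_{i+1}t_it_{i+1}$ ($1\le i\le n-2$); $(t_it_j)^2=-1$ ($i,j\le n-1$, $|i-j|>1$); $(t_it_n)^2=-1$ ($i\neq n-2,n$); $t_{n-2}t_nt_{n-2}=t_nt_{n-2}t_n$. There is an inclusion $\mathbb{C}D_n^-\hookrightarrow\mathbb{C}B_n^-$,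 $t_i\mapsto t_i$ ($i\le n-1$), $t_n\mapsto-t_nt_{n-1}t_n$. $\mathcal{C}l_n$ is the Clifford superalgebra with odd generators $c_1,\dots,c_n$, $c_i^2=1$, $c_ic_j=-c_jc_i$ ($i\neq j$), with unique simple module $U$. Via the superalgebra isomorphism $\mathbb{C}B_n^-\cong\mathcal{C}l_n\otimes\mathbb{C}S_n$ ($\mathbb{C}S_n$ purely even), $t_i\mapsto\frac1{\sqrt2}(c_i-c_{i+1})s_i$ ($i<n$), $t_n\mapsto c_n$, $B^\lambda$ is the pullback of $U\otimes S^\lambda$ ($S^\lambda$ the Specht module). For $n$ even put $D^{\{\lambda,\lambda'\}}:=B^\lambda|_{\mathbb{C}D_n^-}$. When $\lambda=\lambda'$, $D^{\{\lambda,\lambda'\}}=D^\lambda_+\oplus D^\lambda_-$ is the decomposition into two inequivalent modules which are simple already as ungraded modules and carry a compatible $\mathbb{Z}_2$-grading. (When $\lambda\ne\lambda'$, $B^\lambda$ and $B^{\lambda'}$ have isomorphic restrictions to $\mathbb{C}D_n^-$.) *)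

(* Defs.v *)
From HB Require Import structures.
From mathcomp Require Import all_boot all_order all_fingroup all_algebra.
From mathcomp Require Import zify generic_quotient boolp reals complex.

Set Implicit Arguments.
Unset Strict Implicit.
Unset Printing Implicit Defensive.

Import Order.TTheory GRing.Theory Num.Theory.
Local Open Scope ring_scope.
Local Open Scope quotient_scope.
Local Obligation Tactic := idtac.

(* Parities are booleans: false is even, true is odd, and (+) (addb) is the   *)
(* addition of Z/2.                                                           *)

Section Super.
Variable C : numClosedFieldType.

(* An associative unital algebra is a ring with a central structure map       *)
(* sa_scal : C -> A. The structure algType would impose 1 != 0, which fails   *)
(* for some presentations.                                                    *)
Record superalg := SuperAlg {
  sa_ring :> pzRingType;
  sa_scal : {rmorphism C -> sa_ring};
  sa_gr : bool -> sa_ring -> Prop;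
  sa_central : forall c x, sa_scal c * x = x * sa_scal c;
  sa_gr0 : forall p, sa_gr p 0;
  sa_grD : forall p x y, sa_gr p x -> sa_gr p y -> sa_gr p (x + y);
  sa_gr_scal : forall c, sa_gr false (sa_scal c);
  sa_grM : forall p q x y, sa_gr p x -> sa_gr q y -> sa_gr (p (+) q) (x * y);
  sa_gr_sum : forall x, exists x0 x1,
    [/\ sa_gr false x0, sa_gr true x1 & x = x0 + x1];
  sa_gr_cap : forall x, sa_gr false x -> sa_gr true x -> x = 0
}.

Record sahom (A B : superalg) := SaHom {
  sh_fun :> {rmorphism A -> B};
  sh_scal : forall c, sh_fun (sa_scal A c) = sa_scal B c;
  sh_gr : forall p x, sa_gr p x -> sa_gr p (sh_fun x)
}.

Program Definition sahom_comp (A B D : superalg) (g : sahom B D) (f : sahom A B)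
    : sahom A D :=
  @SaHom A D (sh_fun g \o sh_fun f) _ _.
Next Obligation. by move=> A B D g f c /=; rewrite !sh_scal. Qed.
Next Obligation. by move=> A B D g f p x xp /=; do 2!apply: sh_gr. Qed.

Record svect := SVect {
  sv_space :> vectType C;
  sv_gr : bool -> {vspace sv_space};
  sv_gr_sum : (sv_gr false + sv_gr true = fullv)%VS;
  sv_gr_cap : (sv_gr false :&: sv_gr true = 0)%VS
}.

Section EndAlgebra.
Variable V : svect.

Definition end_ring : Type := 'End(V).
HB.instance Definition _ := GRing.Zmodule.on end_ring.
HB.instance Definition _ := GRing.Zmodule_isPzRing.Build end_ring
  (@comp_lfunA _ _ _ _ _) (@comp_lfun1l _ _ _) (@comp_lfun1r _ _ _)
  (@comp_lfunDl _ _ _ _) (@comp_lfunDr _ _ _ _).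

Definition end_scal (c : C) : end_ring := c *: \1%VF.

Fact end_scal_zmod : zmod_morphism end_scal.
Proof. by move=> c d; rewrite /end_scal scalerBl. Qed.
Fact end_scal_monoid : monoid_morphism end_scal.
Proof.
split=> [|c d]; first by rewrite /end_scal scale1r.
apply/lfunP=> v; rewrite /GRing.mul /= comp_lfunE !scale_lfunE !id_lfunE.
by rewrite scalerA.
Qed.
HB.instance Definition _ := GRing.isZmodMorphism.Build C end_ring end_scal
  end_scal_zmod.
HB.instance Definition _ := GRing.isMonoidMorphism.Build C end_ring end_scal
  end_scal_monoid.

Definition end_gr (p : bool) (f : end_ring) : Prop :=
  forall q v, v \in sv_gr V q -> (f : 'End(V)) v \in sv_gr V (p (+) q).

Definition sv_proj (p : bool) : 'End(V) := daddv_pi (sv_gr V p) (sv_gr V (~~ p)).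

Lemma sv_capE p : (sv_gr V p :&: sv_gr V (~~ p) = 0)%VS.
Proof. by case: p => /=; [rewrite capvC|]; apply: sv_gr_cap. Qed.
Lemma sv_proj_mem p v : sv_proj p v \in sv_gr V p.
Proof. exact: memv_pi. Qed.
Lemma sv_proj_id p v : v \in sv_gr V p -> sv_proj p v = v.
Proof. exact/daddv_pi_id/sv_capE. Qed.
Lemma sv_proj_sum v : sv_proj false v + sv_proj true v = v.
Proof.
by apply: daddv_pi_add; rewrite ?sv_gr_cap //= sv_gr_sum memvf.
Qed.
Lemma sv_proj_0 p v : v \in sv_gr V (~~ p) -> sv_proj p v = 0.
Proof.
move=> vp; have := sv_proj_sum v; case: p vp => /= vp.
  by rewrite (sv_proj_id vp) => /(canRL (addKr _)) ->; rewrite addNr.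
by rewrite (sv_proj_id vp) => /(canRL (addrK _)) ->; rewrite subrr.
Qed.

Program Definition send : superalg :=
  @SuperAlg end_ring end_scal end_gr _ _ _ _ _ _ _.
Next Obligation.
move=> c x; apply/lfunP=> v.
rewrite /GRing.mul /= !comp_lfunE !scale_lfunE !id_lfunE.
by rewrite linearZ.
Qed.
Next Obligation. by move=> p q v _; rewrite lfunE mem0v. Qed.
Next Obligation.
by move=> p x y xp yp q v vq; rewrite add_lfunE memvD ?xp ?yp.
Qed.
Next Obligation.
by move=> c q v vq; rewrite scale_lfunE id_lfunE memvZ.
Qed.
Next Obligation.
move=> p q x y xp yp r v vr.
by rewrite comp_lfunE -addbA xp ?yp.
Qed.
Next Obligation.
move=> x.
pose y : 'End(V) := x.
pose e p := \sum_(q : bool) (sv_proj (p (+) q) \o (y \o sv_proj q))%VF.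
have e_gr p : end_gr p (e p).
  move=> q v vq; rewrite /e sum_lfunE big_bool /= !comp_lfunE.
  case: q vq => vq; first by rewrite (@sv_proj_0 false) // !linear0 addr0 sv_proj_mem.
  by rewrite (@sv_proj_0 true) // !linear0 add0r sv_proj_mem.
exists (e false), (e true); split=> //.
apply/lfunP=> v; rewrite add_lfunE /e !sum_lfunE !big_bool /= !comp_lfunE.
rewrite addrACA sv_proj_sum [X in X + _]addrC sv_proj_sum -linearD /=.
by rewrite addrC sv_proj_sum.
Qed.
Next Obligation.
move=> x x0 x1; apply/lfunP=> v; rewrite lfunE /= -[v]sv_proj_sum linearD /=.
have z p u : u \in sv_gr V p -> (x : 'End(V)) u = 0.
  move=> up; have := x0 _ _ up; have := x1 _ _ up => /= a b.
  by apply/eqP; rewrite -memv0 -(sv_capE p) memv_cap a b.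
by rewrite (z false) ?(z true) ?addr0 ?sv_proj_mem.
Qed.

End EndAlgebra.

Record supermod (A : superalg) := SuperMod {
  sm_space :> svect;
  sm_act : sahom A (send sm_space)
}.
Definition act (A : superalg) (M : supermod A) (a : A) : 'End(M) := sm_act M a.

Definition pullback (A B : superalg) (f : sahom A B) (M : supermod B) :
  supermod A := SuperMod (sahom_comp (sm_act M) f).

Section Modules.
Variable A : superalg.
Implicit Types M N : supermod A.

Definition homog_hom M N (p : bool) (f : 'Hom(M, N)) : Prop :=
  (forall q m, m \in sv_gr M q -> f m \in sv_gr N (p (+) q)) /\
  (forall q a m, sa_gr q a ->
     f (act M a m) = (-1) ^+ (p && q) *: act N a (f m)).

Definition in_Hom M N (f : 'Hom(M, N)) : Prop :=
  exists f0 f1, [/\ homog_hom false f0, homog_hom true f1 & f = f0 + f1].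

Definition Hom_dim M N (d : nat) : Prop :=
  exists H : {vspace 'Hom(M, N)},
    (forall f, f \in H <-> in_Hom f) /\ \dim H = d.

Definition type_M M : Prop := Hom_dim M M 1.

Definition isomorphic M N : Prop :=
  exists p (f : 'Hom(M, N)), homog_hom p f /\ bijective f.

Definition submodule M (W : {vspace M}) : Prop :=
  forall a w, w \in W -> act M a w \in W.
Definition graded_subspace M (W : {vspace M}) : Prop :=
  W = (W :&: sv_gr M false + W :&: sv_gr M true)%VS.

Definition simple M : Prop :=
  (fullv : {vspace M}) <> 0%VS /\
  forall W : {vspace M}, graded_subspace W -> submodule W ->
    W = 0%VS \/ W = fullv.
Definition ungraded_simple M : Prop :=
  (fullv : {vspace M}) <> 0%VS /\
  forall W : {vspace M}, submodule W -> W = 0%VS \/ W = fullv.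

Definition direct_sum M N1 N2 : Prop :=
  exists (f1 : 'Hom(N1, M)) (f2 : 'Hom(N2, M)),
    [/\ homog_hom false f1 /\ homog_hom false f2,
        lker f1 = 0%VS /\ lker f2 = 0%VS,
        (limg f1 + limg f2 = fullv)%VS & (limg f1 :&: limg f2 = 0)%VS].

End Modules.

(* Superalgebras presented by odd generators 't_0, ..., 't_(n-1) and          *)
(* relations: noncommutative polynomial expressions modulo the least          *)
(* congruence that contains the axioms of C-algebras and the relations.       *)
Section Presentation.
Variable n : nat.

Inductive ncpoly : Type :=
  | Gen of 'I_n
  | Cst of C
  | Add of ncpoly & ncpoly
  | Mul of ncpoly & ncpoly.

Fixpoint ncpow (x : ncpoly) (k : nat) : ncpoly :=
  if k is k'.+1 then Mul x (ncpow x k') else Cst 1.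

HB.instance Definition _ := gen_eqMixin ncpoly.
HB.instance Definition _ := gen_choiceMixin ncpoly.

Inductive homog : bool -> ncpoly -> Prop :=
  | homog_gen i : homog true (Gen i)
  | homog_cst c : homog false (Cst c)
  | homog_zero p : homog p (Cst 0)
  | homog_add p x y : homog p x -> homog p y -> homog p (Add x y)
  | homog_mul p q x y : homog p x -> homog q y -> homog (p (+) q) (Mul x y).

Record relations := Relations {
  rel_of :> ncpoly -> ncpoly -> Prop;
  rel_homog : forall x y, rel_of x y -> exists p, homog p x /\ homog p y
}.

Variable r : relations.

Inductive nceq : ncpoly -> ncpoly -> Prop :=
  | nceq_rel x y : r x y -> nceq x y
  | nceq_refl x : nceq x x
  | nceq_sym x y : nceq x y -> nceq y x
  | nceq_trans y x z : nceq x y -> nceq y z -> nceq x z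
  | nceq_add x x' y y' : nceq x x' -> nceq y y' -> nceq (Add x y) (Add x' y')
  | nceq_mul x x' y y' : nceq x x' -> nceq y y' -> nceq (Mul x y) (Mul x' y')
  | nceq_addA x y z : nceq (Add x (Add y z)) (Add (Add x y) z)
  | nceq_addC x y : nceq (Add x y) (Add y x)
  | nceq_add0 x : nceq (Add (Cst 0) x) x
  | nceq_addN x : nceq (Add (Mul (Cst (-1)) x) x) (Cst 0)
  | nceq_mulA x y z : nceq (Mul x (Mul y z)) (Mul (Mul x y) z)
  | nceq_mul1 x : nceq (Mul (Cst 1) x) x
  | nceq_mulDl x y z : nceq (Mul (Add x y) z) (Add (Mul x z) (Mul y z))
  | nceq_mulDr x y z : nceq (Mul x (Add y z)) (Add (Mul x y) (Mul x z))
  | nceq_cstD c d : nceq (Cst (c + d)) (Add (Cst c) (Cst d))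
  | nceq_cstM c d : nceq (Cst (c * d)) (Mul (Cst c) (Cst d))
  | nceq_cstC c x : nceq (Mul (Cst c) x) (Mul x (Cst c)).

Definition nceqb (x y : ncpoly) : bool := `[< nceq x y >].

Fact nceqb_equiv : equiv_class_of nceqb.
Proof.
split=> [x|x y|y x z].
- exact/asboolP/nceq_refl.
- by apply/asboolP/asboolP => /nceq_sym.
- by move=> /asboolP xy /asboolP yz; apply/asboolP/(nceq_trans xy yz).
Qed.
Canonical nceqb_equiv_rel := EquivRelPack nceqb_equiv.
Canonical nceqb_encModRel := defaultEncModRel nceqb.

Definition pres : Type := {eq_quot nceqb}.
HB.instance Definition _ : EqQuotient ncpoly nceqb pres := EqQuotient.on pres.
HB.instance Definition _ := Choice.on pres.

Lemma presP (x y : ncpoly) : \pi_pres x = \pi_pres y <-> nceq x y.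
Proof.
by split=> [/eqmodP/asboolP//|xy]; apply/eqmodP/asboolP.
Qed.

Definition pres_zero : pres := \pi_pres (Cst 0).
Definition pres_one : pres := \pi_pres (Cst 1).
Definition pres_opp (x : pres) : pres := \pi_pres (Mul (Cst (-1)) (repr x)).
Definition pres_add (x y : pres) : pres := \pi_pres (Add (repr x) (repr y)).
Definition pres_mul (x y : pres) : pres := \pi_pres (Mul (repr x) (repr y)).

Lemma nceq_repr x : nceq (repr (\pi_pres x)) x.
Proof. by apply/presP; rewrite reprK. Qed.

Lemma pi_addE x y : \pi_pres (Add x y) = pres_add (\pi_pres x) (\pi_pres y).
Proof. by apply/presP; apply: nceq_add; apply/nceq_sym/nceq_repr. Qed.
Lemma pi_mulE x y : \pi_pres (Mul x y) = pres_mul (\pi_pres x) (\pi_pres y).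
Proof. by apply/presP; apply: nceq_mul; apply/nceq_sym/nceq_repr. Qed.
Lemma pi_oppE x : \pi_pres (Mul (Cst (-1)) x) = pres_opp (\pi_pres x).
Proof.
apply/presP; apply: nceq_mul; [exact: nceq_refl|exact/nceq_sym/nceq_repr].
Qed.

Lemma pres_ind (P : pres -> Prop) : (forall x, P (\pi_pres x)) -> forall x, P x.
Proof. by move=> h x; rewrite -[x]reprK. Qed.

Fact pres_addA : associative pres_add.
Proof.
move=> x y z; elim/pres_ind: x=> x; elim/pres_ind: y=> y; elim/pres_ind: z=> z.
by rewrite -!pi_addE; apply/presP/nceq_addA.
Qed.
Fact pres_addC : commutative pres_add.
Proof.
move=> x y; elim/pres_ind: x=> x; elim/pres_ind: y=> y.
by rewrite -!pi_addE; apply/presP/nceq_addC.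
Qed.
Fact pres_add0 : left_id pres_zero pres_add.
Proof.
by move=> x; elim/pres_ind: x=> x; rewrite -!pi_addE; apply/presP/nceq_add0.
Qed.
Fact pres_addN : left_inverse pres_zero pres_opp pres_add.
Proof.
move=> x; elim/pres_ind: x=> x; rewrite -pi_oppE -!pi_addE.
exact/presP/nceq_addN.
Qed.
HB.instance Definition _ := GRing.isZmodule.Build pres
  pres_addA pres_addC pres_add0 pres_addN.

Fact pres_mulA : associative pres_mul.
Proof.
move=> x y z; elim/pres_ind: x=> x; elim/pres_ind: y=> y; elim/pres_ind: z=> z.
by rewrite -!pi_mulE; apply/presP/nceq_mulA.
Qed.
Fact pres_mul1l : left_id pres_one pres_mul.
Proof.
by move=> x; elim/pres_ind: x=> x; rewrite -!pi_mulE; apply/presP/nceq_mul1.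
Qed.
Fact pres_mul1r : right_id pres_one pres_mul.
Proof.
move=> x; elim/pres_ind: x=> x; rewrite -!pi_mulE; apply/presP.
exact/(nceq_trans _ (nceq_mul1 x))/nceq_sym/nceq_cstC.
Qed.
Fact pres_mulDl : left_distributive pres_mul +%R.
Proof.
move=> x y z; elim/pres_ind: x=> x; elim/pres_ind: y=> y; elim/pres_ind: z=> z.
rewrite /GRing.add /= -!(pi_mulE, pi_addE).
exact/presP/nceq_mulDl.
Qed.
Fact pres_mulDr : right_distributive pres_mul +%R.
Proof.
move=> x y z; elim/pres_ind: x=> x; elim/pres_ind: y=> y; elim/pres_ind: z=> z.
rewrite /GRing.add /= -!(pi_mulE, pi_addE).
exact/presP/nceq_mulDr.
Qed.
HB.instance Definition _ := GRing.Zmodule_isPzRing.Build pres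
  pres_mulA pres_mul1l pres_mul1r pres_mulDl pres_mulDr.

Lemma pi_add x y : \pi_pres (Add x y) = \pi_pres x + \pi_pres y :> pres.
Proof. exact: pi_addE. Qed.
Lemma pi_mul x y : \pi_pres (Mul x y) = \pi_pres x * \pi_pres y :> pres.
Proof. exact: pi_mulE. Qed.

Definition pres_scal (c : C) : pres := \pi_pres (Cst c).

Fact pres_scal_monoid : monoid_morphism pres_scal.
Proof.
by split=> // c d; rewrite /pres_scal -pi_mul; apply/presP/nceq_cstM.
Qed.
Fact pres_scal_zmod : zmod_morphism pres_scal.
Proof.
move=> c d; apply/(canRL (addrK _)); rewrite /pres_scal -pi_add -{2}[c](subrK d).
exact/presP/nceq_sym/nceq_cstD.
Qed.
HB.instance Definition _ := GRing.isZmodMorphism.Build C pres pres_scal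
  pres_scal_zmod.
HB.instance Definition _ := GRing.isMonoidMorphism.Build C pres pres_scal
  pres_scal_monoid.

Definition pres_gr (p : bool) (x : pres) : Prop :=
  exists2 e, homog p e & x = \pi_pres e.

Section Eval.
Variables (B : pzRingType) (scal : {rmorphism C -> B}) (b : 'I_n -> B).

Fixpoint ev (e : ncpoly) : B :=
  match e with
  | Gen i => b i
  | Cst c => scal c
  | Add x y => ev x + ev y
  | Mul x y => ev x * ev y
  end.

Lemma ev_pow x k : ev (ncpow x k) = ev x ^+ k.
Proof. by elim: k => [|k IHk] /=; rewrite ?rmorph1 // IHk exprS. Qed.

Hypothesis scal_central : forall c x, scal c * x = x * scal c.
Hypothesis ev_rel : forall x y, r x y -> ev x = ev y.

Lemma ev_nceq x y : nceq x y -> ev x = ev y.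
Proof.
elim=> //= {x y}.
- by move=> y x z _ -> _ ->.
- by move=> x x' y y' _ -> _ ->.
- by move=> x x' y y' _ -> _ ->.
- by move=> *; rewrite addrA.
- by move=> *; rewrite addrC.
- by move=> *; rewrite rmorph0 add0r.
- by move=> *; rewrite rmorphN rmorph1 mulN1r addNr rmorph0.
- by move=> *; rewrite mulrA.
- by move=> *; rewrite rmorph1 mul1r.
- by move=> *; rewrite mulrDl.
- by move=> *; rewrite mulrDr.
- by move=> *; rewrite rmorphD.
- by move=> *; rewrite rmorphM.
Qed.

Definition pres_ev (x : pres) : B := ev (repr x).
Lemma pres_evE e : pres_ev (\pi_pres e) = ev e.
Proof. exact/ev_nceq/nceq_repr. Qed.

Lemma pres_ev_zmod : zmod_morphism pres_ev.
Proof.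
move=> x y; apply/(canRL (addrK _)).
rewrite -{2}[x](subrK y); elim/pres_ind: (x - y) => z; elim/pres_ind: y => y.
by rewrite -pi_add !pres_evE.
Qed.
Lemma pres_ev_monoid : monoid_morphism pres_ev.
Proof.
split=> [|x y]; first by rewrite -[1]/(\pi_pres (Cst 1)) pres_evE /= rmorph1.
by elim/pres_ind: x => x; elim/pres_ind: y => y; rewrite -pi_mul !pres_evE.
Qed.

End Eval.

(* The parity automorphism 't_i |-> - 't_i, used to see that the even and     *)
(* odd parts intersect trivially.                                             *)
Section Parity.
Definition pres_flip : 'I_n -> pres := fun i => - \pi_pres (Gen i).

Lemma ev_flip p e :
  homog p e -> ev pres_scal pres_flip e = (-1) ^+ p * \pi_pres e.
Proof.
elim=> {p e} /=.
- by move=> i; rewrite mulN1r.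
- by move=> c; rewrite mul1r.
- by move=> p; rewrite -[\pi_pres _]/(pres_scal 0) rmorph0 mulr0.
- by move=> p x y _ -> _ ->; rewrite pi_add mulrDr.
- move=> p q x y _ -> _ ->; rewrite pi_mul signr_addb !mulrA; congr (_ * _).
  by rewrite -!mulrA; congr (_ * _); apply: commr_sign.
Qed.

Lemma ev_flip_rel x y :
  r x y -> ev pres_scal pres_flip x = ev pres_scal pres_flip y.
Proof.
move=> rxy; have [p [hx hy]] := rel_homog rxy; rewrite !(@ev_flip p) //.
by congr (_ * _); apply/presP/nceq_rel.
Qed.
End Parity.

Fixpoint part (p : bool) (e : ncpoly) : ncpoly :=
  match e with
  | Gen i => if p then Gen i else Cst 0
  | Cst c => if p then Cst 0 else Cst c
  | Add x y => Add (part p x) (part p y)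
  | Mul x y => Add (Mul (part false x) (part p y))
                   (Mul (part true x) (part (~~ p) y))
  end.

Lemma part_homog p e : homog p (part p e).
Proof.
elim: e p => [i|c|x hx y hy|x hx y hy] p /=; try by case: p; constructor.
apply: homog_add; first exact: (homog_mul (hx false) (hy p)).
by have := homog_mul (hx true) (hy (~~ p)); rewrite addTb negbK.
Qed.

Lemma part_sum e : \pi_pres e = \pi_pres (part false e) + \pi_pres (part true e).
Proof.
have z : \pi_pres (Cst 0) = 0 :> pres by [].
elim: e => [i|c|x hx y hy|x hx y hy] /=; rewrite ?z ?add0r ?addr0 //.
  by rewrite !pi_add hx hy addrACA.
rewrite !(pi_add, pi_mul) hx hy mulrDl !mulrDr.
by rewrite -!addrA; congr (_ + _); rewrite [RHS]addrC addrA.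
Qed.

Program Definition presented : superalg :=
  @SuperAlg pres pres_scal pres_gr _ _ _ _ _ _ _.
Next Obligation.
move=> c x; elim/pres_ind: x => x; rewrite /pres_scal -!pi_mul.
exact/presP/nceq_cstC.
Qed.
Next Obligation. by move=> p; exists (Cst 0) => //; constructor. Qed.
Next Obligation.
move=> p _ _ [x hx ->] [y hy ->]; exists (Add x y); first by constructor.
by rewrite pi_add.
Qed.
Next Obligation. by move=> c; exists (Cst c) => //; constructor. Qed.
Next Obligation.
move=> p q _ _ [x hx ->] [y hy ->]; exists (Mul x y); first by constructor.
by rewrite pi_mul.
Qed.
Next Obligation.
move=> x; elim/pres_ind: x => x.
exists (\pi_pres (part false x)), (\pi_pres (part true x)).
split; last exact: part_sum.
- by exists (part false x) => //; apply: part_homog.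
- by exists (part true x) => //; apply: part_homog.
Qed.
Next Obligation.
move=> x [e0 h0 e0x] [e1 h1 e1x].
have cen c y : pres_scal c * y = y * pres_scal c.
  by elim/pres_ind: y => y; rewrite /pres_scal -!pi_mul; apply/presP/nceq_cstC.
have xx : x = - x.
  have e := pres_evE cen ev_flip_rel.
  rewrite -[LHS]mul1r {1}e0x -(ev_flip h0) -e -e0x {1}e1x e (ev_flip h1) -e1x.
  by rewrite mulN1r.
have : pres_scal (2^-1 * 2) * x = 0.
  rewrite rmorphM rmorph_nat -mulrA mulr_natl [X in _ * X]mulr2n.
  by rewrite [X in _ * (X + _)]xx addNr mulr0.
by rewrite mulVf ?pnatr_eq0 // rmorph1 mul1r.
Qed.

Definition gen (i : 'I_n) : presented := \pi_pres (Gen i).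

Lemma gen_odd i : sa_gr true (gen i).
Proof. by exists (Gen i) => //; constructor. Qed.

Lemma ev_gen e : ev (sa_scal presented) gen e = \pi_pres e.
Proof. by elim: e => //= [x -> y ->|x -> y ->]; rewrite ?pi_add ?pi_mul. Qed.

Lemma gen_rel x y :
  r x y -> ev (sa_scal presented) gen x = ev (sa_scal presented) gen y.
Proof. by rewrite !ev_gen => rxy; apply/presP/nceq_rel. Qed.

Section Lift.
Variables (B : superalg) (b : 'I_n -> B).
Hypothesis b_odd : forall i, sa_gr true (b i).
Hypothesis b_rel :
  forall x y, r x y -> ev (sa_scal B) b x = ev (sa_scal B) b y.

Definition lift_fun : pres -> B := pres_ev (sa_scal B) b.
HB.instance Definition _ := GRing.isZmodMorphism.Build pres B lift_fun
  (pres_ev_zmod (@sa_central B) b_rel).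
HB.instance Definition _ := GRing.isMonoidMorphism.Build pres B lift_fun
  (pres_ev_monoid (@sa_central B) b_rel).

Program Definition lift : sahom presented B := @SaHom presented B lift_fun _ _.
Next Obligation.
by move=> c; exact: (pres_evE (@sa_central B) b_rel (Cst c)).
Qed.
Next Obligation.
move=> p _ [e he ->]; rewrite /= /lift_fun (pres_evE (@sa_central B) b_rel).
elim: he => /= {p e}.
- exact: b_odd.
- exact: sa_gr_scal.
- by move=> p; rewrite rmorph0; apply: sa_gr0.
- by move=> p x y _ hx _ hy; apply: sa_grD.
- by move=> p q x y _ hx _ hy; apply: sa_grM.
Qed.

Lemma lift_gen i : lift (gen i) = b i.
Proof. exact: (pres_evE (@sa_central B) b_rel). Qed.
End Lift.

End Presentation.

End Super.

Declare Scope nc_scope.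
Delimit Scope nc_scope with NC.
Bind Scope nc_scope with ncpoly.
Notation "''t_' i" := (Gen _ i) (at level 8, i at level 2, format "''t_' i")
  : nc_scope.
Notation "1" := (Cst _ 1) : nc_scope.
Notation "- 1" := (Cst _ (-1)) : nc_scope.
Notation "- x" := (Mul (Cst _ (-1)) x) : nc_scope.
Notation "x * y" := (Mul x y) : nc_scope.
Notation "x ^+ k" := (ncpow x k) : nc_scope.

(* The generators are numbered from 0 to n-1 instead of from 1 to n.          *)
Section TypeBD.
Variables (C : numClosedFieldType) (n : nat).
Local Notation ncpoly := (ncpoly C n).

Inductive Clifford_eqn : ncpoly -> ncpoly -> Prop :=
  | Clifford_sq i : Clifford_eqn ('t_i ^+ 2) 1
  | Clifford_anti i j : i != j -> Clifford_eqn ('t_i * 't_j) (- ('t_j * 't_i)).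

Definition far (i j : nat) : bool := (i.+1 < j)%N || (j.+1 < i)%N.

Inductive B_eqn : ncpoly -> ncpoly -> Prop :=
  | B_sq i : B_eqn ('t_i ^+ 2) 1
  | B_braid (i j : 'I_n) : j = i.+1 :> nat -> (j.+1 < n)%N ->
      B_eqn ('t_i * 't_j * 't_i) ('t_j * 't_i * 't_j)
  | B_far (i j : 'I_n) : far i j -> B_eqn (('t_i * 't_j) ^+ 2) (- 1)
  | B_last (i j : 'I_n) : j = i.+1 :> nat -> j.+1 = n ->
      B_eqn (('t_i * 't_j) ^+ 4) (- 1).

Inductive D_eqn : ncpoly -> ncpoly -> Prop :=
  | D_sq i : D_eqn ('t_i ^+ 2) 1
  | D_braid (i j : 'I_n) : j = i.+1 :> nat -> (j.+1 < n)%N ->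
      D_eqn ('t_i * 't_j * 't_i) ('t_j * 't_i * 't_j)
  | D_far (i j : 'I_n) : (i.+1 < n)%N -> (j.+1 < n)%N -> far i j ->
      D_eqn (('t_i * 't_j) ^+ 2) (- 1)
  | D_far_last (i j : 'I_n) : j.+1 = n -> i != j -> i.+3 <> n ->
      D_eqn (('t_i * 't_j) ^+ 2) (- 1)
  | D_last (i j : 'I_n) : j.+1 = n -> i.+3 = n ->
      D_eqn ('t_i * 't_j * 't_i) ('t_j * 't_i * 't_j).

Lemma homog_1 : homog false (1 : ncpoly)%NC. Proof. by constructor. Qed.
Lemma homog_N1 : homog false (- 1 : ncpoly)%NC.
Proof. by constructor. Qed.
Lemma homog_gen2 i j : homog false ('t_i * 't_j : ncpoly)%NC.
Proof. by apply: (@homog_mul _ _ true true); constructor. Qed.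
Lemma homog_gen3 i j k : homog true ('t_i * 't_j * 't_k : ncpoly)%NC.
Proof.
by apply: (@homog_mul _ _ false true); [apply: homog_gen2 | constructor].
Qed.
Lemma homog_gen1X i : homog false ('t_i ^+ 2 : ncpoly)%NC.
Proof.
apply: (@homog_mul _ _ true true); first by constructor.
by apply: (@homog_mul _ _ true false); constructor.
Qed.
Lemma homog_even_pow (x : ncpoly) k : homog false x -> homog false (x ^+ k)%NC.
Proof.
move=> hx; elim: k => [|k hk] /=; first exact: homog_1.
exact: (@homog_mul _ _ false false).
Qed.
Local Hint Resolve homog_1 homog_N1 homog_gen2 homog_gen3 homog_gen1X : core.

Fact Clifford_homog x y :
  Clifford_eqn x y -> exists p, homog p x /\ homog p y.
Proof.
case=> [i|i j _]; exists false; split=> //.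
by apply: (@homog_mul _ _ false false); [constructor | apply: homog_gen2].
Qed.
Fact B_homog x y : B_eqn x y -> exists p, homog p x /\ homog p y.
Proof.
case=> [i|i j _ _|i j _|i j _ _]; [exists false|exists true|exists false|exists false];
  by split=> //; apply: homog_even_pow.
Qed.
Fact D_homog x y : D_eqn x y -> exists p, homog p x /\ homog p y.
Proof.
case=> [i|i j _ _|i j _ _ _|i j _ _ _|i j _ _];
  [exists false|exists true|exists false|exists false|exists true];
  by split=> //; apply: homog_even_pow.
Qed.

Definition Clifford : superalg C := presented (Relations Clifford_homog).
Definition CB : superalg C := presented (Relations B_homog).
Definition CD : superalg C := presented (Relations D_homog).

Definition c_ (i : 'I_n) : Clifford := gen _ i.
Definition tB (i : 'I_n) : CB := gen _ i.
Definition tD (i : 'I_n) : CD := gen _ i.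

Lemma c_sq i : c_ i ^+ 2 = 1.
Proof.
have /= := @gen_rel _ _ (Relations Clifford_homog) _ _ (Clifford_sq i).
by rewrite rmorph1 mulr1.
Qed.
Lemma c_anti i j : i != j -> c_ i * c_ j = - (c_ j * c_ i).
Proof.
move=> ij.
have /= := @gen_rel _ _ (Relations Clifford_homog) _ _ (Clifford_anti ij).
by rewrite rmorphN rmorph1 mulN1r.
Qed.

Lemma tB_sq i : tB i ^+ 2 = 1.
Proof.
have /= := @gen_rel _ _ (Relations B_homog) _ _ (B_sq i).
by rewrite rmorph1 mulr1.
Qed.
Lemma tB_braid (i j : 'I_n) : j = i.+1 :> nat -> (j.+1 < n)%N ->
  tB i * tB j * tB i = tB j * tB i * tB j.
Proof.
by move=> ij jn; exact: (@gen_rel _ _ (Relations B_homog) _ _ (B_braid ij jn)).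
Qed.
Lemma tB_far (i j : 'I_n) : far i j -> (tB i * tB j) ^+ 2 = -1.
Proof.
move=> ij; have /= := @gen_rel _ _ (Relations B_homog) _ _ (B_far ij).
by rewrite rmorphN rmorph1 mulr1.
Qed.
Lemma tB_last (i j : 'I_n) : j = i.+1 :> nat -> j.+1 = n -> (tB i * tB j) ^+ 4 = -1.
Proof.
move=> ij jn; have := @gen_rel _ _ (Relations B_homog) _ _ (B_last ij jn).
by rewrite ev_pow /= rmorphN rmorph1.
Qed.

(* The inclusion of CD into CB. For the last generator i, ord_pred i is the   *)
(* previous one.                                                              *)
Definition D_in_B (i : 'I_n) : CB :=
  if (i.+1 < n)%N then tB i else - (tB i * tB (ord_pred i) * tB i).

Lemma D_in_B_odd i : sa_gr true (D_in_B i).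
Proof.
rewrite /D_in_B; case: ifP => _; first exact: gen_odd.
rewrite -mulN1r -(rmorph1 (sa_scal CB)) -rmorphN.
apply: (@sa_grM _ _ false true); first exact: sa_gr_scal.
apply: (@sa_grM _ _ false true); last exact: gen_odd.
by apply: (@sa_grM _ _ true true); exact: gen_odd.
Qed.

Lemma ord_predE (i : 'I_n) : i.+1 = n -> (1 < n)%N -> (ord_pred i).+1 = i.
Proof.
move=> /= e n1; have i0 : (0 < i)%N by rewrite -ltnS e.
rewrite -{1}(prednK i0) /= modnDr modn_small ?prednK //.
by rewrite (leq_trans _ (ltn_ord i)) // ltnS leq_pred.
Qed.

Lemma anti_of_sq (R : pzRingType) (x y : R) :
  x ^+ 2 = 1 -> y ^+ 2 = 1 -> (x * y) ^+ 2 = -1 -> x * y = - (y * x).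
Proof.
rewrite !expr2 => xx yy xy.
have : x * (x * y * (x * y)) * y = x * -1 * y by rewrite xy.
rewrite !mulrA xx mul1r -(mulrA (y * x)) yy mulr1 => ->.
by rewrite mulrN mulr1 mulNr opprK.
Qed.

Lemma sq_of_anti (R : pzRingType) (x y : R) :
  x ^+ 2 = 1 -> y ^+ 2 = 1 -> x * y = - (y * x) -> (x * y) ^+ 2 = -1.
Proof.
rewrite !expr2 => xx yy xy.
by rewrite {1}xy mulNr mulrA -(mulrA y x x) xx mulr1 yy.
Qed.

Lemma D_in_B_sq i : D_in_B i ^+ 2 = 1.
Proof.
rewrite /D_in_B; case: ifP => _; first exact: tB_sq.
have s j : tB j * tB j = 1 by rewrite -expr2 tB_sq.
rewrite sqrrN expr2; set x := tB i; set y := tB _.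
have -> : x * y * x * (x * y * x) = x * (y * (x * x) * y) * x by rewrite !mulrA.
by rewrite !(s, mulr1).
Qed.

Lemma tB_anti (i j : 'I_n) : far i j -> tB i * tB j = - (tB j * tB i).
Proof. by move=> ij; apply: anti_of_sq; rewrite ?tB_sq ?tB_far. Qed.

Lemma D_in_B_rel x y : D_eqn x y ->
  ev (sa_scal CB) D_in_B x = ev (sa_scal CB) D_in_B y.
Proof.
have s j : tB j * tB j = 1 by rewrite -expr2 tB_sq.
case=> {x y} [i|i j ij jn|i j in_ jn ij|i j jn ij in_|i j jn in_] /=;
  rewrite ?rmorphN ?rmorph1 ?mulr1 -?[X in X = -1]expr2.
- exact: D_in_B_sq.
- have in_ : (i.+1 < n)%N by rewrite (leq_trans _ jn) // ij.
  by rewrite /D_in_B in_ jn tB_braid.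
- by rewrite /D_in_B in_ jn tB_far.
- have jn' : (j.+1 < n)%N = false by rewrite jn ltnn.
  have iltn := ltn_ord i; have ij' : i != j :> nat by [].
  have in' : (i.+1 < n)%N by lia.
  have n1 : (1 < n)%N by lia.
  have kj := ord_predE jn n1; set k := ord_pred j in kj.
  rewrite {1}/D_in_B in' {1}/D_in_B jn' -/k.
  have [ik|ik] := eqVneq i k.
    rewrite ik mulrN sqrrN.
    have -> : (tB k * (tB j * tB k * tB j)) = (tB k * tB j) ^+ 2.
      by rewrite expr2 !mulrA.
    by rewrite -exprM tB_last.
  have ik' : i != k :> nat by [].
  have fk : far i k by rewrite /far; lia.
  have fj : far i j by rewrite /far; lia.
  apply: sq_of_anti; first exact: tB_sq.
    by have := D_in_B_sq j; rewrite /D_in_B jn' -/k.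
  rewrite mulrN mulNr; congr (- _).
  have := tB_anti fj; have := tB_anti fk.
  set a := tB i; set b := tB k; set c := tB j => ab ac.
  by rewrite !mulrA ac !mulNr -(mulrA c a b) ab mulrN mulNr opprK -!mulrA ac !mulrN.
- have jn' : (j.+1 < n)%N = false by rewrite jn ltnn.
  have in' : (i.+1 < n)%N by lia.
  have n1 : (1 < n)%N by lia.
  have kj := ord_predE jn n1; set k := ord_pred j in kj.
  have ki : k = i.+1 :> nat by lia.
  rewrite {1 3 5}/D_in_B in' /D_in_B jn' -/k.
  have fj : far i j by rewrite /far; lia.
  have br : tB i * tB k * tB i = tB k * tB i * tB k.
    by apply: tB_braid; lia.
  set a := tB i in br *; set b := tB k in br *; set c := tB j.
  have ac : a * c = - (c * a) by exact: tB_anti.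
  have cc : c * c = 1 by exact: s.
  have -> : a * - (c * b * c) * a = - (c * (a * b * a) * c).
    rewrite mulrN mulNr !mulrA ac !mulNr opprK -(mulrA _ c a).
    have -> : c * a = - (a * c) by rewrite ac opprK.
    by rewrite mulrN !mulrA.
  have nn (x y : CB) : - x * y * - x = x * y * x by rewrite mulrN !mulNr opprK.
  rewrite br nn.
  have -> : c * b * c * a * (c * b * c) = c * b * (c * a) * c * b * c.
    by rewrite !mulrA.
  have -> : c * a = - (a * c) by rewrite ac opprK.
  by rewrite mulrN !mulNr !mulrA -(mulrA _ c c) cc mulr1.
Qed.

Definition D_incl : sahom CD CB := 
  lift (r := Relations D_homog) D_in_B_odd D_in_B_rel.

Lemma D_incl_gen i : D_incl (tD i) = D_in_B i.
Proof. exact: lift_gen. Qed.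

(* The first tensor factor of the image of t_i in Cl_n (x) CS_n, the second   *)
(* one being B_perm i.                                                        *)
Definition B_cliff (i : 'I_n) : Clifford :=
  if (i.+1 < n)%N then sa_scal Clifford (sqrtC 2)^-1 * (c_ i - c_ (ordS i))
  else c_ i.
Definition B_perm (i : 'I_n) : 'S_n :=
  if (i.+1 < n)%N then tperm i (ordS i) else 1%g.

Definition acm (R : pzRingType) (x y : R) := x * y + y * x.
Lemma acmC (R : pzRingType) (x y : R) : acm x y = acm y x.
Proof. by rewrite /acm addrC. Qed.
Lemma acmBl (R : pzRingType) (x y z : R) : acm (x - y) z = acm x z - acm y z.
Proof. by rewrite /acm mulrBl mulrBr opprD addrACA. Qed.
Lemma acmBr (R : pzRingType) (x y z : R) : acm x (y - z) = acm x y - acm x z.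
Proof. by rewrite !(acmC x) acmBl. Qed.
Lemma acm0 (R : pzRingType) (x y : R) : acm x y = 0 -> x * y = - (y * x).
Proof. by move/eqP; rewrite addr_eq0 => /eqP. Qed.

Lemma acm_c i j : i != j -> acm (c_ i) (c_ j) = 0.
Proof. by move=> ij; rewrite /acm (c_anti ij) addNr. Qed.
Lemma acm_cc i : acm (c_ i) (c_ i) = 2%:R.
Proof. by rewrite /acm -expr2 c_sq. Qed.

Lemma scal_half : sa_scal Clifford (sqrtC 2)^-1 * sa_scal Clifford (sqrtC 2)^-1
  * 2%:R = 1.
Proof.
rewrite -rmorphM -(rmorph_nat (sa_scal Clifford)) -rmorphM.
by rewrite -invfM -expr2 sqrtCK mulVf ?pnatr_eq0 // rmorph1.
Qed.

Lemma scal_mul (A : superalg C) (k : C) (x y : A) :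
  sa_scal A k * x * (sa_scal A k * y) = sa_scal A k * sa_scal A k * (x * y).
Proof. by rewrite -!mulrA; congr (_ * _); rewrite !mulrA sa_central. Qed.

Lemma ordS_val (i : 'I_n) : (i.+1 < n)%N -> ordS i = i.+1 :> nat.
Proof. by move=> h; rewrite /= modn_small. Qed.

Lemma B_cliff_sq i : B_cliff i ^+ 2 = 1.
Proof.
rewrite /B_cliff; case: ifP => h; last exact: c_sq.
rewrite expr2 scal_mul -[RHS]scal_half; congr (_ * _).
have ii : i != ordS i by rewrite -val_eqE /= modn_small //; lia.
have e j : c_ j * c_ j = 1 by rewrite -expr2 c_sq.
rewrite mulrBl !mulrBr !e (c_anti ii) opprK opprB.
by rewrite addrACA subrr addr0.
Qed.

Lemma B_cliff_acm_braid (i j : 'I_n) : j = i.+1 :> nat -> (j.+1 < n)%N ->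
  acm (B_cliff i) (B_cliff j) = -1.
Proof.
move=> ij jn; have hi : (i.+1 < n)%N by lia.
have ji : ordS i = j by apply: ord_inj; rewrite ordS_val.
rewrite /B_cliff hi jn ji /acm !scal_mul -mulrDr -/(acm _ _).
have [k kE] : exists k, k = ordS j by exists (ordS j).
have kv : k = j.+1 :> nat by rewrite kE ordS_val.
have nij : i != j by rewrite -val_eqE /=; lia.
have nik : i != k by rewrite -val_eqE /=; lia.
have njk : j != k by rewrite -val_eqE /=; lia.
rewrite -kE !(acmBl, acmBr) (acm_c nij) (acm_c nik) (acm_c njk) acm_cc.
by rewrite !subr0 sub0r mulrN scal_half.
Qed.

Lemma B_cliff_far (i j : 'I_n) : far i j ->
  B_cliff i * B_cliff j = - (B_cliff j * B_cliff i).
Proof.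
move=> ij; apply: acm0.
have z (k l : 'I_n) : k != l :> nat -> acm (c_ k) (c_ l) = 0.
  by move=> kl; apply: acm_c.
have li := ltn_ord i; have lj := ltn_ord j.
have sl (x y : Clifford) : acm x y = 0 ->
    acm (sa_scal Clifford (sqrtC 2)^-1 * x) y = 0.
  move=> xy; rewrite /acm -mulrA mulrA [y * _]mulrA -sa_central -!mulrA -mulrDr.
  by rewrite -/(acm _ _) xy mulr0.
rewrite /B_cliff; move: ij; rewrite /far.
case: ifP => hi; case: ifP => hj ij.
- apply: (sl); rewrite acmC; apply: (sl).
  by rewrite !(acmBl, acmBr) !z ?ordS_val ?subr0 //; lia.
- by apply: (sl); rewrite acmBl !z ?ordS_val ?subr0 //; lia.
- by rewrite acmC; apply: (sl); rewrite acmBl !z ?ordS_val ?subr0 //; lia.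
- by rewrite z //; lia.
Qed.

Lemma B_cliff_last (i j : 'I_n) : j = i.+1 :> nat -> j.+1 = n ->
  (B_cliff i * B_cliff j) ^+ 4 = -1.
Proof.
move=> ij jn; have hi : (i.+1 < n)%N by lia.
have hj : (j.+1 < n)%N = false by lia.
have ji : ordS i = j by apply: ord_inj; rewrite ordS_val.
rewrite /B_cliff hi hj ji -mulrA mulrBl -[c_ j * c_ j]expr2 c_sq.
have nij : i != j by rewrite -val_eqE /=; lia.
set u := c_ i * c_ j.
have uu : u ^+ 2 = -1 by apply: sq_of_anti; rewrite ?c_sq // c_anti.
rewrite -[4%N]/(2 * 2)%N exprM [X in X ^+ 2]expr2 scal_mul -[(u - 1) * _]expr2.
have -> : (u - 1) ^+ 2 = 2%:R * - u.
  rewrite expr2 mulrBl !mulrBr mulr1 !mul1r -expr2 uu mulr_natl mulr2n.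
  by rewrite opprB addrACA addNr add0r.
by rewrite mulrA scal_half mul1r sqrrN uu.
Qed.

Lemma B_cliff_braid (i j : 'I_n) : j = i.+1 :> nat -> (j.+1 < n)%N ->
  B_cliff i * B_cliff j * B_cliff i = B_cliff j * B_cliff i * B_cliff j.
Proof.
move=> ij jn; have := B_cliff_acm_braid ij jn; rewrite /acm.
have := B_cliff_sq i; have := B_cliff_sq j; rewrite !expr2.
set x := B_cliff i; set y := B_cliff j => yy xx xy.
have e1 : y * x = -1 - x * y by rewrite -xy addrC addKr.
have l : x * (y * x) = - x - y by rewrite e1 mulrBr mulrN1 mulrA xx mul1r.
have r : y * x * y = - y - x by rewrite e1 mulrBl mulN1r -mulrA yy mulr1.
by rewrite -mulrA l r addrC.
Qed.

Lemma B_cliff_odd i : sa_gr true (B_cliff i).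
Proof.
rewrite /B_cliff; case: ifP => _; last exact: gen_odd.
apply: (@sa_grM _ _ false true); first exact: sa_gr_scal.
apply: sa_grD; first exact: gen_odd.
rewrite -mulN1r -(rmorph1 (sa_scal Clifford)) -rmorphN.
by apply: (@sa_grM _ _ false true); [exact: sa_gr_scal | exact: gen_odd].
Qed.

Lemma B_perm_sq i : (B_perm i * B_perm i = 1)%g.
Proof. by rewrite /B_perm; case: ifP => _; rewrite ?tperm2 ?mulg1. Qed.

Lemma B_perm_braid (i j : 'I_n) : j = i.+1 :> nat -> (j.+1 < n)%N ->
  (B_perm i * B_perm j * B_perm i = B_perm j * B_perm i * B_perm j)%g.
Proof.
move=> ij jn; have hi : (i.+1 < n)%N by lia.
have ji : ordS i = j by apply: ord_inj; rewrite ordS_val.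
rewrite /B_perm hi jn ji.
have [k kE] : exists k, k = ordS j by exists (ordS j).
have kv : k = j.+1 :> nat by rewrite kE ordS_val.
have nij : i != j by rewrite -val_eqE /=; lia.
have nik : i != k by rewrite -val_eqE /=; lia.
have njk : j != k by rewrite -val_eqE /=; lia.
have cj a b (t : 'S_n) : (tperm a b * t * tperm a b = t ^ tperm a b)%g.
  by rewrite conjgE tpermV mulgA.
rewrite -kE !cj !tpermJ.
by rewrite tpermL tpermR !tpermD // eq_sym.
Qed.

Lemma B_perm_far (i j : 'I_n) : far i j ->
  (B_perm i * B_perm j = B_perm j * B_perm i)%g.
Proof.
rewrite /far => ij; have li := ltn_ord i; have lj := ltn_ord j.
rewrite /B_perm; case: ifP => hi; case: ifP => hj; rewrite ?mulg1 ?mul1g //.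
apply/commgP/conjg_fixP; rewrite tpermJ !tpermD // -val_eqE /=
  ?modn_small //; lia.
Qed.

Lemma B_perm_last (j : 'I_n) : j.+1 = n -> B_perm j = 1%g.
Proof. by move=> jn; rewrite /B_perm ltn_neqAle jn eqxx. Qed.

End TypeBD.

(* The tensor product of finite-dimensional spaces is realized as             *)
(* U (x) W = Hom(W^*, U), where u (x) w maps phi to phi(w) u.                 *)
Section Tensor.
Variable C : numClosedFieldType.

Section Maps.
Variables U W : vectType C.
Definition dual : vectType C := 'Hom(W, C^o).
Definition tens : vectType C := 'Hom(dual, U).

Definition tens_pure (u : U) (w : W) : tens :=
  linfun (fun phi : dual => phi w *: u).

Definition transpose (g : 'End(W)) : 'End(dual) :=
  linfun (fun phi : 'Hom(W, C^o) => (phi \o g)%VF).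

Definition tens_map (f : 'End(U)) (g : 'End(W)) : 'End(tens) :=
  linfun (fun T : 'Hom(dual, U) => (f \o T \o transpose g)%VF).

Lemma transposeE g (phi : 'Hom(W, C^o)) : transpose g phi = (phi \o g)%VF.
Proof.
pose h (psi : 'Hom(W, C^o)) : 'Hom(W, C^o) := (psi \o g)%VF.
have h_lin : linear h.
  by move=> c x y; rewrite /h comp_lfunDl comp_lfunZl.
pose H := GRing.isLinear.Build _ _ _ _ h h_lin.
pose hL : {linear dual -> dual} := HB.pack h H.
exact: (lfunE hL).
Qed.

Lemma tens_mapE f g (T : 'Hom(dual, U)) :
  tens_map f g T = (f \o T \o transpose g)%VF.
Proof.
pose h (S : 'Hom(dual, U)) : 'Hom(dual, U) := (f \o S \o transpose g)%VF.
have h_lin : linear h.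
  by move=> c x y; rewrite /h comp_lfunDr comp_lfunDl -comp_lfunZr -comp_lfunZl.
pose H := GRing.isLinear.Build _ _ _ _ h h_lin.
pose hL : {linear tens -> tens} := HB.pack h H.
exact: (lfunE hL).
Qed.

Lemma tens_pureE u w (phi : 'Hom(W, C^o)) :
  (tens_pure u w : 'Hom(dual, U)) phi = phi w *: u.
Proof.
pose h (psi : 'Hom(W, C^o)) : U := psi w *: u.
have h_lin : linear h.
  by move=> c x y; rewrite /h add_lfunE scale_lfunE scalerDl scalerA.
pose H := GRing.isLinear.Build _ _ _ _ h h_lin.
pose hL : {linear dual -> U} := HB.pack h H.
exact: (lfunE hL).
Qed.

Lemma tens_map_pure f g u w :
  tens_map f g (tens_pure u w) = tens_pure (f u) (g w).
Proof.
apply/lfunP => phi.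
by rewrite tens_mapE !comp_lfunE transposeE !tens_pureE comp_lfunE linearZ.
Qed.

Lemma tens_map_comp f f' g g' :
  (tens_map f g \o tens_map f' g')%VF = tens_map (f \o f') (g \o g').
Proof.
apply/lfunP => T; rewrite comp_lfunE !tens_mapE; apply/lfunP => phi.
by rewrite !comp_lfunE !transposeE comp_lfunA.
Qed.

Lemma tens_map1 : tens_map \1 \1 = \1%VF.
Proof.
apply/lfunP => T; rewrite tens_mapE id_lfunE; apply/lfunP => phi.
by rewrite !comp_lfunE transposeE comp_lfun1r id_lfunE.
Qed.

Lemma tens_mapDl f f' g : tens_map (f + f') g = tens_map f g + tens_map f' g.
Proof.
by apply/lfunP => T; rewrite add_lfunE !tens_mapE !comp_lfunDl.
Qed.

Lemma tens_mapZl c f g : tens_map (c *: f) g = c *: tens_map f g.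
Proof. by apply/lfunP => T; rewrite scale_lfunE !tens_mapE -!comp_lfunZl. Qed.

Lemma tens_map0l g : tens_map 0 g = 0.
Proof. by rewrite -[X in tens_map X g](scale0r 0) tens_mapZl scale0r. Qed.

End Maps.

(* W is purely even *)
Section Graded.
Variables (U : svect C) (W : vectType C).

Definition tens_gr (p : bool) : {vspace tens U W} :=
  limg (tens_map (sv_proj U p) (\1 : 'End(W))%VF).

Lemma sv_proj_comp p q :
  (sv_proj U p \o sv_proj U q)%VF = if p == q then sv_proj U p else 0.
Proof.
apply/lfunP => v; rewrite comp_lfunE; case: eqP => [->|/eqP pq].
  by rewrite sv_proj_id ?sv_proj_mem.
have -> : q = ~~ p by case: p q pq => [] [].
by rewrite sv_proj_0 ?sv_proj_mem // lfunE.
Qed.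

Lemma tens_gr_id p T :
  T \in tens_gr p -> tens_map (sv_proj U p) (\1 : 'End(W))%VF T = T.
Proof.
move=> /memv_imgP[S _ ->].
by rewrite -comp_lfunE tens_map_comp comp_lfun1l sv_proj_comp eqxx.
Qed.

Fact tens_gr_sum : (tens_gr false + tens_gr true = fullv)%VS.
Proof.
apply/eqP; rewrite eqEsubv subvf /=; apply/subvP => T _.
have -> : T = tens_map (sv_proj U false) (\1 : 'End(W))%VF T
            + tens_map (sv_proj U true) (\1 : 'End(W))%VF T.
  rewrite -add_lfunE -tens_mapDl.
  have -> : sv_proj U false + sv_proj U true = \1%VF.
    by apply/lfunP => v; rewrite add_lfunE sv_proj_sum id_lfunE.
  by rewrite tens_map1 id_lfunE.
by rewrite memv_add // memv_img ?memvf.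
Qed.

Fact tens_gr_cap : (tens_gr false :&: tens_gr true = 0)%VS.
Proof.
apply/eqP; rewrite -subv0; apply/subvP => T /memv_capP[T0 T1].
rewrite -(tens_gr_id T0) -(tens_gr_id T1) -comp_lfunE tens_map_comp.
by rewrite sv_proj_comp /= tens_map0l lfunE mem0v.
Qed.

Definition svtens : svect C := SVect tens_gr_sum tens_gr_cap.

Lemma tens_map_gr p (f : end_ring U) (g : 'End(W)) :
  end_gr p f -> end_gr (V := svtens) p (tens_map (f : 'End(U)) g).
Proof.
move=> fp q T Tq; rewrite -(tens_gr_id Tq) -comp_lfunE tens_map_comp.
have -> : ((f : 'End(U)) \o sv_proj U q)%VF =
          (sv_proj U (p (+) q) \o ((f : 'End(U)) \o sv_proj U q))%VF.
  apply/lfunP => v; rewrite !comp_lfunE [RHS]sv_proj_id //.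
  by apply: fp; apply: sv_proj_mem.
rewrite -[(g \o \1)%VF]comp_lfun1l -tens_map_comp comp_lfunE.
by rewrite memv_img ?memvf.
Qed.

End Graded.
End Tensor.

(* Partitions are lists of positive integers in decreasing order.             *)
Definition is_part (n : nat) (la : seq nat) : bool :=
  [&& sorted geq la, 0%N \notin la & sumn la == n].

Definition conj_part (la : seq nat) : seq nat :=
  mkseq (fun j => count (fun r => (j < r)%N) la) (head 0%N la).

(* The Specht module: the span of the polytabloids in the permutation module  *)
(* on tabloids (James). The cells of the Young diagram of la are numbered in  *)
(* reading order; a tableau is a permutation t, where t k is the entry of     *)
(* cell k. A tabloid is recorded as the function from entries to rows.        *)
Section Specht.
Variables (C : numClosedFieldType) (n : nat) (la : seq nat).

Definition cell_row (k : 'I_n) : nat := reshape_index la k.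
Definition cell_col (k : 'I_n) : nat := reshape_offset la k.

Definition tabloid : finType := {ffun 'I_n -> 'I_(size la).+1}.
Definition tabloid_of (t : 'S_n) : tabloid :=
  [ffun x => inord (cell_row ((t^-1)%g x))].

Definition tabloid_space : vectType C := {ffun tabloid -> C^o}.
Definition tabloid_vec (f : tabloid) : tabloid_space :=
  [ffun g => (g == f)%:R].

(* (s . v) f = v (s^-1 . f), where (s . f) x = f (s^-1 x) *)
Definition perm_fun (s : 'S_n) (v : {ffun tabloid -> C^o}) :
    {ffun tabloid -> C^o} :=
  [ffun f : tabloid => v [ffun x => f (s x)]].
Definition perm_op (s : 'S_n) : 'End(tabloid_space) := linfun (perm_fun s).

Definition col_stab (t : 'S_n) : {set 'S_n} :=
  [set s : 'S_n | [forall x, cell_col ((t^-1)%g (s x)) == cell_col ((t^-1)%g x)]].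

Definition polytabloid (t : 'S_n) : tabloid_space :=
  \sum_(s in col_stab t) (-1) ^+ s *: perm_op s (tabloid_vec (tabloid_of t)).

Definition Specht_space : {vspace tabloid_space} :=
  span [seq polytabloid t | t : 'S_n].
Definition Specht : vectType C := subvs_of Specht_space.

Definition Specht_op (s : 'S_n) : 'End(Specht) :=
  linfun (fun v : Specht => vsproj Specht_space (perm_op s (vsval v)) : Specht).

Lemma perm_opE s (v : {ffun tabloid -> C^o}) : perm_op s v = perm_fun s v.
Proof.
have h_lin : linear (perm_fun s).
  by move=> c x y; apply/ffunP => f; rewrite !ffunE.
pose H := GRing.isLinear.Build _ _ _ _ (perm_fun s) h_lin.
pose hL : {linear tabloid_space -> tabloid_space} := HB.pack (perm_fun s) H.
exact: (lfunE hL).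
Qed.

(* The product s * s' of permutations is s followed by s'. *)
Lemma perm_opM s s' : (perm_op s \o perm_op s')%VF = perm_op (s' * s)%g.
Proof.
apply/lfunP => v; rewrite comp_lfunE !perm_opE; apply/ffunP => f.
rewrite !ffunE; congr (v _); apply/ffunP => x.
by rewrite !ffunE permM.
Qed.

Lemma perm_op1 : perm_op 1%g = \1%VF.
Proof.
apply/lfunP => v; rewrite perm_opE id_lfunE; apply/ffunP => f.
by rewrite !ffunE; congr (v _); apply/ffunP => x; rewrite ffunE perm1.
Qed.

Lemma perm_op_tabloid s t :
  perm_op s (tabloid_vec (tabloid_of t)) = tabloid_vec (tabloid_of (t * s)%g).
Proof.
rewrite perm_opE; apply/ffunP => f; rewrite !ffunE; congr (nat_of_bool _)%:R.
apply/eqP/eqP => [e|->]; apply/ffunP => x.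
  have := congr1 (fun g : tabloid => g ((s^-1)%g x)) e.
  by rewrite !ffunE permKV invMg permM.
by rewrite !ffunE invMg permM permK.
Qed.

Lemma perm_op_polytabloid s t :
  perm_op s (polytabloid t) = polytabloid (t * s)%g.
Proof.
rewrite /polytabloid linear_sum /=.
rewrite [RHS](reindex_inj (conjg_inj s)) /=.
apply: eq_big => [u|u _].
  rewrite !inE; apply/forallP/forallP => h x.
    by have := h ((s^-1)%g x); rewrite conjgE invMg !permM permK.
  by have := h (s x); rewrite conjgE invMg !permM !permK.
rewrite linearZ /= odd_permJ; congr (_ *: _).
by rewrite -perm_op_tabloid -!comp_lfunE !perm_opM conjgC.
Qed.

Lemma perm_op_Specht s v :
  v \in Specht_space -> perm_op s v \in Specht_space.
Proof.
move=> vS; have : perm_op s v \in (perm_op s @: Specht_space)%VS.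
  exact: memv_img.
apply: subvP; rewrite limg_span; apply/span_subvP => w.
case/mapP => _ /mapP[t _ ->] ->; rewrite perm_op_polytabloid.
by apply/memv_span/map_f; rewrite mem_enum.
Qed.

Lemma Specht_opE s (v : Specht) : vsval (Specht_op s v) = perm_op s (vsval v).
Proof.
pose h (w : Specht) : Specht := vsproj Specht_space (perm_op s (vsval w)).
have h_lin : linear h by move=> c x y; rewrite /h !linearP.
pose H := GRing.isLinear.Build _ _ _ _ h h_lin.
pose hL : {linear Specht -> Specht} := HB.pack h H.
have -> : Specht_op s v = h v by exact: (lfunE hL).
by rewrite vsprojK // perm_op_Specht // subvsP.
Qed.

Lemma Specht_opM s s' : (Specht_op s \o Specht_op s')%VF = Specht_op (s' * s)%g.
Proof.
apply/lfunP => v; apply: subvs_inj.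
by rewrite comp_lfunE !Specht_opE -comp_lfunE perm_opM.
Qed.

Lemma Specht_op1 : Specht_op 1%g = \1%VF.
Proof.
by apply/lfunP => v; apply: subvs_inj; rewrite Specht_opE perm_op1 !id_lfunE.
Qed.

End Specht.

Section Modules.
Variables (C : numClosedFieldType) (n : nat).
Variable U : supermod (Clifford C n).
Variable la : seq nat.

Local Notation S := (Specht C n la).

Definition BV : svect C := svtens U S.

Definition pair_op (x : Clifford C n) (s : 'S_n) : end_ring BV :=
  tens_map (act U x) (Specht_op C la s).

Lemma pair_opM x y s s' :
  pair_op x s * pair_op y s' = pair_op (x * y) (s' * s)%g.
Proof.
rewrite /pair_op /act rmorphM -Specht_opM.
exact: tens_map_comp.
Qed.

Lemma pair_op1 : pair_op 1 1%g = 1.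
Proof. by rewrite /pair_op /act rmorph1 Specht_op1; apply: tens_map1. Qed.

Lemma pair_opN x s : pair_op (- x) s = - pair_op x s.
Proof.
rewrite /pair_op /act rmorphN -[- _]scaleN1r tens_mapZl scaleN1r.
by [].
Qed.

Lemma pair_op_gr p x s : sa_gr p x -> end_gr p (pair_op x s).
Proof. by move=> xp; apply/tens_map_gr/(sh_gr (sm_act U)). Qed.

(* t_i acts by 1/sqrt 2 (c_i - c_{i+1}) (x) s_i for i < n, and t_n acts by    *)
(* c_n (x) 1; no sign appears as CS_n is purely even.                         *)
Definition B_op (i : 'I_n) : send BV := pair_op (B_cliff C i) (B_perm i).

Fact B_op_odd i : sa_gr true (B_op i).
Proof. exact/pair_op_gr/B_cliff_odd. Qed.

Fact B_op_rel x y : B_eqn x y ->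
  ev (sa_scal (send BV)) B_op x = ev (sa_scal (send BV)) B_op y.
Proof.
case=> {x y} [i|i j ij jn|i j ij|i j ij jn]; rewrite ?ev_pow /= ?rmorphN ?rmorph1.
- rewrite expr2 pair_opM -expr2 B_cliff_sq B_perm_sq.
  exact: pair_op1.
- by rewrite !pair_opM B_cliff_braid // !mulgA B_perm_braid.
- have pp : (B_perm j * B_perm i * (B_perm j * B_perm i) = 1)%g.
    rewrite -{1}(B_perm_far ij) mulgA -(mulgA (B_perm i)).
    by rewrite B_perm_sq mulg1 B_perm_sq.
  rewrite expr2 !pair_opM pp -expr2 sq_of_anti ?B_cliff_sq //.
    by rewrite pair_opN; congr (- _); exact: pair_op1.
  exact: B_cliff_far.
- rewrite -[4%N]/(2 * 2)%N exprM !expr2 !pair_opM (B_perm_last jn) !mul1g.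
  rewrite B_perm_sq mulg1 -expr2 -expr2 -exprM B_cliff_last //.
  by rewrite pair_opN; congr (- _); exact: pair_op1.
Qed.

Definition Bmod : supermod (CB C n) :=
  SuperMod (lift (r := Relations (@B_homog C n)) B_op_odd B_op_rel).

Lemma Bmod_gen i : act Bmod (tB C i) = B_op i.
Proof. exact: (lift_gen (r := Relations (@B_homog C n)) B_op_odd B_op_rel). Qed.

Definition Dmod : supermod (CD C n) := pullback (D_incl C n) Bmod.

End Modules.

Section Classification.
Variables (C : numClosedFieldType) (n : nat).
Variable U : supermod (Clifford C n).

Definition D_splits (la : seq nat) (Dp Dm : supermod (CD C n)) : Prop :=
  [/\ direct_sum (Dmod U la) Dp Dm, ~ isomorphic Dp Dm,
      ungraded_simple Dp & ungraded_simple Dm].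

(* DPair la stands for D^{la, la'} and DSign s la for D^la_+ (s = true) or    *)
(* D^la_- (s = false).                                                        *)
Inductive Dlabel : Type :=
  | DPair of seq nat
  | DSign of bool & seq nat.

Definition Dlabel_valid (l : Dlabel) : bool :=
  match l with
  | DPair la => is_part n la && (conj_part la != la)
  | DSign _ la => is_part n la && (conj_part la == la)
  end.

(* DPair la only depends on the unordered pair {la, la'} *)
Definition same_Dlabel (l l' : Dlabel) : Prop :=
  match l, l' with
  | DPair la, DPair mu => mu = la \/ mu = conj_part la
  | DSign s la, DSign s' mu => s = s' /\ la = mu
  | _, _ => False
  end.

Definition Dlist (Dsign : bool -> seq nat -> supermod (CD C n)) (l : Dlabel) :
    supermod (CD C n) :=
  match l with
  | DPair la => Dmod U la
  | DSign s la => Dsign s la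
  end.

End Classification.

(* Main.v *)
From HB Require Import structures.
From mathcomp Require Import all_boot all_order all_fingroup all_algebra.
From mathcomp Require Import pgroup mxrepresentation.
From mathcomp Require Import generic_quotient zify boolp reals complex.
Require Import Defs.

Set Implicit Arguments.
Unset Strict Implicit.
Unset Printing Implicit Defensive.

Import Order.TTheory GRing.Theory Num.Theory passmx.
Local Open Scope ring_scope.
Local Open Scope quotient_scope.

(** Why the classification holds.

    Write [t_1, ..., t_n] for the generators of the algebra [CB]. The elements
    [c_n = t_n] and [c_i = - t_i c_(i+1) t_i] satisfy the Clifford relations,
    and [s_i = (c_i - c_(i+1)) t_i / sqrt 2] satisfy the Coxeter relations of
    the symmetric group and commute with all [c_j]. A [CB]-module is thus a
    Clifford module with a commuting action of the symmetric group. For [n]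
    even the volume element [c_1 ... c_n] anticommutes with every [c_i], so it
    acts on the simple module [U] as a multiple of the parity operator; hence
    [U] is simple even without its grading ([Clifford_irred]), and it maps
    nontrivially into every nonzero Clifford module ([cliff_hom]). It follows
    that [B^la], the tensor product of [U] and the Specht module [S^la], is
    simple over [CB] ([B_irred]), and that linear maps between the [B^la]
    compatible with the [c_i] reduce to maps between the [S^la]
    ([twisted_coefficient]).

    The subalgebra [CD] contains [t_1, ..., t_(n-1)] and is normalised by [t_n],
    and together with [t_n] it generates [CB]. This is Clifford theory in index
    two. If [h] is [CD]-linear then [h + t_n h t_n] is [CB]-linear, while
    [h - t_n h t_n] commutes with [t_1, ..., t_(n-1)] and anticommutes with
    [t_n], hence anticommutes with every [c_i] and every [s_i]. The first comes
    from a map [S^la -> S^mu] of representations, the second from a map that is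
    equivariant up to the sign character. As [S^la] tensored with the sign is
    [S^la'], a nonzero [CD]-linear map [B^la -> B^mu] forces [mu = la] or
    [mu = la'] ([D_hom_labels]). Conversely a sign-equivariant map, multiplied
    by the volume element on the factor [U], gives a nonzero [CD]-linear map
    [B^la' -> B^la] ([twisted_Bhom_ex]).

    A proper nonzero [CD]-submodule [W] of [B^la] satisfies
    [B^la = W + t_n W], a direct sum, and the operator equal to [1] on [W] and
    to [-1] on [t_n W] anticommutes with [t_n]; so it exists only if [la = la']
    ([D_irred]). If [la = la'], the even operator (volume) (x) (sign-equivariant
    map) has two eigenspaces exchanged by [t_n], and these are the two
    inequivalent halves ([D_splits_ex]).

    For completeness, a module [M] over [CD] is embedded in the induced
    [CB]-module on [M * M]. There the Clifford maps from [U] form a nonzero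
    representation of the symmetric group, which contains some [S^la]; this
    yields a nonzero [CD]-linear map [B^la -> M] ([D_factor]). That Specht
    modules exhaust the irreducible representations is obtained by counting:
    they are irreducible and pairwise non-isomorphic, and there are at least as
    many partitions as conjugacy classes, since permutations with the same cycle
    type are conjugate ([Specht_complete]).

    Gradings enter only through parity components: the even and odd parts of a
    linear map that commutes with the odd generators commute with them as well,
    and composing an odd one with the parity operator produces the sign in the
    definition of an odd homomorphism. So simple modules are isomorphic as soon
    as a nonzero map between them commutes with the generators
    ([intertwiner_iso]). All listed modules are simple without their grading,
    and Schur's lemma then leaves only scalars: type M ([irred_type_M]). *)

(** * Families of operators and Schur's lemma *)

(** Evaluates [linfun f] when linearity of [f] is a hypothesis and not a registered
    structure. *)
Lemma linfun_linE (K : fieldType) (aT rT : vectType K) (f : aT -> rT) (f_lin : linear f) x :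
  linfun f x = f x.
Proof.
pose H := GRing.isLinear.Build _ _ _ _ f f_lin.
pose hL : {linear aT -> rT} := HB.pack f H.
exact: (lfunE hL).
Qed.


Section Operators.
Variable C : numClosedFieldType.

Definition stable (I : Type) (V : vectType C) (T : I -> 'End(V)) (W : {vspace V}) : Prop :=
  forall i w, w \in W -> T i w \in W.

(** Irreducibility is stated for bare families of operators, so that it applies alike to
    group representations, to Clifford operators and to the generators of a presented
    algebra. *)
Definition irred (I : Type) (V : vectType C) (T : I -> 'End(V)) : Prop :=
  (fullv : {vspace V}) <> 0%VS /\
  forall W, stable T W -> W = 0%VS \/ W = fullv.

(** Equivariance up to a scalar [e i]. The twists that occur are the trivial one, the
    sign character, and the character that is [-1] on the last generator of [CB] only;
    kernels and images are stable for all of them. *)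
Definition twisted_hom (I : Type) (e : I -> C) (V V' : vectType C)
    (T : I -> 'End(V)) (T' : I -> 'End(V')) (h : 'Hom(V, V')) : Prop :=
  forall i v, h (T i v) = e i *: T' i (h v).

Definition intertwines (I : Type) (V V' : vectType C)
    (T : I -> 'End(V)) (T' : I -> 'End(V')) (h : 'Hom(V, V')) : Prop :=
  forall i v, h (T i v) = T' i (h v).

Lemma lker_stable I (e : I -> C) (V V' : vectType C) (T : I -> 'End(V)) (T' : I -> 'End(V')) h :
  twisted_hom e T T' h -> stable T (lker h).
Proof. by move=> hT i w; rewrite !memv_ker hT => /eqP ->; rewrite linear0 scaler0. Qed.

Lemma limg_stable I (e : I -> C) (V V' : vectType C) (T : I -> 'End(V)) (T' : I -> 'End(V')) h :
  (forall i, e i != 0) -> twisted_hom e T T' h -> stable T' (limg h).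
Proof.
move=> e0 hT i w /memv_imgP[v _ ->].
by rewrite -[T' i _](scalerK (e0 i)) -hT -linearZ memv_img ?memvf.
Qed.

Lemma lker_neq_full (V V' : vectType C) (h : 'Hom(V, V')) : h != 0 -> lker h <> fullv.
Proof.
move=> h0 e; case/eqP: h0; apply/lfunP => v; rewrite lfunE /=.
by apply/eqP; rewrite -memv_ker e memvf.
Qed.

(** Schur's lemma: kernel and image are stable because the scalars [e i] are invertible.
    *)
Lemma twisted_iso I (e : I -> C) (V V' : vectType C) (T : I -> 'End(V)) (T' : I -> 'End(V')) h :
  (forall i, e i != 0) -> irred T -> irred T' -> twisted_hom e T T' h -> h != 0 ->
  lker h = 0%VS /\ limg h = fullv.
Proof.
move=> e0 [_ iT] [_ iT'] hT h0; split.
  by case: (iT _ (lker_stable hT)) => // /(lker_neq_full h0).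
case: (iT' _ (limg_stable e0 hT)) => // e1.
case/eqP: h0; apply/lfunP => v; rewrite lfunE /=; apply/eqP.
by rewrite -memv0 -e1 memv_img ?memvf.
Qed.

Lemma twisted_homE I (V V' : vectType C) (T : I -> 'End(V)) (T' : I -> 'End(V')) h :
  intertwines T T' h <-> twisted_hom (fun=> 1) T T' h.
Proof. by split=> hT i v; rewrite hT scale1r. Qed.

Lemma twisted_inv I (e : I -> C) (V V' : vectType C) (T : I -> 'End(V)) (T' : I -> 'End(V')) h :
  (forall i, e i != 0) -> lker h = 0%VS -> limg h = fullv ->
  twisted_hom e T T' h -> twisted_hom (fun i => (e i)^-1) T' T h^-1%VF.
Proof.
move=> e0 k0 i0 hT i v; have kq : lker h == 0%VS by apply/eqP.
have -> : T' i v = (e i)^-1 *: h (T i (h^-1%VF v)).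
  by rewrite hT scalerK // limg_lfunVK // i0 memvf.
by rewrite linearZ /= lker0_lfunK.
Qed.

Lemma sub_lfunE (V V' : vectType C) (f g : 'Hom(V, V')) v : (f - g) v = f v - g v.
Proof. by rewrite add_lfunE opp_lfunE. Qed.

Lemma eigen_ex (V : vectType C) (g : 'End(V)) : (fullv : {vspace V}) <> 0%VS ->
  exists a v, v != 0 /\ g v = a *: v.
Proof.
move=> V0; pose e := vbasis (fullv : {vspace V}).
have dV : (0 < \dim (fullv : {vspace V}))%N by rewrite lt0n dimv_eq0; apply/eqP.
have [a /eigenvalueP[u ua u0]] := eigenvalue_closed (passmx.mxof e e g) dV.
have eb : basis_of fullv e := vbasisP _.
exists a, (passmx.vecof e u); split.
  by rewrite passmx.vecof_eq0 // (basis_free eb).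
by rewrite (passmx.hom_vecof _ eb) ua linearZ.
Qed.

(** An eigenspace of [g] is stable under the family, hence everything. *)
Lemma schur_scalar I (V : vectType C) (T : I -> 'End(V)) g : irred T -> intertwines T T g ->
  exists a, g = a *: \1%VF.
Proof.
move=> [V0 iT] gT; have [a [v [v0 va]]] := eigen_ex g V0.
exists a; apply/eqP; rewrite -subr_eq0 -[_ == 0]negbK; apply/negP => h0.
have st : stable T (lker (g - a *: \1%VF)).
  move=> i w; rewrite !memv_ker !sub_lfunE !scale_lfunE !id_lfunE gT => /eqP e.
  by rewrite -linearZ -linearB /= e linear0.
case: (iT _ st) => [e|/(lker_neq_full h0)//].
have : v \in lker (g - a *: \1%VF).
  by rewrite memv_ker sub_lfunE scale_lfunE id_lfunE va subrr.
by rewrite e memv0 (negbTE v0).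
Qed.

End Operators.

(** * Partitions and the cells of a Young diagram *)

Section Cells.
Variables (n : nat) (la : seq nat).
Hypothesis hla : is_part n la.

Local Notation row := (@cell_row n la).
Local Notation col := (@cell_col n la).

Lemma part_sum_eq : sumn la = n.
Proof. by case/and3P: hla => _ _ /eqP. Qed.

Lemma part_pos r : (r < size la)%N -> (0 < nth 0%N la r)%N.
Proof.
case/and3P: hla => _ h0 _ rs; rewrite lt0n; apply: contraNneq h0 => <-.
exact: mem_nth.
Qed.

Lemma part_nth_anti r r' : (r' <= r)%N -> (nth 0%N la r <= nth 0%N la r')%N.
Proof.
case/and3P: hla => hs _ _ le_r.
have [rs|sr] := ltnP r (size la); last by rewrite nth_default.
have tr : transitive geq by move=> a b c /= h1 h2; apply: leq_trans h2 h1.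
apply: (sorted_leq_nth tr (fun x => leqnn x) 0%N hs) => //; rewrite inE //.
exact: leq_ltn_trans rs.
Qed.

Lemma cell_col_lt (k : 'I_n) : (col k < nth 0%N la (row k))%N.
Proof. by apply: reshape_offsetP; rewrite part_sum_eq. Qed.

Lemma cell_row_lt (k : 'I_n) : (row k < size la)%N.
Proof. by apply: reshape_indexP; rewrite part_sum_eq. Qed.

Lemma cell_col_ltn (k : 'I_n) : (col k < n)%N.
Proof. by rewrite (leq_ltn_trans _ (ltn_ord k)) // /cell_col /reshape_offset leq_subr. Qed.

Lemma cell_ex r c : (c < nth 0%N la r)%N -> exists k : 'I_n, row k = r /\ col k = c.
Proof.
move=> crl; have := flatten_indexP crl; rewrite part_sum_eq => hk.
exists (Ordinal hk); rewrite /cell_row /cell_col /=.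
by rewrite flatten_indexKl // flatten_indexKr.
Qed.

Lemma cell_inj k k' : row k = row k' -> col k = col k' -> k = k'.
Proof.
move=> er ec; apply: ord_inj.
by rewrite -(reshape_indexK la k) -(reshape_indexK la k') -/(row k) -/(col k) er ec.
Qed.

(** Cells are numbered in reading order, so the cells of the first [i] rows are an
    initial segment of [0, ..., n-1]. *)
Lemma card_rows i : #|[set k | (row k < i)%N]| = sumn (take i la).
Proof.
have [li|il] := leqP (size la) i.
  rewrite take_oversize // part_sum_eq -[RHS]card_ord; apply: eq_card => k.
  by rewrite !inE (leq_trans (cell_row_lt k)).
have rE (k : 'I_n) : (row k < i)%N = (k < sumn (take i la))%N.
  rewrite -{1}(reshape_indexK la k) /flatten_index -/(row k) -/(col k).
  have := cell_col_lt k; have := cell_row_lt k.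
  move: (row k) (col k) => r c rs crl.
  have tk m : (m < size la)%N -> sumn (take m.+1 la) = (sumn (take m la) + nth 0 la m)%N.
    by move=> ms; rewrite (take_nth 0%N ms) sumn_rcons.
  have mono a b : (a <= b)%N -> (sumn (take a la) <= sumn (take b la))%N.
    by move=> ab; rewrite -(subnKC ab) takeD sumn_cat leq_addr.
  apply/idP/idP => h.
    by apply: leq_trans (mono _ _ h); rewrite tk // ltn_add2l.
  rewrite ltnNge; apply/negP => ir; have := mono _ _ ir; lia.
have le_n : (sumn (take i la) <= n)%N.
  by rewrite -part_sum_eq -{2}(cat_take_drop i la) sumn_cat leq_addr.
have w_inj : injective (widen_ord le_n) by move=> x y /(congr1 val) /= /ord_inj.
rewrite -[RHS]card_ord -(card_imset _ w_inj).
apply: eq_card => k; rewrite !inE rE; apply/idP/imsetP => [h|[j _ ->] /=]; last exact: ltn_ord.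
by exists (Ordinal h) => //; apply: ord_inj.
Qed.

Section Inj.
Variable f : 'I_n -> nat.
Hypothesis f_inj : forall x y, col x = col y -> f x = f y -> x = y.

(** A column of the diagram occupies consecutive rows starting from the top, so among
    the functions injective on that column the row number is the one that takes small
    values most often. *)
Lemma card_col_le c i :
  (#|[set x | (col x == c) && (f x < i)%N]| <=
   #|[set x | (col x == c) && (row x < i)%N]|)%N.
Proof.
have [/existsP[y /andP[/eqP yc iy]]|/existsPn no] :=
  boolP [exists y, (col y == c) && (i <= row y)%N].
  have cell (r : 'I_i) : exists k, row k = r /\ col k = c.
    apply: cell_ex; rewrite -yc; apply: leq_trans (cell_col_lt y) _.
    by apply: part_nth_anti; rewrite (leq_trans (ltnW (ltn_ord r))).
  pose g (r : 'I_i) := odflt y [pick k | (row k == r :> nat) && (col k == c)].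
  have gP r : row (g r) = r /\ col (g r) = c.
    rewrite /g; case: pickP => [k /andP[/eqP ? /eqP ?] //|no].
    by have [k [kr kc]] := cell r; have := no k; rewrite kr kc !eqxx.
  have le_i : (i <= #|[set x | (col x == c) && (row x < i)%N]|)%N.
    rewrite -[i in (i <= _)%N]card_ord -(card_imset predT (f := g)).
      apply: subset_leq_card; apply/subsetP => _ /imsetP[r _ ->].
      by rewrite inE; have [-> ->] := gP r; rewrite eqxx ltn_ord.
    by move=> r r' e; apply: ord_inj; have [<- _] := gP r; rewrite e; have [-> _] := gP r'.
  apply: leq_trans le_i.
  case: i iy {cell g gP} => [|i] iy.
    by rewrite leqn0 cards_eq0; apply/eqP/setP => x; rewrite !inE ltn0 andbF.
  rewrite -[X in (_ <= X)%N](card_ord i.+1).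
  rewrite -(card_in_imset (f := fun x => inord (f x) : 'I_i.+1)).
    by apply: max_card.
  move=> x x'; rewrite !inE => /andP[/eqP xc fx] /andP[/eqP xc' fx'] e.
  apply: f_inj; first by rewrite xc xc'.
  by have := congr1 val e; rewrite /= !inordK.
apply: subset_leq_card; apply/subsetP => x; rewrite !inE => /andP[xc _].
by rewrite xc /=; have := no x; rewrite xc /= -ltnNge.
Qed.

Lemma card_split (h : 'I_n -> nat) i :
  #|[set x | (h x < i)%N]| =
  (\sum_(c < n) #|[set x | (col x == c :> nat) && (h x < i)%N]|)%N.
Proof.
rewrite -sum1_card (partition_big (fun x => Ordinal (cell_col_ltn x)) predT) //=.
apply: eq_bigr => c _; rewrite -sum1_card; apply: eq_bigl => x.
by rewrite !inE -val_eqE /= andbC.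
Qed.

(** The counting behind the dominance order. *)
Lemma card_below_le i :
  (#|[set x | (f x < i)%N]| <= #|[set x | (row x < i)%N]|)%N.
Proof. by rewrite !card_split; apply: leq_sum => c _; apply: card_col_le. Qed.

(** If the level sets of [f] have the sizes of the rows, equality holds in every column
    in [card_col_le]; then the values of [f] on a column are exactly the rows it meets,
    and [f] is the row number after a permutation within columns. *)
Lemma col_sort :
  (forall i, #|[set x | (f x < i)%N]| = #|[set x | (row x < i)%N]|) ->
  exists p : 'S_n, forall x, col (p x) = col x /\ row (p x) = f x.
Proof.
move=> fE.
have ex x : exists k, row k = f x /\ col k = col x.
  apply: cell_ex; rewrite ltnNge; apply/negP => hx.

  (* If [f x] exceeded the height of the column of [x], all cells of that column would
     lie in rows above [f x], and [x] itself would be missed by [f]. *)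
  pose c := Ordinal (cell_col_ltn x).
  have col_low y : col y = col x -> (row y < f x)%N.
    move=> e; rewrite ltnNge; apply/negP => h.
    have := leq_trans (cell_col_lt y) (leq_trans (part_nth_anti h) hx).
    by rewrite e ltnn.
  have eqc : #|[set y | (col y == col x) && (f y < f x)%N]| =
             #|[set y | (col y == col x) && (row y < f x)%N]|.
    apply/eqP; rewrite eqn_leq card_col_le /=.
    have := fE (f x); rewrite !card_split (bigD1 c) //= [in RHS](bigD1 c) //= => e.
    rewrite -(leq_add2r (\sum_(d < n | d != c)
      #|[set y | (col y == d :> nat) && (row y < f x)%N]|)).
    by rewrite -e leq_add2l; apply: leq_sum => d _; apply: card_col_le.
  have : ([set y | (col y == col x) && (f y < f x)%N] \proper
         [set y | (col y == col x) && (row y < f x)%N]).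
    apply/properP; split.
      by apply/subsetP => y; rewrite !inE => /andP[/eqP e _]; rewrite e eqxx col_low.
    by exists x; rewrite !inE eqxx /= ?ltnn // col_low.
  by move/proper_card; rewrite eqc ltnn.
pose g x := odflt x [pick k | (row k == f x) && (col k == col x)].
have gP x : row (g x) = f x /\ col (g x) = col x.
  rewrite /g; case: pickP => [k /andP[/eqP ? /eqP ?] //|no].
  by have [k [kr kc]] := ex x; have := no k; rewrite kr kc !eqxx.
have g_inj : injective g.
  move=> x y e; have [rx cx] := gP x; have [ry cy] := gP y.
  by apply: f_inj; rewrite -?cx -?cy -?rx -?ry e.
by exists (perm g_inj) => x; rewrite permE; have [-> ->] := gP x.
Qed.

End Inj.
End Cells.

(** Antisymmetry of the dominance order. *)
Lemma part_eq n la mu : is_part n la -> is_part n mu ->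
  (forall i, sumn (take i la) = sumn (take i mu)) -> la = mu.
Proof.
move=> hla hmu e.
have nthE (s : seq nat) i : nth 0%N s i = (sumn (take i.+1 s) - sumn (take i s))%N.
  have [is_|si] := ltnP i (size s); last first.
    by rewrite nth_default // !take_oversize ?subnn // (leq_trans si).
  by rewrite (take_nth 0%N is_) sumn_rcons addKn.
have nthe i : nth 0%N la i = nth 0%N mu i by rewrite !nthE !e.
apply: (@eq_from_nth _ 0%N) => [|i _]; last exact: nthe.
apply/eqP; rewrite eqn_leq ![(size _ <= _)%N]leqNgt; apply/andP; split; apply/negP => lt.
  have := part_pos hla lt.
  rewrite nthe.
  rewrite nth_default; last exact: leqnn.
  by rewrite ltnn.
have := part_pos hmu lt.
rewrite -nthe nth_default; last exact: leqnn.
by rewrite ltnn.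
Qed.

Section Conj.
Variables (n : nat) (la : seq nat).
Hypothesis hla : is_part n la.

(** Cell [(r, c)] belongs to the diagram of [la] if and only if it belongs to the one
    whose column lengths are the entries of [conj_part la]. *)
Lemma count_gt_part c r : (r < count (fun x => (c < x)%N) la)%N = (c < nth 0%N la r)%N.
Proof.
have : sorted geq la by case/and3P: hla.
elim: la r => [|a l IHl] r /= hs; first by rewrite nth_nil.
have ap : all (geq a) l.
  by apply: order_path_min hs => x y z /= h1 h2; apply: leq_trans h2 h1.
have {}IHl := IHl _ (path_sorted hs).
case: (ltnP c a) => ca /=; first by case: r => //= r; rewrite -IHl ltnS.
have -> : count (fun x => (c < x)%N) l = 0%N.
  apply/eqP; rewrite -leqn0 leqNgt -has_count; apply/hasPn => x xl.
  by rewrite -leqNgt; exact: leq_trans (allP ap _ xl) ca.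
rewrite ltn0; apply/esym/negbTE; rewrite -leqNgt.
case: r => [|r] //=; have [rl|lr] := ltnP r (size l); last by rewrite nth_default.
exact: leq_trans (allP ap _ (mem_nth 0%N rl)) ca.
Qed.

Lemma nth_conj_part c r : (r < nth 0%N (conj_part la) c)%N = (c < nth 0%N la r)%N.
Proof.
rewrite /conj_part; have [ch|hc] := ltnP c (head 0%N la).
  by rewrite nth_mkseq // count_gt_part.
rewrite nth_default ?size_mkseq // ltn0; apply/esym/negbTE; rewrite -leqNgt.
by rewrite (leq_trans (part_nth_anti hla (leq0n r))) // nth0.
Qed.

Lemma conj_part_pos : 0%N \notin conj_part la.
Proof.
apply/negP => /mapP[c]; rewrite mem_iota add0n /= => ch.
by move/esym/eqP; rewrite -leqn0 leqNgt count_gt_part nth0 ch.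
Qed.

Lemma sumn_conj_part : sumn (conj_part la) = n.
Proof.
rewrite -(part_sum_eq hla) /conj_part.
have : sorted geq la by case/and3P: hla.
elim: (la) => [|a l IHl] //= hs.
have ap : all (geq a) l.
  by apply: order_path_min hs => x y z /= h1 h2; apply: leq_trans h2 h1.
rewrite -{}IHl ?(path_sorted hs) // !sumnE !big_map.
have -> : (\sum_(j <- iota 0 (head 0%N l)) count (fun r => (j < r)%N) l =
   \sum_(j <- iota 0 a) count (fun r => (j < r)%N) l)%N.
  have hl : (head 0%N l <= a)%N by case: l ap {hs} => //= b l /andP[].
  rewrite -[in RHS](subnKC hl) iotaD big_cat /= [X in (_ + X)%N]big1_seq ?addn0 //.
  move=> j /=; rewrite add0n mem_iota => /andP[hj _].
  apply/eqP; rewrite -leqn0 leqNgt -has_count; apply/hasPn => x xl.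
  rewrite -leqNgt (leq_trans _ hj) //.
  case: l hs xl {ap hl hj} => //= b l /andP[_ hs]; rewrite inE => /orP[/eqP -> //|xl].
  by apply: (allP (order_path_min _ hs)) => // u v w /= h1 h2; apply: leq_trans h2 h1.
rewrite big_split /=; congr (_ + _)%N.
rewrite -[RHS](size_iota 0) -sum1_size big_seq [RHS]big_seq.
by apply: eq_bigr => j; rewrite mem_iota add0n /= => ->.
Qed.

Lemma is_part_conj : is_part n (conj_part la).
Proof.
apply/and3P; split; last by rewrite sumn_conj_part.
  apply/(sortedP 0%N) => i _ /=; rewrite leqNgt; apply/negP.
  by rewrite nth_conj_part => /ltnW; rewrite -nth_conj_part ltnn.
exact: conj_part_pos.
Qed.

End Conj.

Lemma conj_partK n la : is_part n la -> conj_part (conj_part la) = la.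
Proof.
move=> hla; have hc := is_part_conj hla.
apply: (part_eq (is_part_conj hc) hla) => i.
suff e j : nth 0%N (conj_part (conj_part la)) j = nth 0%N la j.
  elim: i => [|i IHi]; first by rewrite !take0.
  have tk s : sumn (take i.+1 s) = (sumn (take i s) + nth 0 s i)%N.
    have [is_|si] := ltnP i (size s); first by rewrite (take_nth 0%N is_) sumn_rcons.
    by rewrite nth_default // !take_oversize ?addn0 // (leq_trans si).
  by rewrite !tk e IHi.
apply/eqP; rewrite eqn_leq ![(nth _ _ _ <= _)%N]leqNgt (nth_conj_part hc) (nth_conj_part hla) ltnn /=.
by rewrite -(nth_conj_part hla) -(nth_conj_part hc) ltnn.
Qed.

Section Transpose.
Variables (n : nat) (la : seq nat).
Hypothesis hla : is_part n la.

(** Transposition of diagrams, as a permutation of cell numbers. *)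
Lemma transpose_cells : exists tr : 'S_n, forall k,
  cell_row (conj_part la) (tr k) = cell_col la k /\
  cell_col (conj_part la) (tr k) = cell_row la k.
Proof.
have hc := is_part_conj hla.
have ex (k : 'I_n) : exists k' : 'I_n, cell_row (conj_part la) k' = cell_col la k /\
  cell_col (conj_part la) k' = cell_row la k.
  by apply: (cell_ex hc); rewrite (nth_conj_part hla) // cell_col_lt.
pose g (k : 'I_n) := odflt k [pick k' : 'I_n | (cell_row (conj_part la) k' == cell_col la k)
  && (cell_col (conj_part la) k' == cell_row la k)].
have gP x : cell_row (conj_part la) (g x) = cell_col la x /\
  cell_col (conj_part la) (g x) = cell_row la x.
  rewrite /g; case: pickP => [k /andP[/eqP ? /eqP ?] //|no].
  by have [k [kr kc]] := ex x; have := no k; rewrite kr kc !eqxx.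
have g_inj : injective g.
  move=> x y e; have [rx cx] := gP x; have [ry cy] := gP y.
  by apply: (@cell_inj _ la); rewrite -?cx -?cy -?rx -?ry e.
by exists (perm g_inj) => x; rewrite permE; apply: gP.
Qed.

End Transpose.

(** * Polytabloids and the column antisymmetrizer *)

Section Sym.
Variables (C : numClosedFieldType) (n : nat).

Lemma col_stab1 la (t : 'S_n) : 1%g \in col_stab la t.
Proof. by rewrite inE; apply/forallP => x; rewrite perm1. Qed.

Lemma col_stabM la (t s s' : 'S_n) :
  s' \in col_stab la t -> ((s * s')%g \in col_stab la t) = (s \in col_stab la t).
Proof.
rewrite !inE => /forallP h; apply/forallP/forallP => h' x.
  by have := h' x; rewrite permM (eqP (h _)).
by rewrite permM (eqP (h _)) h'.
Qed.

Lemma col_stabMl la (t s s' : 'S_n) :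
  s' \in col_stab la t -> ((s' * s)%g \in col_stab la t) = (s \in col_stab la t).
Proof.
rewrite !inE => /forallP h; apply/forallP/forallP => h' x.
  by have := h' ((s'^-1)%g x); rewrite permM permKV => /eqP ->;
    rewrite -{2}(permKV s' x) (eqP (h _)).
by rewrite permM (eqP (h' _)) (eqP (h _)).
Qed.

Lemma col_stabV la (t s : 'S_n) :
  ((s^-1)%g \in col_stab la t) = (s \in col_stab la t).
Proof.
have aux u : u \in col_stab la t -> (u^-1)%g \in col_stab la t.
  by move=> hu; rewrite -(col_stabM _ hu) mulVg col_stab1.
by apply/idP/idP => /aux //; rewrite invgK.
Qed.

(** The signed column sum of the tableau [t] of shape [la], acting on tabloids of an
    arbitrary shape [mu]; comparing two shapes needs both. *)
Definition colsum (la mu : seq nat) (t : 'S_n) : 'End(tabloid_space C n mu) :=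
  \sum_(s in col_stab la t) (-1) ^+ s *: perm_op C mu s.

(** Column permutations are absorbed up to sign. *)
Lemma colsum_perm la mu t s : s \in col_stab la t ->
  (colsum la mu t \o perm_op C mu s)%VF = (-1) ^+ s *: colsum la mu t.
Proof.
move=> hs; apply/lfunP => v; rewrite comp_lfunE scale_lfunE /colsum !sum_lfunE scaler_sumr.
rewrite [RHS](reindex_inj (mulgI s)) /=.
apply: eq_big => [u|u hu]; first by rewrite col_stabMl.
rewrite !scale_lfunE -comp_lfunE perm_opM scalerA odd_permM signr_addb mulrA -expr2.
by rewrite sqrr_sign mul1r.
Qed.

Lemma polytabloidE la t :
  polytabloid C la t = colsum la la t (tabloid_vec C (tabloid_of la t)).
Proof.
by rewrite /colsum sum_lfunE; apply: eq_bigr => s _; rewrite scale_lfunE.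
Qed.

Lemma perm_op_vec mu s (f : tabloid n mu) :
  perm_op C mu s (tabloid_vec C f) = tabloid_vec C [ffun x => f ((s^-1)%g x)].
Proof.
rewrite perm_opE; apply/ffunP => g; rewrite !ffunE; congr (nat_of_bool _)%:R.
apply/eqP/eqP => [e|->]; apply/ffunP => x.
  by rewrite -e !ffunE permKV.
by rewrite !ffunE permK.
Qed.

(** The transposition [tperm x y] fixes the tabloid and is an odd column permutation, so
    the antisymmetrized tabloid equals its opposite. *)
Lemma colsum_vec0 la mu (t : 'S_n) (f : tabloid n mu) x y :
  x != y -> cell_col la ((t^-1)%g x) = cell_col la ((t^-1)%g y) -> f x = f y ->
  colsum la mu t (tabloid_vec C f) = 0.
Proof.
move=> xy cxy fxy; set v := tabloid_vec C f.
have hs : tperm x y \in col_stab la t.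
  rewrite inE; apply/forallP => z.
  by case: (tpermP x y z) => [->|->|//]; rewrite cxy.
have e : perm_op C mu (tperm x y) v = v.
  rewrite perm_op_vec; congr (tabloid_vec _ _); apply/ffunP => z; rewrite ffunE tpermV.
  by case: (tpermP x y z) => [->|->|//].
have := congr1 (fun h : 'End(_) => h v) (colsum_perm mu hs).
rewrite comp_lfunE e scale_lfunE odd_tperm xy expr1 scaleN1r => /eqP.
rewrite -addr_eq0 -mulr2n -scaler_nat scaler_eq0 pnatr_eq0 /=.
by move/eqP.
Qed.

Lemma tabloid_of_val la (hla : is_part n la) (t : 'S_n) x :
  tabloid_of la t x = cell_row la ((t^-1)%g x) :> nat.
Proof. by rewrite ffunE inordK // ltnW // ltnS cell_row_lt. Qed.

(** Contrapositive of the sign lemma [colsum_vec0]. *)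
Lemma colsum_vec_inj la mu (hmu : is_part n mu) (t t' : 'S_n) :
  colsum la mu t (tabloid_vec C (tabloid_of mu t')) != 0 ->
  forall x y, cell_col la x = cell_col la y ->
    cell_row mu ((t'^-1)%g (t x)) = cell_row mu ((t'^-1)%g (t y)) -> x = y.
Proof.
move=> nz x y cxy rxy; apply: contra_neq_eq nz => xy.
apply: (@colsum_vec0 la mu t _ (t x) (t y)).
- by rewrite (inj_eq perm_inj).
- by rewrite !permK.
- by apply: ord_inj; rewrite !tabloid_of_val.
Qed.

Lemma card_perm_rows mu (s : 'S_n) i :
  #|[set x | (cell_row mu (s x) < i)%N]| = #|[set x : 'I_n | (cell_row mu x < i)%N]|.
Proof.
rewrite -(card_imset _ (@perm_inj _ s)); apply: eq_card => y.
rewrite !inE; apply/imsetP/idP => [[x] |h]; first by rewrite inE => h ->.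
by exists ((s^-1)%g y); rewrite ?inE permKV.
Qed.

(** A tabloid of shape [mu] that survives antisymmetrization along the columns of [t]
    has distinct rows along each column, so [card_below_le] compares the partial sums.
    *)
Lemma colsum_dominance la mu (hla : is_part n la) (hmu : is_part n mu) (t t' : 'S_n) :
  colsum la mu t (tabloid_vec C (tabloid_of mu t')) != 0 ->
  forall i, (sumn (take i mu) <= sumn (take i la))%N.
Proof.
move=> nz i; have inj := colsum_vec_inj hmu nz.
have := card_below_le hla inj i.
have -> : #|[set x | (cell_row mu ((t'^-1)%g (t x)) < i)%N]| = sumn (take i mu).
  rewrite -(card_rows hmu) -(card_perm_rows mu (t * t'^-1)%g).
  by apply: eq_card => x; rewrite !inE permM.
by rewrite card_rows.
Qed.

(** For equal shapes a surviving tabloid is obtained from the tabloid of [t] by a column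
    permutation ([col_sort]), so it is sent to a multiple of the polytabloid of [t]. *)
Lemma colsum_self la (hla : is_part n la) (t t' : 'S_n) :
  exists c, colsum la la t (tabloid_vec C (tabloid_of la t')) = c *: polytabloid C la t.
Proof.
have [->|nz] := eqVneq (colsum la la t (tabloid_vec C (tabloid_of la t'))) 0.
  by exists 0; rewrite scale0r.
have inj := colsum_vec_inj hla nz.
have cE i : #|[set x | (cell_row la ((t'^-1)%g (t x)) < i)%N]| =
    #|[set x : 'I_n | (cell_row la x < i)%N]|.
  rewrite -(card_perm_rows la (t * t'^-1)%g).
  by apply: eq_card => x; rewrite !inE permM.
have [p pP] := col_sort hla inj cE.
pose s := (t^-1 * p * t)%g.
have hs : s \in col_stab la t.
  by rewrite inE; apply/forallP => x; rewrite !permM permK; have [-> _] := pP ((t^-1)%g x).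
exists ((-1) ^+ s).
have -> : tabloid_of la t' = tabloid_of la (t * s^-1)%g.
  apply/ffunP => x; rewrite !ffunE; congr inord.
  have -> : ((t * s^-1)^-1 = t^-1 * p)%g by rewrite invMg invgK /s mulgK.
  by have [_] := pP ((t^-1)%g x); rewrite permKV !permM => ->.
rewrite -perm_op_tabloid -comp_lfunE colsum_perm ?col_stabV // odd_permV.
by rewrite scale_lfunE -polytabloidE.
Qed.

Lemma Specht_span la v : v \in Specht_space C n la ->
  exists k : 'S_n -> C, v = \sum_t k t *: polytabloid C la t.
Proof.
move=> /coord_span ->; eexists (fun t => coord _ (enum_rank t) v).
rewrite [RHS](reindex _ (onW_bij _ (@enum_val_bij _))) /=.
by apply: eq_bigr => i _; rewrite enum_valK nth_image.
Qed.

Lemma colsum_span la (hla : is_part n la) (t : 'S_n) v :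
  v \in Specht_space C n la ->
  exists c, colsum la la t v = c *: polytabloid C la t.
Proof.
have e_c t' : exists c, colsum la la t (polytabloid C la t') = c *: polytabloid C la t.
  rewrite /polytabloid linear_sum /=; elim/big_rec: _ => [|s x _ [c e]].
    by exists 0; rewrite scale0r.
  have [d ed] := colsum_self hla t (t' * s)%g.
  rewrite linearZ /= perm_op_tabloid ed.
  by rewrite e scalerA -scalerDl; eexists.
move=> /Specht_span[k ->]; rewrite linear_sum /=; elim/big_rec: _ => [|t' x _ [c e]].
  by exists 0; rewrite scale0r.
rewrite linearZ /= e.
by have [d ->] := e_c t'; rewrite scalerA -scalerDl; eexists.
Qed.

Lemma perm_op_col la (t s : 'S_n) : s \in col_stab la t ->
  perm_op C la s (polytabloid C la t) = (-1) ^+ s *: polytabloid C la t.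
Proof.
move=> hs; rewrite polytabloidE /colsum sum_lfunE linear_sum scaler_sumr /=.
rewrite [RHS](reindex_inj (mulIg s)) /=.
apply: eq_big => [u|u hu]; first by rewrite col_stabM.
rewrite !scale_lfunE linearZ /= scalerA odd_permM signr_addb [in RHS]mulrCA.
by rewrite -expr2 sqrr_sign mulr1 -comp_lfunE perm_opM.
Qed.

Lemma colsum_poly la (t : 'S_n) :
  colsum la la t (polytabloid C la t) = #|col_stab la t|%:R *: polytabloid C la t.
Proof.
rewrite {1}/colsum sum_lfunE -sum1_card natr_sum scaler_suml.
apply: eq_bigr => s hs; rewrite scale_lfunE perm_op_col // scalerA -expr2.
by rewrite sqrr_sign.
Qed.

Lemma card_col_stab_neq0 la (t : 'S_n) : #|col_stab la t|%:R != 0 :> C.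
Proof. by rewrite pnatr_eq0 -lt0n; apply/card_gt0P; exists 1%g; apply: col_stab1. Qed.

Lemma polytabloid_mem la (t : 'S_n) : polytabloid C la t \in Specht_space C n la.
Proof. by apply/memv_span/map_f; rewrite mem_enum. Qed.

(** The Hermitian form for which tabloids are orthonormal. It is positive definite, so a
    subspace meets its orthogonal trivially. *)
Definition form mu (u v : {ffun tabloid n mu -> C^o}) : C := \sum_f (u f)^* * v f.

(** The column antisymmetrizer is self-adjoint; pairing with a polytabloid therefore
    reads off one coefficient of the antisymmetrized vector. *)
Lemma form_poly mu (t : 'S_n) u :
  form u (polytabloid C mu t) =
  ((colsum mu mu t u : {ffun _ -> C^o}) (tabloid_of mu t))^*.
Proof.
rewrite /form /polytabloid /colsum sum_lfunE sum_ffunE rmorph_sum /=.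
transitivity (\sum_(s in col_stab mu t) (-1) ^+ s * ((u (tabloid_of mu (t * s)%g))^* : C)).
  transitivity (\sum_f \sum_(s in col_stab mu t)
      (u f)^* * ((-1) ^+ s * (f == tabloid_of mu (t * s)%g)%:R)).
    apply: eq_bigr => f _; rewrite sum_ffunE mulr_sumr; apply: eq_bigr => s _.
    by rewrite perm_op_tabloid !ffunE.
  rewrite exchange_big; apply: eq_bigr => s _ /=.
  rewrite (bigD1 (tabloid_of mu (t * s)%g)) //= big1 ?addr0 => [|f /negbTE ->].
    by rewrite eqxx mulr1 mulrC.
  by rewrite !mulr0.
rewrite [RHS](reindex_inj invg_inj) /=; apply: eq_big => s; first by rewrite col_stabV.
move=> _; rewrite scale_lfunE perm_opE !ffunE rmorphM /= rmorph_sign odd_permV.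
congr (_ * (u _)^*); apply/ffunP => x.
by rewrite !ffunE invMg permM.
Qed.

Lemma form_sum mu (u : tabloid_space C n mu) I (r : seq I) (F : I -> tabloid_space C n mu) (k : I -> C) :
  form u (\sum_(i <- r) k i *: F i) = \sum_(i <- r) k i * form u (F i).
Proof.
rewrite /form; under eq_bigr do rewrite sum_ffunE mulr_sumr.
rewrite exchange_big; apply: eq_bigr => i _; rewrite mulr_sumr.
by apply: eq_bigr => f _; rewrite !ffunE /GRing.scale /= mulrCA.
Qed.

Lemma form_eq0 mu (u : tabloid_space C n mu) : form u u = 0 -> u = 0.
Proof.
move/eqP; rewrite psumr_eq0 => [/allP h|f _]; last by rewrite mulrC mul_conjC_ge0.
apply/ffunP => f; have := h f (mem_index_enum f).
by rewrite mulrC mul_conjC_eq0 => /eqP ->; rewrite ffunE.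
Qed.

(** Otherwise [u] would be orthogonal to all polytabloids, hence to itself. *)
Lemma Specht_colsum_neq0 la u : u \in Specht_space C n la -> u != 0 ->
  exists t, colsum la la t u != 0.
Proof.
move=> uS u0; apply/existsP; apply: contraNT u0 => /existsPn h.
have [k ek] := Specht_span uS.
apply/eqP/form_eq0; rewrite {2}ek form_sum big1 // => t _.
rewrite form_poly; have := h t; rewrite negbK => /eqP ->.
by rewrite ffunE conjC0 mulr0.
Qed.

(** A permutation that preserves rows and columns of a tableau is trivial. *)
Lemma polytabloid_coef la (hla : is_part n la) (t : 'S_n) :
  (polytabloid C la t : {ffun _ -> C^o}) (tabloid_of la t) = 1.
Proof.
rewrite /polytabloid sum_ffunE (bigD1 1%g) ?col_stab1 //= big1 => [|s /andP[hs s1]].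
  by rewrite perm_op1 id_lfunE !ffunE eqxx odd_perm1 addr0 /GRing.scale /= mulr1.
rewrite perm_op_tabloid !ffunE; case: eqP => [e|_]; last by rewrite scaler0.
case/eqP: s1; apply/permP => x; rewrite perm1.
apply: (@perm_inj _ (t^-1)%g); apply: (@cell_inj _ la).
  have := congr1 (fun f : tabloid n la => f (s x) : nat) e.
  by rewrite !tabloid_of_val // invMg permM permK.
by move: hs; rewrite inE => /forallP /(_ x) /eqP.
Qed.

(** James' submodule theorem: antisymmetrizing a suitable nonzero vector of [W] gives a
    nonzero multiple of a polytabloid, and one polytabloid generates all of them. *)
Theorem Specht_irred la (hla : is_part n la) (W : {vspace tabloid_space C n la}) :
  (W <= Specht_space C n la)%VS ->
  (forall s w, w \in W -> perm_op C la s w \in W) -> W <> 0%VS ->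
  W = Specht_space C n la.
Proof.
move=> WS Wst W0; apply/eqP; rewrite eqEsubv WS /=.
have uW : vpick W \in W := memv_pick W.
have u0 : vpick W != 0 by rewrite vpick0; apply/eqP.
have [t tu] := Specht_colsum_neq0 (subvP WS _ uW) u0.
have [c ec] := colsum_span hla t (subvP WS _ uW).
have c0 : c != 0 by apply: contraNneq tu => c0; rewrite ec c0 scale0r.
have tW : polytabloid C la t \in W.
  rewrite -[X in X \in W](scalerK c0) -ec memvZ // sum_lfunE memv_suml // => s _.
  by rewrite scale_lfunE memvZ // Wst.
apply/span_subvP => _ /mapP[t' _ ->].
by rewrite -(mulKVg t t') -perm_op_polytabloid Wst.
Qed.

Lemma Specht_neq0 la (hla : is_part n la) : Specht_space C n la <> 0%VS.
Proof.
move=> e; have := polytabloid_mem la 1%g; rewrite e memv0 => /eqP e1.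
have := polytabloid_coef hla 1%g; rewrite e1 ffunE => /eqP.
by rewrite eq_sym oner_eq0.
Qed.

(** The polytabloid of [t] is a multiple of its own antisymmetrization, so its image is
    a nonzero antisymmetrized vector of shape [mu]; some tabloid of shape [mu] survives,
    and [colsum_dominance] applies. *)
Lemma Specht_hom_dominance la mu (hla : is_part n la) (hmu : is_part n mu)
    (h : 'Hom(Specht C n la, Specht C n mu)) :
  (forall s v, h (Specht_op C la s v) = Specht_op C mu s (h v)) -> h != 0 ->
  forall i, (sumn (take i mu) <= sumn (take i la))%N.
Proof.
move=> heq h0.
have [t et] : exists t, h (vsproj (Specht_space C n la) (polytabloid C la t)) != 0.
  apply/existsP; apply: contraNT h0 => /existsPn hz; apply/eqP/lfunP => v.
  have [k ek] := Specht_span (subvsP v).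
  rewrite lfunE /= -[v]vsvalK ek !linear_sum /= big1 // => t _.
  by rewrite !linearZ /=; have := hz t; rewrite negbK => /eqP ->; rewrite scaler0.
set e := vsproj _ _ in et.
have ee : vsval e = polytabloid C la t by rewrite vsprojK // polytabloid_mem.
have key : #|col_stab la t|%:R *: vsval (h e) = colsum la mu t (vsval (h e)).
  transitivity (vsval (h (#|col_stab la t|%:R *: e))); first by rewrite !linearZ.
  have -> : #|col_stab la t|%:R *: e = \sum_(s in col_stab la t) (-1) ^+ s *: Specht_op C la s e.
    apply: subvs_inj; rewrite linearZ /= ee -colsum_poly /colsum sum_lfunE linear_sum /=.
    by apply: eq_bigr => s _; rewrite Specht_opE ee scale_lfunE.
  rewrite !linear_sum /colsum sum_lfunE; apply: eq_bigr => s _ /=.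
  by rewrite !linearZ /= heq Specht_opE scale_lfunE.
have nz : colsum la mu t (vsval (h e)) != 0.
  rewrite -key scaler_eq0 negb_or card_col_stab_neq0 /=.
  by apply: contraNneq et => e0; apply/eqP/subvs_inj; rewrite e0 linear0.
have [t' nz'] : exists t', colsum la mu t (tabloid_vec C (tabloid_of mu t')) != 0.
  apply/existsP; apply: contraNT nz => /existsPn hz; apply/eqP.
  have [k ->] := Specht_span (subvsP (h e)).
  rewrite linear_sum big1 // => t' _ /=.
  rewrite linearZ /= /polytabloid linear_sum big1 ?scaler0 // => s _ /=.
  rewrite linearZ /= perm_op_tabloid; have := hz (t' * s)%g; rewrite negbK => /eqP ->.
  by rewrite scaler0.
exact: colsum_dominance nz'.
Qed.

End Sym.

(** * Irreducibility and separation of Specht modules, and the sign twist *)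

Section SpechtModules.
Variables (C : numClosedFieldType) (n : nat).

Definition sgn (s : 'S_n) : C := (-1) ^+ s.

Lemma sgn_neq0 s : sgn s != 0.
Proof. by rewrite signr_eq0. Qed.

Lemma Specht_op_irred la : is_part n la -> irred (Specht_op C (n := n) la).
Proof.
move=> hla; split=> [e|W Wst].
  case: (Specht_neq0 (C := C) hla); apply/eqP; rewrite -subv0; apply/subvP => v vS.
  by rewrite -(vsprojK vS) (_ : vsproj _ v = 0) ?linear0 ?mem0v //; apply/eqP;
    rewrite -memv0 -e memvf.
have [->|/eqP W0] := eqVneq W 0%VS; [by left | right].
pose j : 'Hom(Specht C n la, tabloid_space C n la) := linfun vsval.
have jE v : j v = vsval v by rewrite lfunE.
have jW : (j @: W)%VS = Specht_space C n la.
  apply: Specht_irred => //.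
  - by apply/subvP => _ /memv_imgP[v _ ->]; rewrite jE subvsP.
  - move=> s _ /memv_imgP[v vW ->].
    by rewrite jE -Specht_opE -jE memv_img // Wst.
  - move=> e; apply: W0; apply/eqP; rewrite -subv0; apply/subvP => v vW.
    have : j v \in (j @: W)%VS by rewrite memv_img.
    rewrite e !memv0 jE => /eqP h; apply/eqP; apply: subvs_inj.
    by rewrite h linear0.
apply/eqP; rewrite eqEsubv subvf /=; apply/subvP => v _.
have : vsval v \in (j @: W)%VS by rewrite jW subvsP.
by case/memv_imgP => w wW; rewrite jE => /subvs_inj ->.
Qed.

(** A nonzero equivariant map is invertible, so dominance holds in both directions. *)
Lemma Specht_hom_eq la mu (h : 'Hom(Specht C n la, Specht C n mu)) :
  is_part n la -> is_part n mu ->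
  intertwines (Specht_op C la) (Specht_op C mu) h -> h != 0 -> la = mu.
Proof.
move=> hla hmu hT h0; apply: (part_eq hla hmu) => i.
have e0 (s : 'S_n) : (fun=> 1) s != 0 :> C := oner_neq0 _.
have [k0 i0] := twisted_iso e0 (Specht_op_irred hla) (Specht_op_irred hmu)
  ((twisted_homE _ _ _).1 hT) h0.
have hV := twisted_inv e0 k0 i0 ((twisted_homE _ _ _).1 hT).
apply/eqP; rewrite eqn_leq; apply/andP; split; last exact: (Specht_hom_dominance hla hmu hT h0).
apply: (@Specht_hom_dominance _ _ mu la hmu hla h^-1%VF).
  by move=> s v; rewrite hV invr1 scale1r.
apply: contra_neq h0 => hV0; apply/lfunP => v.
by rewrite lfunE /= -[v](lker0_lfunK (f := h)) ?hV0 ?lfunE /= ?linear0 //; apply/eqP.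
Qed.

Section Transposed.
Variables (la : seq nat) (hla : is_part n la) (tr : 'S_n).
Hypothesis trP : forall k,
  cell_row (conj_part la) (tr k) = cell_col la k /\
  cell_col (conj_part la) (tr k) = cell_row la k.
Local Notation la' := (conj_part la).

(** The tabloid of a tableau [t] of the conjugate shape is sent to the polytabloid of
    the transposed tableau [tr * t], with the sign of [t]. Summing over all tableaux
    with a given tabloid makes this well defined without choosing representatives. *)
Definition transp (v : tabloid_space C n la') : tabloid_space C n la :=
  \sum_(t : 'S_n) ((v : {ffun _ -> C^o}) (tabloid_of la' t) * sgn t)
    *: polytabloid C la (tr * t)%g.

Lemma transp_lin : linear transp.
Proof.
move=> c u v; rewrite /transp scaler_sumr -big_split /=; apply: eq_bigr => t _.
by rewrite !ffunE mulrDl scalerDl -mulrA -scalerA.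
Qed.

Lemma transp_perm s v : transp (perm_op C la' s v) = sgn s *: perm_op C la s (transp v).
Proof.
rewrite /transp linear_sum scaler_sumr /=; rewrite (reindex_inj (mulIg s)) /=.
apply: eq_bigr => t _; rewrite linearZ /= perm_op_polytabloid scalerA mulgA.
congr (_ *: _); rewrite perm_opE ffunE /sgn odd_permM signr_addb [RHS]mulrC -mulrA.
congr (v _ * _); apply/ffunP => x.
by rewrite !ffunE invMg permM permK.
Qed.

Lemma transp_mem v : transp v \in Specht_space C n la.
Proof. by apply: memv_suml => t _; rewrite memvZ // polytabloid_mem. Qed.

(** Row permutations of the tableau of conjugate shape are column permutations of the
    transposed tableau. So the image of a polytabloid is, up to a positive factor, the
    sum of the row translates of a polytabloid, and each of them has coefficient [1] on
    the tabloid of the transposed tableau. *)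
Lemma transp_neq0 : transp (polytabloid C la' 1%g) != 0.
Proof.
have hc := is_part_conj hla.
pose f0 := tabloid_of la tr.
(* [R] is the row stabilizer of the tableau of conjugate shape. *)
pose R := [set r : 'S_n | tabloid_of la' r == tabloid_of la' 1%g].
have RE r : r \in R -> r \in col_stab la tr.
  rewrite !inE => /eqP e; apply/forallP => x.
  have := congr1 (fun f : tabloid n la' => f (r x) : nat) e.
  rewrite !tabloid_of_val // invg1 perm1 permK => e1.
  have [e2 _] := trP ((tr^-1)%g x); have [e3 _] := trP ((tr^-1)%g (r x)).
  by rewrite -e2 -e3 !permKV e1.
have vecE p : transp (perm_op C la' p (tabloid_vec C (tabloid_of la' 1%g))) =
    #|R|%:R *: (sgn p *: perm_op C la p (polytabloid C la tr)).
  rewrite transp_perm scalerA mulrC -scalerA; congr (_ *: _).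
  rewrite -linearZ /=; congr (perm_op _ _ _ _).
  rewrite -sum1_card natr_sum scaler_suml /transp (bigID (mem R)) /= addrC big1 ?add0r.
    apply: eq_bigr => r rR; rewrite scale1r.
    rewrite -perm_op_polytabloid perm_op_col ?RE // scalerA.
    move: rR; rewrite inE ffunE => ->; rewrite mul1r /sgn -expr2 sqrr_sign.
    by rewrite scale1r.
  by move=> r; rewrite inE ffunE => /negbTE ->; rewrite mul0r scale0r.
have -> : transp (polytabloid C la' 1%g) =
    #|R|%:R *: \sum_(p in col_stab la' 1%g) perm_op C la p (polytabloid C la tr).
  rewrite -(linfun_linE transp_lin) /polytabloid linear_sum scaler_sumr /=.
  apply: eq_bigr => p _; rewrite linearZ /= linfun_linE; last exact: transp_lin.
  by rewrite vecE !scalerA mulrCA /sgn -expr2 sqrr_sign mulr1.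
rewrite scaler_eq0 negb_or pnatr_eq0 -lt0n.
have -> : (0 < #|R|)%N by apply/card_gt0P; exists 1%g; rewrite inE.
apply/eqP => /(congr1 (fun v : {ffun _ -> C^o} => v f0)).
rewrite sum_ffunE ffunE.
rewrite (eq_bigr (fun=> 1)) => [|p hp].
  rewrite sumr_const => /eqP; rewrite pnatr_eq0 => /eqP /card0_eq /(_ 1%g).
  by rewrite col_stab1.
rewrite perm_opE ffunE -[RHS](polytabloid_coef C hla tr); congr (polytabloid _ _ _ _).
apply/ffunP => x; apply: ord_inj; rewrite ffunE !tabloid_of_val //.
move: hp; rewrite inE => /forallP /(_ x) /eqP; rewrite invg1 !perm1.
have [_ e2] := trP ((tr^-1)%g x); have [_ e3] := trP ((tr^-1)%g (p x)).
by rewrite -e2 -e3 !permKV.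
Qed.

Lemma Specht_sign_aux : exists h : 'Hom(Specht C n la', Specht C n la),
  h != 0 /\ twisted_hom sgn (Specht_op C la') (Specht_op C la) h.
Proof.
pose h := (linfun (vsproj (Specht_space C n la)) \o linfun transp \o linfun vsval)%VF
  : 'Hom(Specht C n la', Specht C n la).
have hE v : vsval (h v) = transp (vsval v).
  rewrite !comp_lfunE !lfunE /= linfun_linE; last exact: transp_lin.
  by rewrite vsprojK // transp_mem.
exists h; split.
  apply: contra_neq transp_neq0 => h0.
  have := hE (vsproj _ (polytabloid C la' 1%g)).
  rewrite vsprojK ?polytabloid_mem // => <-.
  by rewrite h0 zero_lfunE linear0.
move=> s v; apply: subvs_inj; rewrite hE Specht_opE transp_perm.
by rewrite linearZ /= Specht_opE hE.
Qed.

End Transposed.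

Lemma Specht_sign la : is_part n la -> exists h : 'Hom(Specht C n (conj_part la), Specht C n la),
  h != 0 /\ twisted_hom sgn (Specht_op C (conj_part la)) (Specht_op C la) h.
Proof. by move=> hla; have [tr trP] := transpose_cells hla; apply: (Specht_sign_aux hla trP). Qed.

(** Composing with the sign-equivariant map of [Specht_sign] gives an equivariant one.
    *)
Lemma Specht_sign_eq la mu (h : 'Hom(Specht C n la, Specht C n mu)) :
  is_part n la -> is_part n mu ->
  twisted_hom sgn (Specht_op C la) (Specht_op C mu) h -> h != 0 -> mu = conj_part la.
Proof.
move=> hla hmu hT h0; have hc := is_part_conj hla.
have [g [g0 gT]] := Specht_sign hla.
have [gk gi] := twisted_iso sgn_neq0 (Specht_op_irred hc) (Specht_op_irred hla) gT g0.
apply/esym; apply: (@Specht_hom_eq _ _ (h \o g)%VF) => //.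
  move=> s v; rewrite !comp_lfunE gT linearZ /= hT scalerA.
  by rewrite /sgn -expr2 sqrr_sign scale1r.
apply: contra_neq h0 => hg; apply/lfunP => v.
have -> : v = g (g^-1%VF v) by rewrite limg_lfunVK // gi memvf.
by rewrite -comp_lfunE hg !lfunE.
Qed.

End SpechtModules.

(** * Cycle types determine conjugacy classes *)

Section CycleType.
Variable n : nat.
Implicit Types s : 'S_n.

Definition longer (p q : seq 'I_n) : bool := (size q <= size p)%N.
(** The orbits, each listed in cyclic order, by decreasing length, so that the list of
    lengths is a partition. *)
Definition cycles s : seq (seq 'I_n) :=
  sort longer [seq fingraph.orbit s x | x <- enum (froots s)].
Definition cycle_type s : seq nat := shape (cycles s).

Lemma cycles_fcycle s p : p \in cycles s -> fcycle s p.
Proof. by rewrite mem_sort => /mapP[x _ ->]; apply/cycle_orbit/perm_inj. Qed.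

Lemma flatten_cycles s : perm_eq (flatten (cycles s)) (enum 'I_n).
Proof.
have pe : perm_eq (flatten (cycles s)) (flatten [seq fingraph.orbit s x | x <- enum (froots s)]).
  by apply: perm_flatten; rewrite perm_sort.
have sym : fconnect s =2 (fun x y => fconnect s y x) by apply: fconnect_sym; apply: perm_inj.
apply: (perm_trans pe); apply: uniq_perm; last 2 first.
- exact: enum_uniq.
- move=> y; rewrite mem_enum [RHS]inE; apply/flattenP; exists (fingraph.orbit s (froot s y)).
    by apply: map_f; rewrite mem_enum; apply: roots_root; apply: fconnect_sym; apply: perm_inj.
  by rewrite -fconnect_orbit sym connect_root.
set r := enum _.
have : {in r &, forall x y, fconnect s x y -> x = y}.
  move=> x y; rewrite !mem_enum => /eqP {2}<- /eqP {2}<- xy.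
  by apply/fingraph.rootP => //; apply: fconnect_sym; apply: perm_inj.
have : uniq r by apply: enum_uniq.
elim: r => //= x r IHr /andP[xr ur] rinj.
rewrite cat_uniq fingraph.orbit_uniq IHr // ?andbT /=; last first.
  by move=> u v ur' vr'; apply: rinj; rewrite inE ?ur' ?vr' orbT.
apply/hasPn => z /flattenP[_ /mapP[y yr ->]] yz; apply/negP => /= xz.
have xy : x = y.
  apply: rinj; rewrite ?inE ?eqxx ?yr ?orbT //.
  by apply: (connect_trans (y := z)); rewrite ?[fconnect s z _]sym fconnect_orbit.
by rewrite xy yr in xr.
Qed.

Lemma cycle_type_part s : is_part n (cycle_type s).
Proof.
apply/and3P; split.
- rewrite sorted_map; apply: (sort_sorted (leT := longer)) => p q.
  exact: leq_total.
- apply/negP => /mapP[p]; rewrite mem_sort => /mapP[x _ ->].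
  by move=> e; have := in_orbit s x; case: (fingraph.orbit s x) e.
- by rewrite -size_flatten (perm_size (flatten_cycles s)) size_enum_ord.
Qed.

Lemma fpath_zip (T : eqType) (f f' : T -> T) x x' p p' : size p = size p' ->
  fpath f x p -> fpath f' x' p' ->
  fpath (fun u : T * T => (f u.1, f' u.2)) (x, x') (zip p p').
Proof.
elim: p x x' p' => [|y p IHp] x x' [|y' p'] //= [e] /andP[/eqP <- h] /andP[/eqP <- h'].
by rewrite eqxx IHp.
Qed.

Lemma fcycle_zip (T : eqType) (f f' : T -> T) p p' : size p = size p' ->
  fcycle f p -> fcycle f' p' ->
  fcycle (fun u : T * T => (f u.1, f' u.2)) (zip p p').
Proof.
case: p p' => [|x p] [|x' p'] //= [e] h h'.
rewrite -[rcons _ _]/(rcons (zip p p') (x, x')).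
have -> : rcons (zip p p') (x, x') = zip (rcons p x) (rcons p' x').
  by rewrite -!cats1 zip_cat.
by apply: fpath_zip; rewrite ?size_rcons ?e.
Qed.

(** Two lists of cycles of equal shape, zipped, form a list of cycles for the product
    map; the zipped list is therefore the graph of a relation compatible with both maps.
    *)
Lemma zip_flatten (T : eqType) (f f' : T -> T) (L L' : seq (seq T)) :
  shape L = shape L' -> {in L, forall p, fcycle f p} -> {in L', forall p, fcycle f' p} ->
  forall x x', (x, x') \in zip (flatten L) (flatten L') ->
    (f x, f' x') \in zip (flatten L) (flatten L').
Proof.
elim: L L' => [|p L IHL] [|p' L'] //= [e eL] hL hL' x x'.
rewrite zip_cat // !mem_cat => /orP[xp|xL].
  have := mem_fcycle (fcycle_zip e (hL _ _) (hL' _ _)); rewrite !inE !eqxx.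
  by move=> /(_ isT isT) h; rewrite (h _ xp).
rewrite IHL ?orbT // => q qL; first by apply: hL; rewrite inE qL orbT.
by apply: hL'; rewrite inE qL orbT.
Qed.

(** The conjugating permutation matches the two lists of orbits entry by entry. *)
Lemma cycle_type_conj s s' : cycle_type s = cycle_type s' ->
  exists g : 'S_n, (s ^ g)%g = s'.
Proof.
move=> e; set a := flatten (cycles s); set b := flatten (cycles s').
have pa : perm_eq a (enum 'I_n) := flatten_cycles s.
have pb : perm_eq b (enum 'I_n) := flatten_cycles s'.
have ua : uniq a by rewrite (perm_uniq pa) enum_uniq.
have ub : uniq b by rewrite (perm_uniq pb) enum_uniq.
have sa : size a = n by rewrite (perm_size pa) size_enum_ord.
have sb : size b = n by rewrite (perm_size pb) size_enum_ord.
have ma x : x \in a by rewrite (perm_mem pa) mem_enum.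
(* The default value of [nth] is never reached, since [a] and [b] have the same length. *)
pose g x := nth x b (index x a).
have zE x y : ((x, y) \in zip a b) = (y == g x).
  have ix : (index x a < n)%N by rewrite -[X in (_ < X)%N]sa index_mem.
  apply/idP/eqP => [/(nthP (x, y))[k]|->].
    rewrite size_zip sa sb minnn => k_n; rewrite nth_zip ?sa ?sb // => -[<- <-].
    by rewrite /g index_uniq ?sa //; apply: set_nth_default; rewrite sb.
  apply/(nthP (x, x)); exists (index x a); first by rewrite size_zip sa sb minnn.
  by rewrite nth_zip ?sa ?sb // nth_index.
have g_inj : injective g.
  move=> x y exy; have ix : (index x a < n)%N by rewrite -[X in (_ < X)%N]sa index_mem.
  have iy : (index y a < n)%N by rewrite -[X in (_ < X)%N]sa index_mem.
  have : index x a = index y a.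
    apply/eqP; rewrite -(nth_uniq x _ _ ub) ?sb //; apply/eqP.
    by rewrite -/(g x) exy; apply: set_nth_default; rewrite sb.
  by move/(congr1 (nth x a)); rewrite !nth_index.
exists (perm g_inj); apply/permP => y; rewrite conjgE !permM.
set x := ((perm g_inj)^-1)%g y; have -> : y = g x by rewrite -(permE g_inj) permKV.
rewrite permE; apply/esym/eqP; rewrite -zE.
apply: (zip_flatten e (@cycles_fcycle s) (@cycles_fcycle s')).
by rewrite zE.
Qed.

Lemma cycle_type_class s s' : cycle_type s = cycle_type s' ->
  (s ^: [set: 'S_n] = s' ^: [set: 'S_n])%g.
Proof.
by move=> /cycle_type_conj[g <-]; rewrite classGidl ?inE.
Qed.

End CycleType.

(** * The Coxeter presentation of the symmetric group *)

Section Coxeter.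
Variable m : nat.
Local Notation n := m.+1.

Definition adj (i : nat) : 'S_n := tperm (inord i) (inord i.+1).

(** The cycle sending [k] to [k - d] and moving [k - d, ..., k - 1] up by one. The
    permutations [rise k d] represent the cosets of the permutations fixing [k, ..., m]
    in those fixing [k.+1, ..., m]. *)
Fixpoint rise (k d : nat) : 'S_n :=
  if d is d'.+1 then (rise k d' * adj (k - d'.+1))%g else 1%g.

Lemma riseE k d (x : 'I_n) : (k < n)%N -> (d <= k)%N ->
  rise k d x = (if x == k :> nat then k - d
                else if (k - d <= x)%N && (x < k)%N then x.+1 else x)%N :> nat.
Proof.
move=> kn; elim: d => [|d IHd] dk /=.
  by rewrite perm1 subn0; case: ltngtP.
have {}IHd := IHd (ltnW dk); rewrite permM /adj.
have e1 : (k - d.+1).+1 = (k - d)%N by lia.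
have l1 : (k - d.+1 < n)%N by lia.
have l2 : (k - d < n)%N by lia.
rewrite e1; case: tpermP => [e|e|].
- rewrite inordK //; have := congr1 val e; rewrite /= inordK // IHd; have := ltn_ord x.
  by do ?case: ifP; lia.
- rewrite inordK //; have := congr1 val e; rewrite /= inordK // IHd; have := ltn_ord x.
  by do ?case: ifP; lia.
- move=> /eqP; rewrite -val_eqE /= inordK // IHd => h1 /eqP.
  rewrite -val_eqE /= inordK // IHd; move: h1; have := ltn_ord x.
  by do ?case: ifP; lia.
Qed.

Definition fixes_above (k : nat) (w : 'S_n) : Prop := forall x : 'I_n, (k <= x)%N -> w x = x.

Lemma fixes_rise k w (kn : (k < n)%N) :
  fixes_above k.+1 w -> (w (Ordinal kn) <= k)%N /\
  fixes_above k (w * (rise k (k - w (Ordinal kn)))^-1)%g.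
Proof.
move=> hw; set x := Ordinal kn.
have le : (w x <= k)%N.
  rewrite leqNgt; apply/negP => h; have := perm_inj (hw (w x) h).
  by move/(congr1 val) => /= e; rewrite e ltnn in h.
split=> // y; rewrite leq_eqVlt => /orP[/eqP e|ky]; apply: (@perm_inj _ (rise k (k - w x))).
  have -> : y = x by apply: ord_inj.
  rewrite permM permKV; apply: ord_inj; rewrite riseE ?leq_subr //= eqxx; lia.
rewrite permM permKV (hw y ky); apply: ord_inj; rewrite riseE ?leq_subr //.
by do ?case: ifP; lia.
Qed.

(** Every permutation is a product of adjacent transpositions: peel off one [rise] at a
    time. *)
Lemma adj_ind (P : 'S_n -> Prop) : P 1%g ->
  (forall w i, (i < m)%N -> P w -> P (w * adj i)%g) -> forall w, P w.
Proof.
move=> P1 Pt w.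
have key k : (k <= n)%N -> forall w, fixes_above k w -> P w.
  elim: k => [_ {}w hw|k IHk kn {}w hw].
    by rewrite (_ : w = 1%g) //; apply/permP => x; rewrite hw // perm1.
  have [le hw'] := fixes_rise kn hw.
  rewrite -(mulgKV (rise k (k - w (Ordinal kn))) w).
  have := IHk (ltnW kn) _ hw'; move: (w * _)%g => w' Pw'.
  have := leq_subr (w (Ordinal kn)) k; move: (k - _)%N => d.
  elim: d => [|d IHd] dk /=; first by rewrite mulg1.
  rewrite mulgA; apply: Pt; last exact/IHd/ltnW.
  by clear -kn dk; lia.
by apply: (key n) => // x; rewrite leqNgt ltn_ord.
Qed.

Variables (A : pzRingType) (g : nat -> A).
Hypothesis g_sq : forall i, (i < m)%N -> g i * g i = 1.
Hypothesis g_braid : forall i, (i.+1 < m)%N -> g i * g i.+1 * g i = g i.+1 * g i * g i.+1.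
Hypothesis g_far : forall i j, (i.+1 < j)%N -> (j < m)%N -> g i * g j = g j * g i.

(** The word of [rise k d] in the elements [g]. *)
Fixpoint grise (k d : nat) : A :=
  if d is d'.+1 then g (k - d'.+1) * grise k d' else 1.

Lemma grise_far k d i : (k <= m)%N -> (d <= k)%N -> (i.+1 < k - d)%N ->
  grise k d * g i = g i * grise k d.
Proof.
move=> km; elim: d => [|d IHd] dk h /=; first by rewrite mul1r mulr1.
rewrite -mulrA IHd ?mulrA ?(@g_far i) //; lia.
Qed.

(** The only place where the braid relation is used. *)
Lemma grise_shift k d i : (k <= m)%N -> (d <= k)%N -> (k - d < i < k)%N ->
  grise k d * g i.-1 = g i * grise k d.
Proof.
move=> km; elim: d => [|d IHd] dk h /=; first by lia.
have [ei|ni] := eqVneq i (k - d)%N; last first.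
  rewrite -mulrA IHd; [|lia|lia].
  by rewrite !mulrA g_far //; lia.
case: d {IHd} dk h ei => [|d] dk h ei; first by lia.
have -> : i.-1 = (k - d.+2)%N by lia.
have -> : i = (k - d.+2).+1 by lia.
rewrite /= (_ : (k - d.+1)%N = (k - d.+2).+1); last by lia.
rewrite -!mulrA grise_far; [|lia|lia|lia].
rewrite !mulrA g_braid //; lia.
Qed.

(** A permutation fixing everything above [k] factors uniquely as one fixing everything
    from [k] on, times some [rise k d]; the value of [rho] is read off this normal form.
    Multiplying by an adjacent transposition changes [d] by one or passes through
    [grise]. *)
Lemma adj_rep_step k : (k <= n)%N -> exists rho : 'S_n -> A, rho 1%g = 1 /\
  forall w i, fixes_above k w -> (i.+1 < k)%N -> rho (w * adj i)%g = g i * rho w.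
Proof.
elim: k => [|k IHk] kn; first by exists (fun=> 1).
have [rho [rho1 rhoM]] := IHk (ltnW kn).
pose x := Ordinal kn; pose d (w : 'S_n) := (k - w x)%N.
exists (fun w => grise k (d w) * rho (w * (rise k (d w))^-1)%g); split.
  by rewrite /d perm1 /= subnn /= mul1r invg1 mulg1.
move=> w i hw ik; have [le hw'] := fixes_rise kn hw.
rewrite -/x -/(d w) in hw' le.
have dE : d w = (k - w x)%N by [].
have km : (k <= m)%N by rewrite -ltnS.
have l1 : (i < n)%N by lia.
have l2 : (i.+1 < n)%N by lia.
have vtp : adj i (w x) = (if w x == i :> nat then i.+1
   else if w x == i.+1 :> nat then i else w x) :> nat.
  rewrite /adj; case: tpermP => [->|->|/eqP + /eqP +].
  - by rewrite !inordK // eqxx.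
  - by rewrite !inordK // eqxx; case: eqP => //; lia.
  - by rewrite -!val_eqE /= !inordK // => /negbTE -> /negbTE ->.
have dt : d (w * adj i)%g = (k - adj i (w x))%N by rewrite /d permM.
rewrite {}dt vtp.
have [ei|ni] := eqVneq (w x : nat) i.
  have -> : d w = (k - i.+1).+1 by lia.
  rewrite /= (_ : (k - (k - i.+1).+1)%N = i); last by lia.
  rewrite mulrA mulrA g_sq; last by lia.
  rewrite mul1r; congr (_ * rho _).
  by rewrite invMg /adj tpermV mulgA.
have [ei|ni'] := eqVneq (w x : nat) i.+1.
  have -> : (k - i)%N = (d w).+1 by lia.
  rewrite /= (_ : (k - (d w).+1)%N = i); last by lia.
  by rewrite mulrA; congr (_ * rho _); rewrite invMg mulgA mulgK.
rewrite -/(d w).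
have cj j : (w * adj i * (rise k (d w))^-1)%g = (w * (rise k (d w))^-1 * adj j)%g <->
   tperm (inord i) (inord i.+1) = tperm (rise k (d w) (inord j)) (rise k (d w) (inord j.+1)).
  rewrite -tpermJ -/(adj i) -/(adj j) conjgE; split=> [h|->].
    apply: (mulgI w); apply: (mulIg (rise k (d w))^-1%g).
    by rewrite h !mulgA mulgK.
  by rewrite !mulgA mulgK.
have [lt|ge] := ltnP (w x) i.
  have -> : (w * adj i * (rise k (d w))^-1)%g = (w * (rise k (d w))^-1 * adj i.-1)%g.
    apply/cj; congr tperm; apply: ord_inj; rewrite riseE ?leq_subr // !inordK //; try lia;
      do ?case: ifP; lia.
  rewrite rhoM //; last by lia.
  by rewrite mulrA grise_shift ?mulrA //; lia.
have -> : (w * adj i * (rise k (d w))^-1)%g = (w * (rise k (d w))^-1 * adj i)%g.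
  apply/cj; congr tperm; apply: ord_inj; rewrite riseE ?leq_subr // !inordK //;
    do ?case: ifP; lia.
rewrite rhoM //; last by lia.
by rewrite mulrA grise_far ?mulrA //; lia.
Qed.

(** Elements subject to the Coxeter relations extend to a representation. It reverses
    products because [s * s'] stands for [s] followed by [s']. *)
Lemma adj_rep : exists rho : 'S_n -> A,
  [/\ rho 1%g = 1, forall v w, rho (v * w)%g = rho w * rho v &
      forall i, (i < m)%N -> rho (adj i) = g i].
Proof.
have [rho [rho1 rhoM]] := adj_rep_step (leqnn n).
have hM w i : (i < m)%N -> rho (w * adj i)%g = g i * rho w.
  by move=> im; apply: rhoM => // x; rewrite leqNgt ltn_ord.
exists rho; split=> // [v w|i im]; last by rewrite -[adj i]mul1g hM // rho1 mulr1.
elim/adj_ind: w v => [v|w i im IHw v]; first by rewrite mulg1 rho1 mul1r.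
by rewrite mulgA !hM // IHw mulrA.
Qed.

End Coxeter.

(** * Specht modules exhaust the irreducible representations *)

Section Complete.
Variables (C : numClosedFieldType) (n : nat).
Local Notation G := [set: 'S_n]%G.

(** The order of the factors is that of composition of operators, opposite to the
    product of permutations. *)
Definition op_rep (V : vectType C) (R : 'S_n -> 'End(V)) : Prop :=
  R 1%g = \1%VF /\ forall s s', (R s \o R s')%VF = R (s' * s)%g.

Section Matrices.
Variables (V : vectType C) (R : 'S_n -> 'End(V)).
Hypothesis hR : op_rep R.
Local Notation e := (vbasis (fullv : {vspace V})).
Local Notation eb := (vbasisP (fullv : {vspace V})).

(** Matrices act on row vectors from the right, which turns the reversed product of
    [op_rep] into a homomorphism. *)
Definition op_mx (s : 'S_n) : 'M[C]_(\dim {:V}) := mxof e e (R s).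

Lemma op_mx_repr : mx_repr G op_mx.
Proof.
case: hR => R1 RM; split; first by rewrite /op_mx R1 mxof1 // (basis_free eb).
by move=> s s' _ _; rewrite /op_mx -RM (mxof_comp _ _ eb).
Qed.
Definition op_mxrep := MxRepresentation op_mx_repr.

Lemma stable_mxmodule (W : {vspace V}) : stable R W -> mxmodule op_mxrep (msof e W).
Proof.
move=> Wst; apply/mxmoduleP => s _; apply/rV_subP => _ /submxP[u ->].
have uW : vecof e (u *m msof e W) \in W by rewrite (mem_vecof eb) ?submxMl.
rewrite mulmxA /= /op_mx mul_mxof (rVof_sub eb).
by rewrite (msofK eb) Wst.
Qed.

Lemma mxmodule_stable U : mxmodule op_mxrep U -> stable R (vsof e U).
Proof.
move=> /mxmoduleP Ust s w; rewrite -!(rVof_sub eb) => wU.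
rewrite (rVof_app _ eb); apply: submx_trans (Ust s _); last by rewrite inE.
by rewrite submxMr.
Qed.

Lemma irred_mx : irred R -> mx_irreducible op_mxrep.
Proof.
move=> [V0 iR]; apply/mx_irrP; split; first by rewrite lt0n dimv_eq0; apply/eqP.
move=> U Um U0; case: (iR _ (mxmodule_stable Um)) => eU.
  by move: U0; rewrite -(vsof_eq0 eb) eU eqxx.
rewrite -sub1mx -(eqmxP (vsofK eb U)) eU; apply/rV_subP => u _.
by rewrite -(mem_vecof eb) ?memvf.
Qed.

End Matrices.

Lemma pchar_S : pgroup (negn [pchar C]) G.
Proof. by apply/sub_pgroup/(pgroup_pi G) => p _; rewrite inE /= pchar_num. Qed.

Lemma Specht_rep la : op_rep (Specht_op C (n := n) la).
Proof. by split; [exact: Specht_op1 | exact: Specht_opM]. Qed.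

Let sG : irrType C G := DecSocleType (regular_repr C G).
Let rS la := op_mxrep (Specht_rep la).

Lemma rS_irr la : is_part n la -> mx_irreducible (rS la).
Proof. by move=> hla; apply/irred_mx/Specht_op_irred. Qed.

Lemma rS_inj la mu : is_part n la -> is_part n mu ->
  irr_comp sG (rS la) = irr_comp sG (rS mu) -> la = mu.
Proof.
move=> hla hmu e.
have r1 := rsim_irr_comp_pchar sG pchar_S (rS_irr hla).
have r2 := rsim_irr_comp_pchar sG pchar_S (rS_irr hmu).
rewrite e in r1; have [B e12 Bf hB] := mx_rsim_trans r1 (mx_rsim_sym r2).
have b1 := vbasisP (fullv : {vspace Specht C n la}).
have b2 := vbasisP (fullv : {vspace Specht C n mu}).
apply: (@Specht_hom_eq C n la mu (hommx (vbasis fullv) (vbasis fullv) B)) => //.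
  move=> s v; apply: (can_inj (rVofK b2)).
  rewrite -(rVof_mul b1 b2) !(rVof_app _ b2) -(rVof_mul b1 b2) (rVof_app _ b1) -!mulmxA.
  by congr (_ *m _); apply: hB; rewrite inE.
rewrite (hommx_eq0 b1 b2); apply: contraTneq Bf => ->.
rewrite /row_free mxrank0 eq_sym -lt0n lt0n dimv_eq0; apply/eqP.
by case: (Specht_op_irred C hla).
Qed.

(** The irreducible representations are as many as the conjugacy classes, and the cycle
    types of the classes are that many distinct partitions, whose Specht modules are
    pairwise non-isomorphic. *)
Lemma rS_surj (i : sG) : exists2 la, is_part n la & irr_comp sG (rS la) = i.
Proof.
pose ct (xG : {set 'S_n}) := cycle_type (fingroup.repr xG).
pose L := map ct (enum (classes G)).
have Lpart la : la \in L -> is_part n la by case/mapP => xG _ ->; apply: cycle_type_part.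
have Lu : uniq L.
  rewrite map_inj_in_uniq ?enum_uniq // => x y; rewrite !mem_enum.
  move=> /imsetP[s _ ->] /imsetP[t _ ->] e.
  have cr u : (fingroup.repr (u ^: G) ^: G = u ^: G)%g.
    by have [z zG ->] := repr_class G u; rewrite classGidl.
  by have := cycle_type_class e; rewrite !cr.
have Mu : uniq (map (fun la => irr_comp sG (rS la)) L).
  by rewrite map_inj_in_uniq // => la mu /Lpart hla /Lpart hmu; apply: rS_inj.
have : i \in map (fun la => irr_comp sG (rS la)) L.
  set s := map _ L; have cs : #|s| = #|sG|.
    rewrite (card_uniqP Mu) !size_map -cardE.
    by rewrite (card_irr_pchar sG pchar_S (@group_closure_closed_field C _ G)).
  by rewrite (subset_cardP cs (subset_predT _)).
by case/mapP => la /Lpart hla ->; exists la.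
Qed.

(** A minimal stable subspace of [W] is irreducible, hence isomorphic to some Specht
    module. *)
Theorem Specht_complete (V : vectType C) (R : 'S_n -> 'End(V)) (W : {vspace V}) :
  op_rep R -> W <> 0%VS -> stable R W ->
  exists la (h : 'Hom(Specht C n la, V)),
    [/\ is_part n la, h != 0, intertwines (Specht_op C la) R h & (limg h <= W)%VS].
Proof.
move=> hR W0 Wst.
have eb := vbasisP (fullv : {vspace V}).
have mW := stable_mxmodule hR Wst.
have nW : msof (vbasis fullv) W != 0 by rewrite msof_eq0 //; apply/eqP.
have [M simM MW] := dec_mxsimple_exists mW nW.
have [modM M0 _] := simM.
have irrM : mx_irreducible (submod_repr modM) by apply/submod_mx_irr.
have [la hla ela] := rS_surj (irr_comp sG (submod_repr modM)).
have r1 := rsim_irr_comp_pchar sG pchar_S (rS_irr hla).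
have r2 := rsim_irr_comp_pchar sG pchar_S irrM.
rewrite ela in r1; have [B e12 Bf hB] := mx_rsim_trans r1 (mx_rsim_sym r2).
have b1 := vbasisP (fullv : {vspace Specht C n la}).
pose D := val_submod B.
exists la, (hommx (vbasis fullv) (vbasis fullv) D); split=> //.
- rewrite (hommx_eq0 b1 eb) val_submod_eq0; apply: contraTneq Bf => ->.
  rewrite /row_free mxrank0 eq_sym -lt0n lt0n dimv_eq0; apply/eqP.
  by case: (Specht_op_irred C hla).
- move=> s v; apply: (can_inj (rVofK eb)).
  rewrite -(rVof_mul b1 eb) !(rVof_app _ eb) -(rVof_mul b1 eb) (rVof_app _ b1) -[LHS]mulmxA -[RHS]mulmxA.
  congr (_ *m _);  rewrite -[mxof _ _ (R s)]/(op_mxrep hR s) /D -(val_submodJ modM) ?inE //.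
  by rewrite -[submod_mx _ _]/(submod_repr modM s) -hB ?inE // val_submodE [RHS]val_submodE mulmxA.
- apply/subvP => _ /memv_imgP[v _ ->].
  rewrite -[X in X \in _](rVofK eb) (mem_vecof eb) -(rVof_mul b1 eb).
  by rewrite (submx_trans _ MW) // mulmx_sub // val_submodP.
Qed.

End Complete.

(** * Parity, homogeneous homomorphisms and isomorphism of supermodules *)

Section Parity.
Variable C : numClosedFieldType.
Implicit Types V N : svect C.

Definition parity V : 'End(V) := sv_proj V false - sv_proj V true.

Lemma parityE V q v : v \in sv_gr V q -> parity V v = (-1) ^+ q *: v.
Proof.
move=> vq; rewrite /parity sub_lfunE; case: q vq => vq.
  by rewrite (@sv_proj_0 _ V false) // sv_proj_id // sub0r expr1 scaleN1r.
by rewrite (@sv_proj_0 _ V true) // sv_proj_id // subr0 scale1r.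
Qed.

Lemma parityK V v : parity V (parity V v) = v.
Proof.
have h q w : w \in sv_gr V q -> parity V (parity V w) = w.
  by move=> wq; rewrite (parityE wq) linearZ /= (parityE wq) scalerA -expr2 sqrr_sign scale1r.
by rewrite -[v]sv_proj_sum !linearD /= (h false) ?(h true) ?sv_proj_mem.
Qed.

Lemma sv_proj_odd V (T : 'End(V)) q v : @end_gr C V true T ->
  T (sv_proj V q v) = sv_proj V (~~ q) (T v).
Proof.
move=> To; rewrite -[in RHS](sv_proj_sum v) !linearD /=.
have hq r u : u \in sv_gr V r -> T u \in sv_gr V (~~ r) by move=> ur; apply: (To r).
have := hq _ _ (sv_proj_mem false v); have := hq _ _ (sv_proj_mem true v).
case: q => /= h1 h0.
  by rewrite (@sv_proj_0 _ _ false (T (sv_proj V false v))) // (sv_proj_id h1) add0r.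
by rewrite (@sv_proj_0 _ _ true (T (sv_proj V true v))) // (sv_proj_id h0) addr0.
Qed.

Lemma parity_odd V (T : 'End(V)) v : @end_gr C V true T ->
  parity V (T v) = - T (parity V v).
Proof.
move=> To; rewrite /parity !sub_lfunE linearB /= !sv_proj_odd //.
by rewrite /= opprB.
Qed.


Lemma sv_homog_ex V : (fullv : {vspace V}) <> 0%VS ->
  exists q v, v \in sv_gr V q /\ v != 0.
Proof.
move=> V0; have [v v0] : exists v : V, v != 0.
  by exists (vpick fullv); rewrite vpick0; apply/eqP.
have [e|] := eqVneq (sv_proj V false v) 0.
  exists true, (sv_proj V true v); split; first exact: sv_proj_mem.
  by apply: contra_neq v0 => e1; rewrite -[v]sv_proj_sum e e1 addr0.
by exists false, (sv_proj V false v); rewrite sv_proj_mem.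
Qed.

Definition hom_part V N (p : bool) (f : 'Hom(V, N)) : 'Hom(V, N) :=
  ((sv_proj N p \o f \o sv_proj V false) + (sv_proj N (~~ p) \o f \o sv_proj V true))%VF.

Lemma hom_part_sum V N (f : 'Hom(V, N)) : f = hom_part false f + hom_part true f.
Proof.
apply/lfunP => v; rewrite !add_lfunE !comp_lfunE /= addrACA sv_proj_sum.
by rewrite [X in _ + X]addrC sv_proj_sum -linearD sv_proj_sum.
Qed.

Lemma hom_part_gr V N p (f : 'Hom(V, N)) q v : v \in sv_gr V q ->
  hom_part p f v \in sv_gr N (p (+) q).
Proof.
move=> vq; rewrite add_lfunE !comp_lfunE; case: q vq => vq.
  rewrite (@sv_proj_0 _ V false) // !linear0 add0r addbT; exact: sv_proj_mem.
by rewrite (@sv_proj_0 _ V true) // !linear0 addr0 addbF; exact: sv_proj_mem.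
Qed.

(** Odd operators exchange the two graded pieces on both sides, so they commute with
    taking parity components. *)
Lemma hom_part_intertwines V N p (f : 'Hom(V, N)) (I : Type)
    (T : I -> 'End(V)) (T' : I -> 'End(N)) :
  (forall i, @end_gr C V true (T i)) -> (forall i, @end_gr C N true (T' i)) ->
  intertwines T T' f -> intertwines T T' (hom_part p f).
Proof.
move=> To To' fT i v; rewrite !add_lfunE !comp_lfunE linearD /= !sv_proj_odd //.
by rewrite -!fT !sv_proj_odd // negbK addrC.
Qed.

End Parity.

Section Modules.
Variables (C : numClosedFieldType) (n : nat) (r : relations C n).
Local Notation A := (presented r).
Implicit Types M N : supermod A.

Lemma actD M x y : act M (x + y) = act M x + act M y.
Proof. by rewrite /act rmorphD. Qed.
Lemma actM M x y v : act M (x * y) v = act M x (act M y v).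
Proof. by rewrite /act rmorphM -comp_lfunE. Qed.
Lemma act_scal M c : act M (sa_scal A c) = c *: \1%VF.
Proof. by rewrite /act sh_scal. Qed.

Definition gens M (i : 'I_n) : 'End(M) := act M (gen r i).

Lemma gens_odd M i : @end_gr C M true (gens M i).
Proof. exact/(sh_gr (sm_act M))/gen_odd. Qed.

(** Stability under the generators of a presented algebra suffices, by induction on
    noncommutative polynomials. *)
Lemma submodule_gens M (W : {vspace M}) : submodule W <-> stable (gens M) W.
Proof.
split=> [h i w|h a]; first exact: h.
elim/pres_ind: a => e w wW; elim: e w wW => [i|c|x IHx y IHy|x IHx y IHy] w wW.
- exact: h.
- by rewrite (act_scal M c) scale_lfunE id_lfunE memvZ.
- by rewrite (pi_add r) actD add_lfunE memvD ?IHx ?IHy.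
- by rewrite (pi_mul r) actM IHx ?IHy.
Qed.

(** For odd generators the sign of a homogeneous homomorphism only depends on its
    parity. *)
Lemma homog_hom_gens M N p (f : 'Hom(M, N)) :
  homog_hom p f <->
  (forall q m, m \in sv_gr M q -> f m \in sv_gr N (p (+) q)) /\
  (forall i m, f (gens M i m) = (-1) ^+ p *: gens N i (f m)).
Proof.
split=> [[h1 h2]|[h1 h2]]; split=> //.
  by move=> i m; rewrite (h2 true) ?andbT //; apply: gen_odd.
move=> q _ m [e he ->]; elim: he m => {q e}.
- by move=> i m; rewrite andbT; apply: h2.
- move=> c m; rewrite andbF -[\pi_(pres r) _]/(sa_scal A c) !act_scal.
  by rewrite !scale_lfunE !id_lfunE linearZ scale1r.
- move=> q m; rewrite -[\pi_(pres r) _]/(sa_scal A 0) !act_scal !scale0r.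
  by rewrite !zero_lfunE linear0 scaler0.
- by move=> q x y _ IHx _ IHy m; rewrite (pi_add r) !actD !add_lfunE linearD /= IHx IHy scalerDr.
- move=> q q' x y _ IHx _ IHy m; rewrite (pi_mul r) !actM IHx IHy !linearZ /= scalerA.
  by rewrite -signr_addb -andb_addr addbC.
Qed.

Lemma ungraded_simple_irred M : ungraded_simple M <-> irred (gens M).
Proof. by split=> -[h0 h]; split=> // W /submodule_gens; apply: h. Qed.

Lemma graded_subspaceP M (W : {vspace M}) :
  (forall v, v \in W -> sv_proj M false v \in W) -> graded_subspace W.
Proof.
move=> h; apply/eqP; rewrite eqEsubv; apply/andP; split; apply/subvP => v.
  move=> vW; have vt : sv_proj M true v \in W.
    by rewrite -(addKr (sv_proj M false v) (sv_proj _ _ _)) sv_proj_sum memvD ?memvN ?h.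
  by rewrite -[v]sv_proj_sum; apply: memv_add; rewrite memv_cap ?h ?vt // sv_proj_mem.
by case/memv_addP => u /memv_capP[uW _] [w /memv_capP[wW _] ->]; rewrite memvD.
Qed.

Lemma simple_irred M : ungraded_simple M -> simple M.
Proof. by move=> [h0 h]; split=> // W _; apply: h. Qed.

Lemma homog_hom_kernel M N p (f : 'Hom(M, N)) : homog_hom p f ->
  graded_subspace (lker f) /\ submodule (lker f).
Proof.
move=> hf; have [h1 h2] := hf; split; last first.
  apply/submodule_gens/(lker_stable (e := fun=> (-1) ^+ p) (T' := gens N)).
  by have [_] := (homog_hom_gens _ _).1 hf.
apply: graded_subspaceP => v; rewrite !memv_ker -{1}[v]sv_proj_sum linearD /=.
rewrite addr_eq0 => /eqP e; rewrite -memv0 -(sv_capE N p) memv_cap.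
have := h1 _ _ (sv_proj_mem (V := M) false v); have := h1 _ _ (sv_proj_mem (V := M) true v).
rewrite addbF addbT => m1 m0; rewrite m0 e memvN.
exact: m1.
Qed.

Lemma homog_hom_image M N p (f : 'Hom(M, N)) : homog_hom p f ->
  graded_subspace (limg f) /\ submodule (limg f).
Proof.
move=> hf; have [h1 h2] := (homog_hom_gens _ _).1 hf; split; last first.
  apply/submodule_gens => i _ /memv_imgP[v _ ->].
  by rewrite -[gens N i _](signrZK p) -h2 -linearZ memv_img ?memvf.
apply: graded_subspaceP => _ /memv_imgP[v _ ->].
rewrite -[v]sv_proj_sum !linearD /=.
have := h1 _ _ (sv_proj_mem (V := M) false v); have := h1 _ _ (sv_proj_mem (V := M) true v).
rewrite addbF addbT; case: (p) => /= m1 m0.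
  by rewrite (@sv_proj_0 _ N false (f (sv_proj M false v))) // add0r (sv_proj_id m1) memv_img ?memvf.
by rewrite (@sv_proj_0 _ N false (f (sv_proj M true v))) // addr0 (sv_proj_id m0) memv_img ?memvf.
Qed.

Lemma lfun_bij (V W : vectType C) (f : 'Hom(V, W)) :
  lker f = 0%VS -> limg f = fullv -> bijective f.
Proof.
move=> k i; exists (f^-1%VF) => v; first by rewrite lker0_lfunK //; apply/eqP.
by rewrite limg_lfunVK // i memvf.
Qed.

(** Kernel and image of a homogeneous homomorphism are graded submodules. *)
Lemma simple_iso M N p (f : 'Hom(M, N)) : simple M -> simple N ->
  homog_hom p f -> f != 0 -> isomorphic M N.
Proof.
move=> [_ sM] [_ sN] hf f0; exists p, f; split=> //.
have [gk sk] := homog_hom_kernel hf; have [gi si] := homog_hom_image hf.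
apply: lfun_bij; first by case: (sM _ gk sk) => // /(lker_neq_full f0).
case: (sN _ gi si) => // e; case/eqP: f0; apply/lfunP => v; apply/eqP.
by rewrite zero_lfunE -memv0 -e memv_img ?memvf.
Qed.

(** Some parity component of [f] is nonzero and still commutes with the generators. If
    it is odd, composing it with the parity operator, which anticommutes with the odd
    generators, makes it an odd homomorphism. *)
Lemma intertwiner_iso M N (f : 'Hom(M, N)) : simple M -> simple N ->
  intertwines (gens M) (gens N) f -> f != 0 -> isomorphic M N.
Proof.
move=> sM sN fT f0.
have hT p := hom_part_intertwines p (@gens_odd M) (@gens_odd N) fT.
have [p hp0] : exists p, hom_part p f != 0.
  have [e|] := eqVneq (hom_part false f) 0; last by exists false.
  by exists true; apply: contra_neq f0 => e'; rewrite [f]hom_part_sum e e' addr0.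
pose g : 'Hom(M, N) := if p then (hom_part p f \o parity M)%VF else hom_part p f.
have gE m : g m = if p then hom_part p f (parity M m) else hom_part p f m.
  by rewrite /g; case: (p); rewrite ?comp_lfunE.
apply: (@simple_iso M N p g) => //.
  apply/homog_hom_gens; split=> [q m mq|i m].
    have := hom_part_gr p f mq; rewrite gE; case: (p) => // hm.
    by rewrite (parityE mq) linearZ; apply: memvZ.
  rewrite !gE; case: (p) hT => hT; last by rewrite hT scale1r.
  by rewrite (parity_odd m (@gens_odd M i)) linearN /= hT expr1 scaleN1r.
apply: contra_neq hp0 => g0; apply/lfunP => m; rewrite zero_lfunE.
have := gE m; have := gE (parity M m); rewrite g0 !zero_lfunE parityK.
by case: (p).
Qed.

(** Composition with the parity operator turns an odd isomorphism into a linear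
    bijection that commutes with the generators without signs. *)
Lemma isomorphic_intertwiner M N : isomorphic M N ->
  exists g : 'Hom(M, N), intertwines (gens M) (gens N) g /\ bijective g.
Proof.
move=> [p [f [hf fb]]]; have [_ h2] := (homog_hom_gens _ _).1 hf.
case: p {hf} h2 => h2; last by exists f; split=> // i m; rewrite h2 scale1r.
exists (f \o parity M)%VF; split.
  move=> i m; rewrite !comp_lfunE.
  by rewrite (parity_odd m (@gens_odd M i)) linearN /= h2 expr1 scaleN1r opprK.
case: fb => f' fK f'K; exists (fun x => parity M (f' x)) => x; rewrite comp_lfunE.
  by rewrite fK parityK.
by rewrite parityK f'K.
Qed.

(** By Schur's lemma without grading, an even endomorphism is a scalar, and an odd one
    composed with the parity operator is a scalar too; the latter is both even and odd,
    hence zero. *)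
Lemma irred_type_M M : ungraded_simple M -> type_M M.
Proof.
move=> hM; have iM := (ungraded_simple_irred M).1 hM.
have M0 := iM.1.
have id_hom : homog_hom false (\1%VF : 'Hom(M, M)).
  by apply/homog_hom_gens; split=> [q m|i m]; rewrite !id_lfunE // scale1r.
exists <[\1%VF]>%VS; split; last first.
  rewrite dim_vline; case: eqP => // e; case: M0; apply/eqP; rewrite -subv0.
  by apply/subvP => v _; rewrite memv0 -[v]id_lfunE e zero_lfunE.
move=> f; split.
  case/vlineP => k ->; exists (k *: \1%VF), 0; split; last by rewrite addr0.
    case: id_hom => h1 h2; split=> [q m mq|q a m aq].
      by rewrite scale_lfunE id_lfunE memvZ.
    by rewrite !scale_lfunE !id_lfunE andFb scale1r linearZ.
  by split=> [q m _|q a m _]; rewrite !zero_lfunE ?mem0v // linear0 scaler0.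
case=> f0 [f1 [/homog_hom_gens[_ h0] /homog_hom_gens[g1 h1] ->]].
have [k ->] : exists k, f0 = k *: \1%VF.
  by apply: (schur_scalar iM) => i m; rewrite h0 scale1r.
suff -> : f1 = 0 by rewrite addr0 memvZ ?memv_line.
have [c ec] : exists c, (f1 \o parity M)%VF = c *: \1%VF.
  apply: (schur_scalar iM) => i m; rewrite !comp_lfunE.
  by rewrite (parity_odd m (@gens_odd M i)) linearN /= h1 expr1 scaleN1r opprK.
have f1E m : f1 m = c *: parity M m.
  by rewrite -{1}(parityK m) -comp_lfunE ec scale_lfunE id_lfunE.
suff c0 : c = 0 by apply/lfunP => m; rewrite f1E c0 scale0r zero_lfunE.
have [q [v [vq v0]]] := sv_homog_ex M0.
have := g1 _ _ vq; rewrite f1E (parityE vq) => h.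
have : c *: ((-1) ^+ q *: v) \in (sv_gr M q :&: sv_gr M (~~ q))%VS.
  by rewrite memv_cap; apply/andP; split; [rewrite !memvZ | exact: h].
rewrite sv_capE memv0 !scaler_eq0 signr_eq0 (negbTE v0) !orbF.
by move/eqP.
Qed.

End Modules.

(** * Clifford modules of even rank *)

Lemma sv_proj_parity (C : numClosedFieldType) (V : svect C) u :
  sv_proj V false u = 2^-1 *: (u + parity V u).
Proof.
rewrite -{2}[u]sv_proj_sum /parity sub_lfunE addrACA subrr addr0 -mulr2n.
by rewrite -scaler_nat scalerA mulVf ?scale1r // pnatr_eq0.
Qed.

Section CliffordOps.
Variables (C : numClosedFieldType) (n : nat).

Definition cliff_rep (V : vectType C) (c : 'I_n -> 'End(V)) : Prop :=
  (forall i v, c i (c i v) = v) /\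
  (forall i j v, i != j -> c i (c j v) = - c j (c i v)).

Section Words.
Variables (V : vectType C) (c : 'I_n -> 'End(V)).
Hypothesis hc : cliff_rep c.

Definition cliff_word (s : seq 'I_n) : 'End(V) :=
  foldr (fun i f => (c i \o f)%VF) \1%VF s.

Lemma cliff_word_cons i s v : cliff_word (i :: s) v = c i (cliff_word s v).
Proof. by rewrite /= comp_lfunE. Qed.

(** A generator anticommutes with every letter of the word different from itself. *)
Lemma cliff_word_comm i s v :
  c i (cliff_word s v) = (-1) ^+ count (predC1 i) s *: cliff_word s (c i v).
Proof.
case: hc => csq canti; elim: s => [|j s IHs].
  by rewrite !id_lfunE scale1r.
rewrite !cliff_word_cons [count _ _]/=.
have [->|ij] := eqVneq j i; first by rewrite IHs linearZ.
by rewrite canti 1?eq_sym // IHs linearZ /= exprD expr1 mulN1r scaleNr.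
Qed.

Lemma cliff_word_sign i s v : uniq s ->
  c i (cliff_word s v) = (-1) ^+ (size s - (i \in s))%N *: cliff_word s (c i v).
Proof.
move=> us; rewrite cliff_word_comm -(count_predC (pred1 i) s).
by rewrite count_uniq_mem // addKn.
Qed.

Lemma cliff_word_inj s v : cliff_word s v = 0 -> v = 0.
Proof.
case: hc => csq _; elim: s => [|i s IHs]; first by rewrite id_lfunE.
rewrite cliff_word_cons => e; apply: IHs.
by rewrite -(csq i (cliff_word s v)) e linear0.
Qed.

Lemma cliff_word_stable s W : stable c W -> forall w, w \in W -> cliff_word s w \in W.
Proof.
move=> Wst w wW; elim: s => [|i s IHs]; first by rewrite id_lfunE.
by rewrite cliff_word_cons Wst.
Qed.

End Words.

(** The seed of the construction in [cliff_hom]. *)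
Lemma rank_one_ex (U N : vectType C) (w : N) : (fullv : {vspace U}) <> 0%VS -> w != 0 ->
  exists phi : 'Hom(U, N), phi != 0 /\ forall u, phi u \in <[w]>%VS.
Proof.
move=> U0 w0; pose e := vbasis (fullv : {vspace U}).
have dU : (0 < \dim (fullv : {vspace U}))%N by rewrite lt0n dimv_eq0; apply/eqP.
pose i0 := Ordinal dU.
have l : linear (fun u => coord e i0 u *: w).
  by move=> k u v; rewrite linearP scalerDl scalerA.
exists (linfun (fun u => coord e i0 u *: w)); split; last first.
  by move=> u; rewrite (linfun_linE l) memvZ // memv_line.
apply: contraNneq w0 => e0.
have := linfun_linE l e`_i0; rewrite e0 zero_lfunE coord_free; last first.
  exact: (basis_free (vbasisP _)).
by rewrite eqxx scale1r => <-.
Qed.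

(** The map is made compatible with one generator after another. If [phi] intertwines
    the first [k] of them, then [phi + d_k phi c_k] intertwines one more. When this sum
    vanishes, [phi] anticommutes with the next generator, and composing with a Clifford
    word that commutes with the first [k] generators and anticommutes with the next one
    repairs the sign. Such a word exists at every stage because [n] is even. *)
Theorem cliff_hom (U N : vectType C) (c : 'I_n -> 'End(U)) (d : 'I_n -> 'End(N))
    (W : {vspace N}) : ~~ odd n -> cliff_rep c -> cliff_rep d ->
  (fullv : {vspace U}) <> 0%VS -> W <> 0%VS -> stable d W ->
  exists phi : 'Hom(U, N), [/\ phi != 0, (limg phi <= W)%VS & intertwines c d phi].
Proof.
move=> nev hc hd U0 W0 Wst; have [csq canti] := hc; have [dsq danti] := hd.
suff key k : (k <= n)%N -> exists phi : 'Hom(U, N), [/\ phi != 0,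
    forall u, phi u \in W & forall (i : 'I_n) u, (i < k)%N -> phi (c i u) = d i (phi u)].
  have [phi [p0 pW pT]] := key _ (leqnn n); exists phi; split=> //.
    by apply/subvP => _ /memv_imgP[u _ ->].
  by move=> i u; apply: pT.
elim: k => [_|k IHk kn].
  have [w0 wW] : vpick W != 0 /\ vpick W \in W.
    by rewrite vpick0 memv_pick; split=> //; apply/eqP.
  have [phi [p0 pw]] := rank_one_ex U0 w0.
  exists phi; split=> // u; have := pw u; apply: subvP.
  by rewrite -memvE.
have [phi [p0 pW pT]] := IHk (ltnW kn).
pose x := Ordinal kn; pose phi1 := (phi + (d x \o phi \o c x))%VF.
have phi1E u : phi1 u = phi u + d x (phi (c x u)) by rewrite add_lfunE !comp_lfunE.
have [e1|n1] := eqVneq phi1 0; last first.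
  exists phi1; split=> // [u|i u]; first by rewrite phi1E memvD ?Wst.
  rewrite ltnS leq_eqVlt => /orP[/eqP e|ik].
    have -> : i = x by apply: ord_inj.
    by rewrite !phi1E csq linearD /= dsq addrC.
  have nxi : x != i by rewrite -val_eqE /= gtn_eqF.
  rewrite !phi1E (pT i) // (canti x) // linearN /= (pT i) // linearN /=.
  by rewrite (danti x) // opprK linearD.
have anti u : phi (c x u) = - d x (phi u).
  apply/eqP; rewrite -addr_eq0 addrC; apply/eqP.
  have := phi1E (c x u); rewrite e1 zero_lfunE csq => /esym.
  by rewrite addrC.
(* The first [k] generators. For [k] odd their product is the word sought; for [k] even
   one more generator, beyond the next one, corrects both signs. *)
pose s0 := map (widen_ord (ltnW kn)) (enum 'I_k).
have s0mem (i : 'I_n) : (i \in s0) = (i < k)%N.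
  apply/mapP/idP => [[j _ ->] /=|ik]; first exact: ltn_ord.
  by exists (Ordinal ik); rewrite ?mem_enum //; apply: ord_inj.
have s0u : uniq s0.
  by rewrite map_inj_uniq ?enum_uniq // => i j /(congr1 val) /= /ord_inj.
have s0s : size s0 = k by rewrite size_map size_enum_ord.
have [s [us sx si]] : exists s : seq 'I_n, [/\ uniq s, odd (size s - (x \in s))
    & forall i : 'I_n, (i < k)%N -> ~~ odd (size s - (i \in s))].
  have [ok|ek] := boolP (odd k).
    exists s0; rewrite s0u s0s; split=> // [|i ik]; rewrite s0mem ?ltnn ?subn0 // ik.
    by rewrite subn1; case: (k) ok ik => //= k' ->.
  have k1n : (k.+1 < n)%N.
    rewrite ltn_neqAle kn andbT; apply: contraNneq nev => <-.
    by rewrite /= ek.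
  exists (Ordinal k1n :: s0); rewrite /= s0mem /= -ltnNge ltnS leqnSn s0u s0s; split=> // [|i ik].
    by rewrite inE s0mem -val_eqE /= ltnn ltn_eqF // subn0 /= ek.
  rewrite inE s0mem ik orbT subn1 /= //.
exists (cliff_word d s \o phi)%VF; split.
- apply: contra_neq p0 => e0; apply/lfunP => u; rewrite zero_lfunE.
  by apply: (cliff_word_inj hd (s := s)); rewrite -comp_lfunE e0 zero_lfunE.
- by move=> u; rewrite comp_lfunE; apply: cliff_word_stable.
move=> i u; rewrite !comp_lfunE (cliff_word_sign hd) // ltnS leq_eqVlt => /orP[/eqP e|ik].
  have -> : i = x by apply: ord_inj.
  by rewrite -signr_odd sx expr1 scaleN1r -linearN -anti.
by rewrite -signr_odd (negbTE (si _ ik)) scale1r pT.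
Qed.

Section SimpleModule.
Variable U : supermod (Clifford C n).
Hypothesis n_even : ~~ odd n.
Local Notation c := (gens (r := Relations (@Clifford_homog C n)) U).

Lemma Clifford_cliff_rep : cliff_rep c.
Proof.
split=> [i v|i j v ij]; rewrite /gens -!actM.
  by rewrite -expr2 (c_sq C i) /act rmorph1 id_lfunE.
by rewrite (c_anti C ij) /act rmorphN opp_lfunE -/(act U _) actM.
Qed.

Lemma cliff_word_parity s v :
  parity U (cliff_word c s v) = (-1) ^+ size s *: cliff_word c s (parity U v).
Proof.
elim: s => [|i s IHs]; first by rewrite !id_lfunE scale1r.
rewrite !cliff_word_cons (parity_odd _ (@gens_odd _ _ _ U i)) IHs linearZ /= exprS mulN1r.
by rewrite scaleNr.
Qed.

(** The volume element passes [n - 1] other generators, an odd number. *)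
Lemma volume_anti i v : (0 < n)%N ->
  c i (cliff_word c (enum 'I_n) v) = - cliff_word c (enum 'I_n) (c i v).
Proof.
move=> n0; rewrite (cliff_word_sign Clifford_cliff_rep) ?enum_uniq //.
have on : odd n.-1 by move: n_even n0; case: (n) => //= m; rewrite negbK.
by rewrite size_enum_ord mem_enum -signr_odd subn1 on expr1 scaleN1r.
Qed.

(** The volume element composed with the parity operator is even and commutes with the
    Clifford operators, so one of its eigenspaces is a nonzero graded submodule, hence
    everything. The parity operator is therefore a multiple of the volume element, and
    every submodule is graded. *)
Theorem Clifford_irred : (0 < n)%N -> simple U -> irred c.
Proof.
move=> n0 [U0 sU]; split=> // W Wst; set w := cliff_word c (enum 'I_n).
pose g := (w \o parity U)%VF.
have gE v : g v = w (parity U v) by rewrite comp_lfunE.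
have [a [v [v0 va]]] := eigen_ex g U0.
have wP u : parity U (w u) = w (parity U u).
  by rewrite cliff_word_parity size_enum_ord -signr_odd (negbTE n_even) scale1r.
have gP u : parity U (g u) = g (parity U u) by rewrite !gE wP.
have gc i u : g (c i u) = c i (g u).
  rewrite !gE (parity_odd _ (@gens_odd _ _ _ U i)) linearN /= -[RHS]opprK.
  by rewrite volume_anti // !opprK.
pose K := lker (g - a *: \1%VF).
have KE u : (u \in K) = (g u == a *: u).
  by rewrite memv_ker sub_lfunE scale_lfunE id_lfunE subr_eq0.
have Ksub : submodule K.
  apply/submodule_gens => i u; rewrite !KE gc => /eqP ->.
  by rewrite linearZ.
have Kgr : graded_subspace K.
  apply: graded_subspaceP => u uK; have Pu : parity U u \in K.
    by move: uK; rewrite !KE -gP => /eqP ->; rewrite linearZ.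
  by rewrite sv_proj_parity memvZ // memvD.
(* The eigenvalue equation [w (parity v) = a v], applied to [parity u]. *)
have wE u : w u = a *: parity U u.
  have : parity U u \in K.
    case: (sU _ Kgr Ksub) => [e|->]; last exact: memvf.
    by case/negP: v0; rewrite -memv0 -e KE va.
  by rewrite KE gE parityK => /eqP.
have a0 : a != 0.
  apply: contraNneq v0 => a0; apply/eqP.
  by apply: (cliff_word_inj Clifford_cliff_rep (s := enum 'I_n)); rewrite -/w wE a0 scale0r.
apply: sU; last by apply/submodule_gens.
apply: graded_subspaceP => u uW; have Pu : parity U u \in W.
  by rewrite -[parity U u](scalerK a0) -wE memvZ // cliff_word_stable.
by rewrite sv_proj_parity memvZ // memvD.
Qed.

End SimpleModule.
End CliffordOps.

(** * Clifford and symmetric group elements from the relations of type B *)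

Section RingLevel.
Variables (m : nat) (A : pzRingType) (T : nat -> A).
Hypothesis T_sq : forall i, (i <= m)%N -> T i * T i = 1.
Hypothesis T_braid : forall i, (i.+1 < m)%N -> T i * T i.+1 * T i = T i.+1 * T i * T i.+1.
Hypothesis T_anti : forall i j, (i.+1 < j)%N -> (j <= m)%N -> T i * T j = - (T j * T i).
Hypothesis T_last : forall i, i.+1 = m -> (T i * T m) ^+ 4 = -1.

Fixpoint clgen_rec (d : nat) : A :=
  if d is d'.+1 then - (T (m - d) * clgen_rec d' * T (m - d)) else T m.
(** Generators of the Clifford algebra inside the algebra of type B, in terms of its
    generators [T 0, ..., T m]. *)
Definition clgen (i : nat) : A := clgen_rec (m - i).

Lemma clgen_last : clgen m = T m.
Proof. by rewrite /clgen subnn. Qed.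

Lemma clgen_step i : (i < m)%N -> clgen i = - (T i * clgen i.+1 * T i).
Proof.
move=> im; rewrite /clgen; have -> : (m - i = (m - i.+1).+1)%N by lia.
by rewrite /= (_ : (m - (m - i.+1).+1)%N = i); last by lia.
Qed.

Lemma clgen_ind (P : nat -> Prop) : P m -> (forall i, (i < m)%N -> P i.+1 -> P i) ->
  forall i, (i <= m)%N -> P i.
Proof.
move=> Pm Ps i im; rewrite -(subKn im); elim: (m - i)%N (leq_subr i m) => [|d IHd] dm.
  by rewrite subn0.
apply: Ps; first by lia.
by rewrite -subSn // subSS; apply/IHd/ltnW.
Qed.

Lemma T_clgen i : (i < m)%N -> T i * clgen i = - (clgen i.+1 * T i).
Proof. by move=> im; rewrite (clgen_step im) mulrN !mulrA T_sq ?mul1r // ltnW. Qed.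

Lemma T_clgenS i : (i < m)%N -> T i * clgen i.+1 = - (clgen i * T i).
Proof. by move=> im; rewrite (clgen_step im) mulNr opprK -mulrA T_sq ?mulr1 // ltnW. Qed.

(** Only generators [T k] with [j <= k] occur in [clgen j], in odd number, and all are
    far from [T i]. *)
Lemma T_clgen_hi i j : (i.+1 < j)%N -> (j <= m)%N -> T i * clgen j = - (clgen j * T i).
Proof.
move=> + jm; elim/clgen_ind: j / jm => [im|j jm IHj ij]; first by rewrite clgen_last T_anti.
have h := T_anti ij (ltnW jm).
rewrite (clgen_step jm) mulrN mulNr opprK !mulrA h !mulNr opprK -(mulrA (T j)) IHj; last by lia.
by rewrite mulrN mulNr -(mulrA _ (T j)) -[T j * T i]opprK -h mulrN !mulrA.
Qed.

(** Induction on [i - j]; the first step, where [T j] and [T i] are neighbours, is the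
    braid relation. *)
Lemma T_clgen_lo i j : (j < i)%N -> (i < m)%N -> T i * clgen j = - (clgen j * T i).
Proof.
move=> + im; have [d] := ubnP (i - j); elim: d j => // d IHd j hd ji.
have jm : (j < m)%N by lia.
have [e|nji] := eqVneq i j.+1.
  have br : T j * T i * T j = T i * T j * T i by rewrite e T_braid // -e.
  have hi := T_clgen_hi (i := j) (j := i.+1).
  have -> : clgen j = T j * T i * clgen i.+1 * T i * T j.
    by rewrite clgen_step // -e clgen_step // mulrN mulNr opprK !mulrA.
  rewrite !mulrA -br -!mulrA (mulrA (T j) (clgen _)) hi; [|lia|lia].
  rewrite !mulNr !mulrN !mulrA -(mulrA _ (T j) (T i)) -(mulrA _ (T j * T i)) br.
  by rewrite !mulrA.
have far : T j * T i = - (T i * T j) by apply: T_anti; lia.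
rewrite (clgen_step jm) mulrN mulNr opprK !mulrA -[T i * T j]opprK -far !mulNr opprK.
rewrite -(mulrA (T j)) IHd; [|lia|lia].
by rewrite mulrN mulNr -(mulrA _ (T j)) far mulrN !mulrA.
Qed.

Lemma T_clgen_far i j : (i < m)%N -> (j <= m)%N -> j != i -> j != i.+1 ->
  T i * clgen j = - (clgen j * T i).
Proof.
move=> im jm ji ji1; have [lt|ge] := ltnP j i; first exact: T_clgen_lo.
by apply: T_clgen_hi => //; lia.
Qed.

Lemma clgen_sq j : (j <= m)%N -> clgen j * clgen j = 1.
Proof.
move=> jm; elim/clgen_ind: j / jm => [|j jm IHj]; first by rewrite clgen_last T_sq.
rewrite (clgen_step jm) mulrNN !mulrA -(mulrA _ (T j) (T j)) T_sq ?(ltnW jm) // mulr1.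
by rewrite -(mulrA (T j)) IHj mulr1 T_sq // ltnW.
Qed.

(** The relation of order eight between the last two generators gives the case of the
    last two Clifford elements, and conjugation by the [T i] propagates it. *)
Lemma clgen_anti_last i : (i < m)%N -> clgen i * clgen m = - (clgen m * clgen i).
Proof.
move=> im0; have im1 := ltnW im0; move: im0; elim/clgen_ind: i / im1 => [|i im IHi _]; first by rewrite ltnn.
have [e|nim] := eqVneq i.+1 m.
  apply: anti_of_sq; rewrite ?expr2 ?clgen_sq ?(ltnW im) // -expr2.
  rewrite (clgen_step im) e clgen_last mulNr sqrrN -mulrA -expr2.
  by rewrite -exprM T_last.
have i1m : (i.+1 < m)%N by lia.
have h := T_clgen_hi i1m (leqnn m).
rewrite (clgen_step im) mulNr mulrN opprK -(mulrA _ (T i)) h mulrN opprK.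
by rewrite !mulrA -(mulrA (T i)) IHi // mulrN mulNr !mulrA h !mulNr opprK.
Qed.

Lemma clgen_anti_lt i j : (i < j)%N -> (j <= m)%N -> clgen i * clgen j = - (clgen j * clgen i).
Proof.
move=> + jm; elim/clgen_ind: j / jm i => [|j jm IHj] i ij; first exact: clgen_anti_last.
have h : T j * clgen i = - (clgen i * T j) by apply: T_clgen_lo.
rewrite (clgen_step jm) mulNr mulrN opprK !mulrA -[clgen i * T j]opprK -h !mulNr opprK.
rewrite -(mulrA (T j)) IHj; last by lia.
by rewrite mulrN mulNr -(mulrA _ (T j)) h mulrN !mulrA.
Qed.

Lemma clgen_anti i j : i != j -> (i <= m)%N -> (j <= m)%N -> clgen i * clgen j = - (clgen j * clgen i).
Proof.
move=> ij im jm; have [lt|gt|e] := ltngtP i j; first exact: clgen_anti_lt.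
  by rewrite (clgen_anti_lt gt) // opprK.
by rewrite e eqxx in ij.
Qed.

Variable r : A.
Hypothesis r_central : forall x, r * x = x * r.
Hypothesis r_half : r * r * 2%:R = 1.

(** With [r] a square root of one half, this is the unit vector along which the
    generator [T i] reflects the Clifford elements. *)
Definition cldiff (i : nat) : A := r * (clgen i - clgen i.+1).
(** The factor of [T i] in the symmetric group, as [T i = cldiff i * cperm i]. *)
Definition cperm (i : nat) : A := cldiff i * T i.

Lemma acm_r x y : acm (r * x) (r * y) = r * r * acm x y.
Proof.
rewrite /acm mulrDr -!mulrA; congr (r * _ + r * _).
  by rewrite (mulrA x) -r_central mulrA.
by rewrite (mulrA y) -r_central mulrA.
Qed.

Lemma acm_clgen i j : i != j -> (i <= m)%N -> (j <= m)%N -> acm (clgen i) (clgen j) = 0.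
Proof. by move=> ij im jm; rewrite /acm (clgen_anti ij) // addNr. Qed.

Lemma acm_clgen_self i : (i <= m)%N -> acm (clgen i) (clgen i) = 2%:R.
Proof. by move=> im; rewrite /acm clgen_sq. Qed.

Lemma cldiff_sq i : (i < m)%N -> cldiff i * cldiff i = 1.
Proof.
move=> im; have im' := ltnW im.
have ii : i != i.+1 by lia.
have sq : (clgen i - clgen i.+1) * (clgen i - clgen i.+1) = 2%:R.
  rewrite mulrBl !mulrBr !clgen_sq // (clgen_anti ii) // opprK opprB addrACA.
  by rewrite [_ - _]addrC addNr addr0.
by rewrite /cldiff -mulrA (mulrA _ r) -r_central -mulrA mulrA sq r_half.
Qed.

Lemma cldiff_braid i : (i.+1 < m)%N -> acm (cldiff i) (cldiff i.+1) = -1.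
Proof.
move=> im; rewrite acm_r !(acmBl, acmBr) (@acm_clgen i i.+1) ?(@acm_clgen i i.+2) ?(@acm_clgen i.+1 i.+2) ?acm_clgen_self //;
  try lia.
by rewrite !subr0 sub0r mulrN r_half.
Qed.

Lemma cldiff_far i j : (i.+1 < j)%N -> (j < m)%N -> cldiff i * cldiff j = - (cldiff j * cldiff i).
Proof.
move=> ij jm; apply: acm0; rewrite acm_r !(acmBl, acmBr) !acm_clgen ?subr0 ?mulr0 //; lia.
Qed.

(** Both factors of [cperm i] exchange [clgen i] and [clgen i.+1] and change the sign of
    all Clifford elements; the two effects cancel. *)
Lemma cperm_clgen i j : (i < m)%N -> (j <= m)%N -> cperm i * clgen j = clgen j * cperm i.
Proof.
move=> im jm; have im' := ltnW im.
have ii : i != i.+1 by lia.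
rewrite /cperm /cldiff -!mulrA [clgen j * _]mulrA -r_central -mulrA; congr (r * _).
have [->|ji] := eqVneq j i.
  rewrite T_clgen // mulrN !mulrA -mulNr; congr (_ * _).
  by rewrite mulrBl mulrBr !clgen_sq // opprB.
have [->|ji1] := eqVneq j i.+1.
  rewrite T_clgenS // mulrN !mulrA -mulNr; congr (_ * _).
  by rewrite mulrBl mulrBr !clgen_sq // opprB.
rewrite T_clgen_far // mulrN !mulrA -mulNr; congr (_ * _).
by rewrite mulrBl mulrBr opprB (@clgen_anti i j) ?(@clgen_anti i.+1 j) 1?eq_sym // opprK addrC.
Qed.

Lemma cperm_cldiff i j : (i < m)%N -> (j < m)%N -> cperm i * cldiff j = cldiff j * cperm i.
Proof.
move=> im jm; rewrite /cldiff mulrA -r_central -(mulrA r) -[RHS]mulrA; congr (r * _).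
by rewrite mulrBr mulrBl !cperm_clgen // ltnW.
Qed.

Lemma cperm_sq i : (i < m)%N -> cperm i * cperm i = 1.
Proof.
move=> im; rewrite {2}/cperm (mulrA (cperm i)) cperm_cldiff // -(mulrA (cldiff i)) /cperm -(mulrA _ (T i)).
by rewrite T_sq ?(ltnW im) // mulr1 cldiff_sq.
Qed.

Lemma T_cperm i : (i < m)%N -> T i = cldiff i * cperm i.
Proof. by move=> im; rewrite /cperm mulrA cldiff_sq // mul1r. Qed.

(** As [cperm i] commutes with the Clifford elements, products of the [cperm i] separate
    into a Clifford part, in reversed order, and a product of generators. *)
Lemma cperm_mul i j : (i < m)%N -> (j < m)%N -> cperm i * cperm j = cldiff j * cldiff i * (T i * T j).
Proof.
move=> im jm; rewrite {2}/cperm (mulrA (cperm i)) cperm_cldiff // -(mulrA (cldiff j)) /cperm.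
by rewrite -(mulrA (cldiff i)) (mulrA (cldiff j)).
Qed.

Lemma cperm_far i j : (i.+1 < j)%N -> (j < m)%N -> cperm i * cperm j = cperm j * cperm i.
Proof.
move=> ij jm; have im : (i < m)%N by lia.
by rewrite !cperm_mul // (cldiff_far ij jm) (T_anti ij (ltnW jm)) mulrN mulNr.
Qed.

Lemma cperm_mul3 i j : (i < m)%N -> (j < m)%N ->
  cperm i * cperm j * cperm i = cldiff i * cldiff j * cldiff i * (T i * T j * T i).
Proof.
move=> im jm; rewrite {2}/cperm (mulrA (cperm i * cperm j)) -(mulrA (cperm i)) (cperm_cldiff jm im).
rewrite (mulrA (cperm i)) (cperm_cldiff im im) -(mulrA (cldiff i)) (cperm_mul im jm).
by rewrite -(mulrA (cldiff i)) -(mulrA _ (T i * T j)) (mulrA (cldiff i)) (mulrA (cldiff i)).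
Qed.

(** Both the Clifford part and the part in the generators satisfy the braid relation. *)
Lemma cperm_braid i : (i.+1 < m)%N -> cperm i * cperm i.+1 * cperm i = cperm i.+1 * cperm i * cperm i.+1.
Proof.
move=> im; have im' := ltnW im; rewrite !cperm_mul3 // T_braid //; congr (_ * _).
have := cldiff_braid im; have := cldiff_sq im; have := cldiff_sq im'; rewrite /acm.
set x := cldiff i; set y := cldiff i.+1 => xx yy xy.
have e1 : y * x = -1 - x * y by rewrite -xy addrC addKr.
have l : x * (y * x) = - x - y by rewrite e1 mulrBr mulrN1 mulrA xx mul1r.
have r' : y * x * y = - y - x by rewrite e1 mulrBl mulN1r -mulrA yy mulr1.
by rewrite -mulrA l r' addrC.
Qed.

Lemma cperm_rep : exists rho : 'S_m.+1 -> A,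
  [/\ rho 1%g = 1, forall v w, rho (v * w)%g = rho w * rho v &
      forall i, (i < m)%N -> rho (adj m i) = cperm i].
Proof. exact: (adj_rep cperm_sq cperm_braid cperm_far). Qed.

End RingLevel.

(** * Tensor products, and the structure of modules over CB *)

Section Tensors.
Variables (C : numClosedFieldType) (U S : vectType C).
Local Notation b := (vbasis (fullv : {vspace S})).
Local Notation pure := (@tens_pure C U S).

Definition dual_basis (k : 'I_(\dim {:S})) : dual S := linfun (coord b k : S -> C^o).

Lemma dual_basisE k v : dual_basis k v = coord b k v.
Proof. by rewrite linfun_linE //; move=> c x y; rewrite linearP. Qed.

Lemma pure_linear_l v : linear (pure^~ v).
Proof.
move=> c x y; apply/lfunP => phi.
by rewrite add_lfunE scale_lfunE !tens_pureE scalerDr !scalerA mulrC.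
Qed.

Lemma pure_linear_r u : linear (pure u).
Proof.
move=> c x y; apply/lfunP => phi.
by rewrite add_lfunE scale_lfunE !tens_pureE linearP scalerDl scalerA.
Qed.

Lemma pureNl u v : pure (- u) v = - pure u v.
Proof. by apply/lfunP => phi; rewrite opp_lfunE !tens_pureE scalerN. Qed.

Lemma pureZl c u v : pure (c *: u) v = c *: pure u v.
Proof. by apply/lfunP => phi; rewrite scale_lfunE !tens_pureE !scalerA mulrC. Qed.

Lemma pureZr c u v : pure u (c *: v) = c *: pure u v.
Proof. by apply/lfunP => phi; rewrite scale_lfunE !tens_pureE linearZ scalerA. Qed.

Lemma pureBl u u' v : pure (u - u') v = pure u v - pure u' v.
Proof. by apply/lfunP => phi; rewrite sub_lfunE !tens_pureE scalerBr. Qed.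

Lemma basis_decomp v : v = \sum_k coord b k v *: b`_k.
Proof. by rewrite {1}(coord_vbasis (memvf v)). Qed.

(** A basis of [S] writes every tensor as a sum of pure tensors. *)
Lemma tens_decomp (T : tens U S) :
  T = \sum_(k < \dim {:S}) pure ((T : 'Hom(dual S, U)) (dual_basis k)) b`_k.
Proof.
apply/lfunP => phi; rewrite sum_lfunE.
have phiE : phi = \sum_(k < \dim {:S}) phi b`_k *: dual_basis k.
  apply/lfunP => v; rewrite sum_lfunE {1}[v]basis_decomp linear_sum /=.
  apply: eq_bigr => k _; rewrite linearZ scale_lfunE dual_basisE /= /GRing.scale /=.
  by rewrite mulrC.
rewrite {1}phiE linear_sum /=; apply: eq_bigr => k _.
by rewrite linearZ tens_pureE.
Qed.

Lemma pure_neq0 u v : u != 0 -> v != 0 -> pure u v != 0.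
Proof.
move=> u0 v0; apply: contraNneq v0 => e.
rewrite [v]basis_decomp big1 // => k _.
have := tens_pureE u v (dual_basis k); rewrite e zero_lfunE dual_basisE.
by move/esym/eqP; rewrite scaler_eq0 (negbTE u0) orbF => /eqP ->; rewrite scale0r.
Qed.

Lemma pure_span (N : vectType C) (f g : 'Hom(tens U S, N)) :
  (forall u v, f (pure u v) = g (pure u v)) -> f = g.
Proof.
move=> e; apply/lfunP => T; rewrite [T]tens_decomp !linear_sum /=.
by apply: eq_bigr => k _; apply: e.
Qed.

(** The universal property of the tensor product. *)
Lemma tens_lift (N : vectType C) (beta : U -> S -> N) :
  (forall v, linear (beta^~ v)) -> (forall u, linear (beta u)) ->
  exists Xi : 'Hom(tens U S, N), forall u v, Xi (pure u v) = beta u v.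
Proof.
move=> bl br.
pose F (T : tens U S) := \sum_(k < \dim {:S}) beta ((T : 'Hom(dual S, U)) (dual_basis k)) b`_k.
have Fl : linear F.
  move=> c x y; rewrite /F scaler_sumr -big_split; apply: eq_bigr => k _ /=.
  by rewrite add_lfunE scale_lfunE bl.
exists (linfun F) => u v; rewrite (linfun_linE Fl) /F.
rewrite -[RHS](linfun_linE (br u)) [in RHS](basis_decomp v) linear_sum /=.
apply: eq_bigr => k _; rewrite tens_pureE dual_basisE.
rewrite -(linfun_linE (bl b`_k)) !linearZ /=.
by rewrite (linfun_linE (br u)) (linfun_linE (bl b`_k)).
Qed.

End Tensors.

Section CBstruct.
Variables (C : numClosedFieldType) (m : nat).
Hypothesis m_gt0 : (0 < m)%N.
Local Notation n := m.+1.
Local Notation CB := (CB C n).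

(** The generators of [CB] indexed by natural numbers, which makes successor arithmetic
    available. *)
Definition tN (i : nat) : CB := tB C (inord i : 'I_n).
Definition isqrt2 : CB := sa_scal CB (sqrtC 2)^-1.
Definition cB (i : nat) : CB := clgen m tN i.
Definition sB (i : nat) : CB := cperm m tN isqrt2 i.

Lemma tN_sq i : (i <= m)%N -> tN i * tN i = 1.
Proof. by move=> _; rewrite -expr2 tB_sq. Qed.
Lemma tN_braid i : (i.+1 < m)%N -> tN i * tN i.+1 * tN i = tN i.+1 * tN i * tN i.+1.
Proof. by move=> im; apply: tB_braid; rewrite !inordK //; lia. Qed.
Lemma tN_anti i j : (i.+1 < j)%N -> (j <= m)%N -> tN i * tN j = - (tN j * tN i).
Proof. by move=> ij jm; apply: tB_anti; rewrite /far !inordK //; lia. Qed.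
Lemma tN_last i : i.+1 = m -> (tN i * tN m) ^+ 4 = -1.
Proof. by move=> im; apply: tB_last; rewrite !inordK //; lia. Qed.
Lemma isqrt2_central x : isqrt2 * x = x * isqrt2.
Proof. exact: sa_central. Qed.
Lemma isqrt2_half : isqrt2 * isqrt2 * 2%:R = 1.
Proof.
rewrite /isqrt2 -rmorphM -(rmorph_nat (sa_scal CB)) -rmorphM.
by rewrite -invfM -expr2 sqrtCK mulVf ?pnatr_eq0 // rmorph1.
Qed.

Lemma tN_ord (i : 'I_n) : tB C i = tN i.
Proof. by rewrite /tN inord_val. Qed.

(** The symmetric group inside the units of [CB], generated by the elements [sB i]. *)
Definition S_embedding (rho : 'S_n -> CB) : Prop :=
  [/\ rho 1%g = 1, forall v w, rho (v * w)%g = rho w * rho v &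
      forall i, (i < m)%N -> rho (adj m i) = sB i].

Lemma S_embedding_ex : exists rho, S_embedding rho.
Proof.
exact: (cperm_rep tN_sq tN_braid tN_anti tN_last isqrt2_central isqrt2_half).
Qed.

Section Module.
Variables (V : svect C) (f : {rmorphism CB -> end_ring V}).
Hypothesis f_scal : forall c, f (sa_scal CB c) = c *: \1%VF.
(** Modules over [CB] are taken as ring homomorphisms into an endomorphism ring, which
    covers the induced module below, whose grading is immaterial. *)
Definition opB (x : CB) : 'End(V) := f x.

Lemma opBM x y v : opB (x * y) v = opB x (opB y v).
Proof. by rewrite /opB rmorphM -comp_lfunE. Qed.
Lemma opBN x v : opB (- x) v = - opB x v.
Proof. by rewrite /opB rmorphN opp_lfunE. Qed.
Lemma opBD x y v : opB (x + y) v = opB x v + opB y v.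
Proof. by rewrite /opB rmorphD add_lfunE. Qed.
Lemma opBvD x v w : opB x (v + w) = opB x v + opB x w.
Proof. exact: linearD. Qed.
Lemma opBvB x v w : opB x (v - w) = opB x v - opB x w.
Proof. exact: linearB. Qed.
Lemma opB1 v : opB 1 v = v.
Proof. by rewrite /opB rmorph1 id_lfunE. Qed.
Lemma opB_scal c v : opB (sa_scal CB c) v = c *: v.
Proof. by rewrite /opB f_scal scale_lfunE id_lfunE. Qed.

Lemma opB_stable (W : {vspace V}) : stable (fun i => opB (tB C i)) W ->
  forall x, forall w, w \in W -> opB x w \in W.
Proof.
move=> h; elim/pres_ind => e; elim: e => [i|c|x IHx y IHy|x IHx y IHy] w wW.
- exact: h.
- by rewrite (opB_scal c) memvZ.
- by rewrite (pi_add (Relations (@B_homog C n))) opBD memvD ?IHx ?IHy.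
- by rewrite (pi_mul (Relations (@B_homog C n))) opBM IHx ?IHy.
Qed.

Lemma opB_cliff : cliff_rep (fun i : 'I_n => opB (cB i)).
Proof.
split=> [i v|i j v ij]; rewrite -!opBM.
  by rewrite (clgen_sq tN_sq) ?opB1 // -ltnS.
by rewrite (clgen_anti tN_sq tN_braid tN_anti tN_last) ?opBN // -ltnS.
Qed.

Lemma opB_rep rho : S_embedding rho -> op_rep (fun s => opB (rho s)).
Proof.
case=> r1 rM _; split; first by rewrite /opB r1 rmorph1.
by move=> s s'; apply/lfunP => v; rewrite comp_lfunE -opBM rM.
Qed.

Lemma opB_commute rho s i v : S_embedding rho -> (i <= m)%N ->
  opB (rho s) (opB (cB i) v) = opB (cB i) (opB (rho s) v).
Proof.
case=> r1 rM ra im; rewrite -!opBM; congr (opB _ _).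
elim/adj_ind: s => [|s j jm IHs]; first by rewrite r1 mul1r mulr1.
rewrite rM ra // -(mulrA (sB j)) IHs (mulrA (sB j)) (mulrA (cB i)); congr (_ * _).
exact: (cperm_clgen tN_sq tN_braid tN_anti tN_last isqrt2_central jm im).
Qed.

End Module.

Section Homs.
Variables (V N : svect C) (f : {rmorphism CB -> end_ring V}) (g : {rmorphism CB -> end_ring N}).
Hypothesis f_scal : forall c, f (sa_scal CB c) = c *: \1%VF.
Hypothesis g_scal : forall c, g (sa_scal CB c) = c *: \1%VF.
Variable h : 'Hom(V, N).

Lemma opB_hom : (forall (i : 'I_n) v, h (opB f (tB C i) v) = opB g (tB C i) (h v)) ->
  forall x v, h (opB f x v) = opB g x (h v).
Proof.
move=> hT; elim/pres_ind => e; elim: e => [i|c|x IHx y IHy|x IHx y IHy] v.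
- exact: hT.
- by rewrite (opB_scal f_scal c) (opB_scal g_scal c) linearZ.
- by rewrite (pi_add (Relations (@B_homog C n))) !opBD linearD /= IHx IHy.
- by rewrite (pi_mul (Relations (@B_homog C n))) !opBM IHx IHy.
Qed.

Definition last_sign (i : nat) : C := if (i < m)%N then 1 else -1.

Hypothesis hT : forall i v, (i <= m)%N -> h (opB f (tN i) v) = last_sign i *: opB g (tN i) (h v).

(** Each [cB i] is a product of generators in which the last one occurs exactly once. *)
Lemma last_sign_cB i v : (i <= m)%N -> h (opB f (cB i) v) = - opB g (cB i) (h v).
Proof.
move=> im; elim/(@clgen_ind m): i / im v => [|i im IHi] v.
  by rewrite /cB clgen_last hT // /last_sign ltnn scaleN1r.
rewrite /cB clgen_step // !opBN !opBM !linearN /= hT ?(ltnW im) // -/(cB i.+1) IHi.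
by rewrite hT ?(ltnW im) // /last_sign im !scale1r linearN.
Qed.

(** The elements [sB i] are products of a Clifford element, which changes sign by
    [last_sign_cB], and of a generator other than the last. *)
Lemma last_sign_rho rho s v : S_embedding rho ->
  h (opB f (rho s) v) = sgn C s *: opB g (rho s) (h v).
Proof.
case=> r1 rM ra; elim/adj_ind: s v => [|s i im IHs] v.
  by rewrite r1 !opB1 /sgn odd_perm1 scale1r.
rewrite rM ra // (opBM f (sB i)) (opBM g (sB i)).
have -> w : h (opB f (sB i) w) = - opB g (sB i) (h w).
  rewrite /sB /cperm /cldiff !opBM (opB_scal f_scal) (opB_scal g_scal) !opBD !opBN linearZ linearD /=.
  rewrite linearN /= !(last_sign_cB _ (ltnW im)) (last_sign_cB _ im) hT ?(ltnW im) //.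
  by rewrite /last_sign im scale1r -!opprD scalerN.
rewrite IHs linearZ /= -scalerN -scaleN1r scalerA; congr (_ *: _).
rewrite /sgn odd_permM signr_addb; congr (_ * _).
rewrite /adj odd_tperm -val_eqE /= !inordK //; last by lia.
by rewrite neq_ltn ltnSn expr1.
Qed.

End Homs.
End CBstruct.

(** * The modules B^la over CB *)

Section Blambda.
Variables (C : numClosedFieldType) (m : nat).
Hypothesis m_gt0 : (0 < m)%N.
Hypothesis n_even : ~~ odd m.+1.
Local Notation n := m.+1.
Variable U : supermod (Clifford C n).
Hypothesis U_simple : simple U.
Local Notation cU := (gens (r := Relations (@Clifford_homog C n)) U).

Section OneShape.
Variable la : seq nat.
Local Notation S := (Specht C n la).
Local Notation fB := (sh_fun (sm_act (Bmod U la))).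
Local Notation pure := (@tens_pure C U S).

Lemma fB_scal c : fB (sa_scal (CB C n) c) = c *: \1%VF.
Proof. exact: (sh_scal (sm_act (Bmod U la))). Qed.

Lemma fB_gen i : fB (tB C i) = @pair_op C n U la (B_cliff C i) (B_perm i).
Proof. exact: (Bmod_gen U la i). Qed.

Lemma pair_op_pure x s u v :
  (@pair_op C n U la x s : 'End(tens U S)) (pure u v) = pure (act U x u) (Specht_op C la s v).
Proof. exact: tens_map_pure. Qed.

Lemma opB_pure_gen i u v : opB fB (tB C i) (pure u v) =
  pure (act U (B_cliff C i) u) (Specht_op C la (B_perm i) v).
Proof. by rewrite /opB fB_gen; apply: pair_op_pure. Qed.

Lemma B_cliffE (i : nat) u : (i < m)%N ->
  act U (B_cliff C (inord i)) u =
  (sqrtC 2)^-1 *: (cU (inord i) u - cU (inord i.+1) u).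
Proof.
move=> im; rewrite /B_cliff !inordK ?ltnS ?im //; last exact: ltnW.
have -> : ordS (inord i : 'I_n) = inord i.+1.
  by apply: ord_inj; rewrite /= !inordK ?modn_small // ltnS // ltnW.
rewrite actM -[sa_scal _ _]/(sa_scal (presented (Relations (@Clifford_homog C n))) _).
by rewrite act_scal scale_lfunE id_lfunE /act rmorphB sub_lfunE.
Qed.

Lemma B_permE (i : nat) : (i < m)%N -> B_perm (inord i : 'I_n) = adj m i.
Proof.
move=> im; rewrite /B_perm inordK ?ltnS ?im //; last exact: ltnW.
congr tperm; apply: ord_inj.
by rewrite /= !inordK ?modn_small // ltnS // ltnW.
Qed.

Lemma opB_last_pure u v : opB fB (tN C m m) (pure u v) = pure (cU (inord m) u) v.
Proof.
rewrite opB_pure_gen /B_cliff /B_perm inordK // ltnn.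
by rewrite Specht_op1 id_lfunE.
Qed.

Lemma opB_cB_pure i u v : (i <= m)%N -> opB fB (cB C m i) (pure u v) = pure (cU (inord i) u) v.
Proof.
have [csq canti] := Clifford_cliff_rep U.
move=> im; elim/(@clgen_ind m): i / im u v => [|i im IHi] u v.
  by rewrite /cB clgen_last opB_last_pure.
rewrite /cB clgen_step // opBN !opBM -/(cB C m i.+1) opB_pure_gen IHi opB_pure_gen.
rewrite -comp_lfunE Specht_opM B_perm_sq Specht_op1 id_lfunE -pureNl; congr (pure _ _).
have ne : (inord i : 'I_n) != inord i.+1.
  by rewrite -val_eqE /= !inordK //; lia.
rewrite !B_cliffE //.
set x := inord i in ne *; set y := inord i.+1 in ne *.
have e : cU x (cU y (cU x u - cU y u)) = - cU y u - cU x u.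
  by rewrite !linearB /= csq (canti x y) // csq.
rewrite csq !linearZ /= e -scalerDr opprB addrACA addNr add0r -opprD -mulr2n.
rewrite -scaler_nat !scalerN opprK !scalerA -invfM -expr2 sqrtCK.
by rewrite mulVf ?scale1r // pnatr_eq0.
Qed.

Lemma act_B_cliff_sq i u : act U (B_cliff C i) (act U (B_cliff C i) u) = u.
Proof. by rewrite -actM -expr2 B_cliff_sq /act rmorph1 id_lfunE. Qed.

Lemma opB_sB_pure i u v : (i < m)%N ->
  opB fB (sB C m i) (pure u v) = pure u (Specht_op C la (adj m i) v).
Proof.
move=> im; rewrite /sB /cperm /cldiff (opBM _ (isqrt2 C m * _)) (opBM _ (isqrt2 C m)).
rewrite (opB_scal fB_scal) opB_pure_gen opBD opBN !opB_cB_pure //; last exact: ltnW.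
rewrite -pureBl -pureZl -B_cliffE // act_B_cliff_sq.
by rewrite B_permE.
Qed.

Lemma opB_rho_pure rho s u v : S_embedding rho ->
  opB fB (rho s) (pure u v) = pure u (Specht_op C la s v).
Proof.
case=> r1 rM ra; elim/adj_ind: s u v => [|s i im IHs] u v.
  by rewrite r1 opB1 Specht_op1 id_lfunE.
by rewrite rM ra // opBM IHs opB_sB_pure // -comp_lfunE Specht_opM.
Qed.

Lemma U_irred : irred cU.
Proof. exact: Clifford_irred. Qed.

(** A nonzero submodule contains the image of a Clifford map from [U]. By Schur's lemma
    on [U] such a map has the form [u |-> u (x) v] for a fixed vector [v]; moving [v] by
    the symmetric group gives all pure tensors. *)
Theorem B_irred : is_part n la -> irred (fun i => opB fB (tB C i)).
Proof.
move=> hla; have iU := U_irred; have iS := Specht_op_irred C hla.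
have [u0 u0n] : exists u : U, u != 0.
  by exists (vpick fullv); rewrite vpick0; apply/eqP; exact: iU.1.
split.
  move=> e; have [v vn] : exists v : S, v != 0.
    by exists (vpick fullv); rewrite vpick0; apply/eqP; exact: iS.1.
  have := memvf (pure u0 v); rewrite e memv0.
  by rewrite (negbTE (pure_neq0 u0n vn)).
move=> W Wst; have [->|/eqP W0] := eqVneq W 0%VS; [by left|right].
have Wall := opB_stable fB_scal Wst.
have Wc : stable (fun i : 'I_n => opB fB (cB C m i)) W by move=> i; apply: Wall.
have [phi [p0 pW pT]] := cliff_hom n_even (Clifford_cliff_rep U)
  (opB_cliff m_gt0 fB) iU.1 W0 Wc.
(* Contracting [phi] with a functional of [S] gives a Clifford endomorphism of [U]. *)
have ev (psi : dual S) : exists a, forall u, (phi u : 'Hom(dual S, U)) psi = a *: u.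
  have l : linear (fun u => (phi u : 'Hom(dual S, U)) psi).
    by move=> k x y; rewrite linearP add_lfunE scale_lfunE.
  have [a ea] : exists a, (linfun (fun u => (phi u : 'Hom(dual S, U)) psi) : 'End(U)) = a *: \1%VF.
    apply: (schur_scalar iU) => i u; rewrite !(linfun_linE l) pT.
    rewrite {1}[phi u]tens_decomp linear_sum sum_lfunE [in RHS](tens_decomp (phi u)) sum_lfunE linear_sum.
    apply: eq_bigr => k _ /=; rewrite opB_cB_pure; last by rewrite -ltnS.
    by rewrite !tens_pureE linearZ inord_val.
  by exists a => u; rewrite -(linfun_linE l) ea scale_lfunE id_lfunE.
(* The coordinates of [v] are the scalars attached to the dual basis. *)
have [v phiE] : exists v, forall u, phi u = pure u v.
  have [a aE] := choice ev.
  exists (\sum_k a (dual_basis k) *: (vbasis fullv)`_k) => u.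
  rewrite [LHS]tens_decomp -(linfun_linE (pure_linear_r u)) linear_sum.
  by apply: eq_bigr => k _; rewrite linearZ /= aE pureZl (linfun_linE (pure_linear_r u)).
have vn : v != 0.
  apply: contra_neq p0 => v0; apply/lfunP => u.
  by rewrite zero_lfunE phiE v0 -(scale0r 0) pureZr scale0r.
have uvW u : pure u v \in W.
  by rewrite -phiE; apply: (subvP pW); rewrite memv_img ?memvf.
have [rho hrho] := S_embedding_ex C m_gt0.
have allW u w : pure u w \in W.
  pose j : 'Hom(S, tens U S) := linfun (pure u).
  have jE x : j x = pure u x by rewrite (linfun_linE (pure_linear_r u)).
  have : (j @^-1: W)%VS = fullv.
    have st : stable (Specht_op C la) (j @^-1: W)%VS.
      move=> s x; rewrite -!memv_preim !jE => xW.
      by rewrite -(opB_rho_pure _ _ _ hrho) Wall.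
    case: (iS.2 _ st) => // e; case/negP: vn; rewrite -memv0 -e -memv_preim jE.
    exact: uvW.
  by move=> e; have := memvf w; rewrite -e -memv_preim jE.
apply/eqP; rewrite eqEsubv subvf /=; apply/subvP => T _.
by rewrite [T]tens_decomp memv_suml.
Qed.

End OneShape.

Section TwoShapes.
Variables (la mu : seq nat).
Local Notation S := (Specht C n la).
Local Notation S' := (Specht C n mu).
Local Notation fB la := (sh_fun (sm_act (Bmod U la))).

(** A contraction [alpha (x) 1] that does not kill [h]. *)
Lemma pure_coefficient (h : 'Hom(tens U S, tens U S')) : h != 0 ->
  exists (u : U) (ct : 'Hom(tens U S', S')), 
    (forall (g : 'End(S')) (T : tens U S'), 
        ct (tens_map \1 g T) = g (ct T)) /\
    exists v, ct (h (tens_pure u v)) != 0.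
Proof.
move=> h0.
have [u [v uv]] : exists u v, h (tens_pure u v) != 0.
  apply/not_existsP => no; case/eqP: h0; apply: pure_span => u v; rewrite zero_lfunE.
  apply/eqP; apply: contrapT => /negP ne; apply: (no u).
  by exists v.
set T := h _ in uv.
have [k Tk] : exists k, (T : 'Hom(dual S', U)) (dual_basis k) != 0.
  apply/existsP; apply: contraNT uv => /existsPn no; apply/eqP.
  rewrite [T]tens_decomp big1 // => k _; have := no k; rewrite negbK => /eqP ->.
  by rewrite -(scale0r 0) pureZl scale0r.
have [alpha a1] : exists alpha : 'Hom(U, C^o), alpha ((T : 'Hom(dual S', U)) (dual_basis k)) != 0.
  set x := (T : 'Hom(dual S', U)) (dual_basis k) in Tk *.
  have [l xl] : exists l, coord (vbasis (fullv : {vspace U})) l x != 0.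
    apply/existsP; apply: contraNT Tk => /existsPn no; apply/eqP.
    rewrite (coord_vbasis (memvf x)) big1 // => l _; have := no l; rewrite negbK => /eqP ->.
    by rewrite scale0r.
  by exists (dual_basis l); rewrite dual_basisE.
have [ct ctE] : exists ct : 'Hom(tens U S', S'), forall u v, ct (tens_pure u v) = (alpha u : C) *: v.
  apply: tens_lift => [w c x y|w c x y]; first by rewrite linearP scalerDl scalerA.
  by rewrite scalerDr !scalerA mulrC.
exists u, ct; split.
  move=> g X; rewrite [X]tens_decomp !linear_sum; apply: eq_bigr => i _ /=.
  by rewrite tens_map_pure !ctE id_lfunE linearZ.
have ckE : coord (vbasis (fullv : {vspace S'})) k (ct T) =
    alpha ((T : 'Hom(dual S', U)) (dual_basis k)).
  rewrite {1}[T]tens_decomp !linear_sum /= (bigD1 k) //= big1 => [|i ik].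
    by rewrite addr0 ctE linearZ /= coord_free ?(basis_free (vbasisP _)) // eqxx mulr1.
  by rewrite ctE linearZ /= coord_free ?(basis_free (vbasisP _)) // (negbTE ik) mulr0.
by exists v; rewrite -/T; apply: contraNneq a1 => e0; rewrite -ckE e0 linear0.
Qed.

Lemma rho_tens_map nu rho s T : S_embedding rho ->
  opB (fB nu) (rho s) T = tens_map \1 (Specht_op C nu s) T.
Proof.
move=> hrho; rewrite [T]tens_decomp !linear_sum; apply: eq_bigr => i _ /=.
by rewrite tens_map_pure opB_rho_pure // id_lfunE.
Qed.

(** The matrix coefficients [v |-> (alpha (x) 1) (h (u (x) v))] of [h] along [U] inherit
    its equivariance on the factor [S]. *)
Lemma twisted_coefficient (e : 'S_n -> C) rho (h : 'Hom(tens U S, tens U S')) :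
  S_embedding rho ->
  (forall s v, h (opB (fB la) (rho s) v) = e s *: opB (fB mu) (rho s) (h v)) ->
  h != 0 -> exists h' : 'Hom(S, S'),
    h' != 0 /\ twisted_hom e (Specht_op C la) (Specht_op C mu) h'.
Proof.
move=> hrho hT h0; have [u [ct [ctE [v hv]]]] := pure_coefficient h0.
exists (ct \o h \o linfun (tens_pure u))%VF.
have hE w : (ct \o h \o linfun (tens_pure u))%VF w = ct (h (tens_pure u w)).
  by rewrite !comp_lfunE (linfun_linE (pure_linear_r u)).
split; first by apply: contraNneq hv => e0; rewrite -hE e0 zero_lfunE.
move=> s w; rewrite !hE -(opB_rho_pure _ _ _ hrho) hT linearZ /=.
by rewrite rho_tens_map // ctE.
Qed.

End TwoShapes.
End Blambda.

(** * Clifford theory for CD inside CB *)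

Section DinB.
Variables (C : numClosedFieldType) (m : nat).
Hypothesis m_gt0 : (0 < m)%N.
Local Notation n := m.+1.
Local Notation CB := (CB C n).
Local Notation t := (tN C m m).
Local Notation dB := (D_in_B C (n := n)).

Lemma t_sq : t * t = 1. Proof. exact: tN_sq. Qed.

Lemma D_in_B_lt (i : 'I_n) : (i < m)%N -> dB i = tB C i.
Proof. by move=> im; rewrite /D_in_B ltnS im. Qed.

Lemma D_in_B_last (i : 'I_n) : i = m :> nat -> dB i = - (t * tN C m m.-1 * t).
Proof.
move=> e; rewrite /D_in_B e ltnn.
have -> : tB C i = t by rewrite tN_ord e.
have pE : ord_pred i = m.-1 :> nat.
  have := @ord_predE _ i; rewrite e ltnS => /(_ erefl m_gt0).
  by case: (nat_of_ord (ord_pred i)) => [|k] <-.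
by rewrite tN_ord pE.
Qed.

(** Conjugation by the last generator preserves the set of generators of [CD] up to
    sign, and exchanges the last two of them. *)
Lemma t_D_in_B i : exists j, t * dB i = - (dB j * t) /\ t * dB j = - (dB i * t).
Proof.
have tt x : t * (t * x) = x by rewrite mulrA t_sq mul1r.
have xtt x : x * t * t = x by rewrite -mulrA t_sq mulr1.
suff [j e] : exists j, t * dB i = - (dB j * t).
  have e' : dB j * t = - (t * dB i) by rewrite e opprK.
  by exists j; split=> //; rewrite -[LHS]xtt -(mulrA t) e' mulrN tt mulNr.
have [im|] := ltnP i m; last first.
  move=> mi; have e : i = m :> nat by apply/eqP; rewrite eqn_leq mi -ltnS ltn_ord.
  exists (inord m.-1); rewrite D_in_B_last // D_in_B_lt ?inordK; try lia.
  by rewrite -/(tN C m m.-1) mulrN -mulrA tt.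
have [e|ne] := eqVneq (i : nat) m.-1.
  exists ord_max; rewrite D_in_B_lt // D_in_B_last // mulNr opprK tN_ord e.
  by rewrite xtt.
exists i; rewrite D_in_B_lt // tN_ord.
by rewrite (@tN_anti _ _ m_gt0 i m) ?opprK //; lia.
Qed.

Section Module.
Variables (V : svect C) (f : {rmorphism CB -> end_ring V}).
Hypothesis f_scal : forall c, f (sa_scal CB c) = c *: \1%VF.
Local Notation op := (opB f).

Definition Dop (i : 'I_n) : 'End(V) := op (dB i).

Lemma op_tt v : op t (op t v) = v.
Proof. by rewrite -opBM t_sq opB1. Qed.

Lemma t_Dop i j v : t * dB i = - (dB j * t) -> op t (Dop i v) = - Dop j (op t v).
Proof. by move=> e; rewrite -!opBM e opBN. Qed.

(** The algebra [CB] is generated by [CD] and its own last generator. *)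
Lemma stable_Dt (W : {vspace V}) : stable Dop W -> (forall w, w \in W -> op t w \in W) ->
  stable (fun i => op (tB C i)) W.
Proof.
move=> Ws Wt i w wW; have [im|mi] := ltnP i m.
  by rewrite -D_in_B_lt //; apply: Ws.
have e : i = m :> nat by apply/eqP; rewrite eqn_leq mi -ltnS ltn_ord.
by rewrite tN_ord e Wt.
Qed.

Lemma Dstable_tW (W : {vspace V}) : stable Dop W -> stable Dop (op t @: W)%VS.
Proof.
move=> Ws i _ /memv_imgP[w wW ->]; have [j [_ h]] := t_D_in_B i.
by rewrite -[Dop i _]opprK -(t_Dop _ h) memvN memv_img // Ws.
Qed.

(** The intersection is stable under [CD] and under the last generator. *)
Lemma D_split_cap (W : {vspace V}) : irred (fun i => op (tB C i)) -> stable Dop W ->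
  W <> fullv -> (W :&: op t @: W = 0)%VS.
Proof.
move=> [_ iB] Ws Wn; have tWs := Dstable_tW Ws.
have Xs : stable (fun i => op (tB C i)) (W :&: op t @: W)%VS.
  apply: stable_Dt => [i w|w] /memv_capP[w1 w2]; first by rewrite memv_cap Ws ?tWs.
  rewrite memv_cap andbC memv_img //=.
  by case/memv_imgP: w2 => u uW ->; rewrite op_tt.
case: (iB _ Xs) => // e; case: Wn; apply/eqP; rewrite eqEsubv subvf /= -e.
exact: capvSl.
Qed.

(** The sum is stable under [CD] and under the last generator. *)
Lemma D_split_sum (W : {vspace V}) : irred (fun i => op (tB C i)) -> stable Dop W ->
  W <> 0%VS -> (W + op t @: W = fullv)%VS.
Proof.
move=> [_ iB] Ws W0; have tWs := Dstable_tW Ws.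
have Xs : stable (fun i => op (tB C i)) (W + op t @: W)%VS.
  apply: stable_Dt => [i w|w] /memv_addP[u uW [v vW ->]]; rewrite linearD /=.
    by rewrite memv_add // ?Ws ?tWs.
  rewrite addrC; apply: memv_add; last exact: memv_img.
  by case/memv_imgP: vW => x xW ->; rewrite op_tt.
case: (iB _ Xs) => // e; case: W0; apply/eqP; rewrite -subv0 -e.
exact: addvSl.
Qed.

End Module.

Section Homs.
Variables (V N : svect C) (f : {rmorphism CB -> end_ring V}) (g : {rmorphism CB -> end_ring N}).
Hypothesis f_scal : forall c, f (sa_scal CB c) = c *: \1%VF.
Hypothesis g_scal : forall c, g (sa_scal CB c) = c *: \1%VF.
Implicit Type h : 'Hom(V, N).

Definition Bhom h : Prop :=
  forall i v, (i <= m)%N -> h (opB f (tN C m i) v) = opB g (tN C m i) (h v).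
(** Linear over the automorphism of [CB] that changes the sign of the last generator. *)
Definition twisted_Bhom h : Prop :=
  forall i v, (i <= m)%N -> h (opB f (tN C m i) v) = last_sign C m i *: opB g (tN C m i) (h v).
Definition Dhom h : Prop := intertwines (Dop f) (Dop g) h.

Lemma Bhom_all h : Bhom h -> forall x v, h (opB f x v) = opB g x (h v).
Proof.
move=> hB; apply: opB_hom => // i v.
by rewrite tN_ord hB // -ltnS.
Qed.

(** The last generator of [CB] occurs twice in the last generator of [CD]. *)
Lemma twisted_Bhom_Dhom h : twisted_Bhom h -> Dhom h.
Proof.
move=> hS i v; rewrite /Dop; have [im|mi] := ltnP i m.
  by rewrite D_in_B_lt // tN_ord hS ?(ltnW im) // /last_sign im scale1r.
have e : i = m :> nat by apply/eqP; rewrite eqn_leq mi -ltnS ltn_ord.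
rewrite D_in_B_last // !opBN !opBM linearN /= !hS // ?leq_pred // /last_sign ltnn.
have -> : (m.-1 < m)%N by lia.
by rewrite scale1r scaleN1r !linearZ /= scaleN1r opprK.
Qed.

Definition t_conj h : 'Hom(V, N) := (opB g t \o h \o opB f t)%VF.

Lemma t_conjE h v : t_conj h v = opB g t (h (opB f t v)).
Proof. by rewrite !comp_lfunE. Qed.

Lemma Dhom_t_conj h : Dhom h -> Dhom (t_conj h).
Proof.
move=> hD i v; rewrite !t_conjE; have [j [e1 e2]] := t_D_in_B i.
by rewrite (t_Dop f _ e1) !linearN /= hD (t_Dop g _ e2) opprK.
Qed.

(** Averaging over the two cosets of [CD]. *)
Lemma Dhom_plus h : Dhom h -> Bhom (h + t_conj h).
Proof.
move=> hD i v im; have hD' := Dhom_t_conj hD; rewrite !add_lfunE linearD /=.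
have [lt|mi] := ltnP i m.
  have e : tN C m i = dB (inord i) by rewrite D_in_B_lt ?inordK // ltnW.
  by rewrite e; congr (_ + _); [apply: hD | apply: hD'].
have -> : i = m by lia.
by rewrite !t_conjE !op_tt addrC.
Qed.

(** Averaging over the two cosets of [CD], with the nontrivial character. *)
Lemma Dhom_minus h : Dhom h -> twisted_Bhom (h - t_conj h).
Proof.
move=> hD i v im; have hD' := Dhom_t_conj hD; rewrite !sub_lfunE linearB /=.
have [lt|mi] := ltnP i m.
  have e : tN C m i = dB (inord i) by rewrite D_in_B_lt ?inordK // ltnW.
  by rewrite /last_sign lt scale1r e; congr (_ - _); [apply: hD | apply: hD'].
have -> : i = m by lia.
by rewrite !t_conjE !op_tt /last_sign ltnn scaleN1r opprB.
Qed.

Lemma Dhom_neq0 h : Dhom h -> h != 0 -> h + t_conj h = 0 -> h - t_conj h != 0.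
Proof.
move=> hD h0 e; apply: contraNneq h0 => e'.
have : 2%:R *: h = 0.
  have := congr2 +%R e e'; rewrite addrACA subrr !addr0 -mulr2n.
  by rewrite scaler_nat.
by move/eqP; rewrite scaler_eq0 pnatr_eq0.
Qed.

End Homs.
End DinB.

(** * Restriction of B^la to CD *)

Section Dlambda.
Variables (C : numClosedFieldType) (m : nat).
Hypothesis m_gt0 : (0 < m)%N.
Hypothesis n_even : ~~ odd m.+1.
Local Notation n := m.+1.
Variable U : supermod (Clifford C n).
Hypothesis U_simple : simple U.
Local Notation cU := (gens (r := Relations (@Clifford_homog C n)) U).
Local Notation fB la := (sh_fun (sm_act (Bmod U la))).
Local Notation S la := (Specht C n la).
Local Notation vol := (cliff_word cU (enum 'I_n)).
Local Notation t := (tN C m m).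

Let fs la := fB_scal U la.
Let iB la (hla : is_part n la) := B_irred m_gt0 n_even U_simple hla.

(** One of [h + t h t] and [h - t h t] is nonzero. The first has equivariant matrix
    coefficients, the second sign-equivariant ones. *)
Theorem D_hom_labels la mu (h : 'Hom(BV U la, BV U mu)) : is_part n la -> is_part n mu ->
  Dhom (fB la) (fB mu) h -> h != 0 -> mu = la \/ mu = conj_part la.
Proof.
move=> hla hmu hD h0; have [rho hrho] := S_embedding_ex C m_gt0.
have [e|nz] := eqVneq (h + t_conj (fB la) (fB mu) h) 0.
  right; have hS := Dhom_minus m_gt0 hD; have nz := Dhom_neq0 hD h0 e.
  have [h' [h'0 h'T]] := twisted_coefficient m_gt0 n_even hrho
    (fun s v => last_sign_rho m_gt0 (fs la) (fs mu) hS s v hrho) nz.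
  exact: Specht_sign_eq h'T h'0.
left; have hB := Bhom_all (fs la) (fs mu) (Dhom_plus m_gt0 hD).
have hT s v : (h + t_conj (fB la) (fB mu) h) (opB (fB la) (rho s) v) =
    (fun=> 1) s *: opB (fB mu) (rho s) ((h + t_conj (fB la) (fB mu) h) v).
  by rewrite hB scale1r.
have [h' [h'0 h'T]] := twisted_coefficient m_gt0 n_even hrho hT nz.
apply/esym; apply: (Specht_hom_eq hla hmu _ h'0).
by apply/twisted_homE.
Qed.

Lemma vol_B_cliff (i : 'I_n) u : vol (act U (B_cliff C i) u) = - act U (B_cliff C i) (vol u).
Proof.
have vc j x : vol (cU j x) = - cU j (vol x).
  by rewrite (volume_anti (U := U) n_even) // opprK.
have [im|mi] := ltnP i m.
  rewrite -(inord_val i) !B_cliffE // linearZ linearB /= !vc.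
  by rewrite -scalerN opprB opprK addrC.
have -> : B_cliff C i = c_ C i.
  by rewrite /B_cliff ltnS ltnNge mi.
exact: vc.
Qed.

Lemma vol_proj q u : vol (sv_proj U q u) = sv_proj U q (vol u).
Proof.
have e u' : vol (sv_proj U false u') = sv_proj U false (vol u').
  rewrite !sv_proj_parity linearZ linearD /=.
  by rewrite cliff_word_parity size_enum_ord -signr_odd (negbTE n_even) scale1r.
case: q; last exact: e.
have tE x : sv_proj U true x = x - sv_proj U false x.
  by rewrite -{2}[x]sv_proj_sum addrC addKr.
by rewrite !tE linearB /= e.
Qed.

(** The volume element changes the sign of the Clifford part of each generator, and
    [theta] changes the sign of its permutation part. The last generator has trivial
    permutation part, so only there a sign remains. The map preserves parity because the
    volume element is even. *)
Lemma twisted_Bhom_ex la mu (theta : 'Hom(S la, S mu)) : theta != 0 ->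
  twisted_hom (@sgn C n) (Specht_op C la) (Specht_op C mu) theta ->
  exists H : 'Hom(BV U la, BV U mu),
    [/\ H != 0, twisted_Bhom (fB la) (fB mu) H &
        forall q T, T \in sv_gr (BV U la) q -> H T \in sv_gr (BV U mu) q].
Proof.
move=> th0 thT.
have [H HE] : exists H : 'Hom(tens U (S la), tens U (S mu)),
    forall u v, H (tens_pure u v) = tens_pure (vol u) (theta v).
  apply: tens_lift => [v c x y|u c x y].
    by rewrite linearP (pure_linear_l _ c).
  by rewrite linearP (pure_linear_r _ c).
have iU := Clifford_irred n_even (ltn0Sn m) U_simple.
have [u0 u0n] : exists u : U, u != 0.
  by exists (vpick fullv); rewrite vpick0; apply/eqP; exact: iU.1.
exists H; split.
- have [v v0] : exists v, theta v != 0.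
    apply/not_existsP => no; case/eqP: th0; apply/lfunP => v; rewrite zero_lfunE.
    by apply/eqP; apply: contrapT => /negP ne; apply: (no v).
  have vu : vol u0 != 0.
    by apply: contraNneq u0n => e; apply/eqP; apply: (cliff_word_inj (Clifford_cliff_rep U) e).
  apply: contraTneq (pure_neq0 vu v0) => H0.
  by rewrite -HE H0 zero_lfunE eqxx.
- move=> i T im.
  rewrite [T]tens_decomp !linear_sum; apply: eq_bigr => k _ /=.
  rewrite /tN opB_pure_gen !HE opB_pure_gen vol_B_cliff thT pureNl pureZr.
  rewrite -scalerN -scaleN1r scalerA; congr (_ *: _).
  rewrite /last_sign; case: ltnP => lt.
    have l1 : (i < m.+1)%N by exact: ltnW.
    rewrite B_permE // /sgn /adj odd_tperm -val_eqE /= !inordK // ltn_eqF //.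
    by rewrite expr1 mulrNN mulr1.

  rewrite B_perm_last ?inordK //; last by lia.
  by rewrite /sgn odd_perm1 mul1r.
move=> q T Tq; rewrite -[T](tens_gr_id Tq).
have -> : H (tens_map (sv_proj U q) \1 T) = tens_map (sv_proj U q) \1 (H T).
  rewrite [T]tens_decomp !linear_sum; apply: eq_bigr => k _ /=.
  by rewrite tens_map_pure !HE tens_map_pure vol_proj !id_lfunE.
by rewrite memv_img ?memvf.
Qed.

(** For a proper nonzero submodule [W] the operator equal to [1] on [W] and to [-1] on
    [t W] is linear over [CB] up to the sign of the last generator, and produces a
    sign-equivariant endomorphism of [S^la]; this is impossible unless [la] is
    self-conjugate. *)
Theorem D_irred la : is_part n la -> conj_part la != la -> irred (Dop (fB la)).
Proof.
move=> hla cla; have iV := iB hla; split; first exact: iV.1.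
move=> W Ws; have [->|/eqP W0] := eqVneq W 0%VS; [by left|right].
apply: contrapT => Wn; have tWs := Dstable_tW m_gt0 Ws.
have ca := D_split_cap m_gt0 iV Ws Wn; have su := D_split_sum m_gt0 iV Ws W0.
pose W' := (opB (fB la) t @: W)%VS; rewrite -/W' in ca su tWs.
have ca' : (W' :&: W = 0)%VS by rewrite capvC.
(* [h] is [1] on [W] and [-1] on [W'], its image under the last generator. *)
pose h : 'End(BV U la) := daddv_pi W W' - daddv_pi W' W.
have piE (X Y : {vspace BV U la}) v : (X :&: Y = 0)%VS -> v \in Y -> daddv_pi X Y v = 0.
  move=> XY vY; have vXY : v \in (X + Y)%VS by rewrite -[v]add0r memv_add ?mem0v.
  have := daddv_pi_add XY vXY; rewrite (daddv_pi_id (U := Y) (V := X)) 1?capvC //.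
  by move/(canRL (addrK _)); rewrite subrr.
have hE a b : a \in W -> b \in W' -> h (a + b) = a - b.
  move=> aW bW; rewrite /h sub_lfunE !linearD /=.
  rewrite (daddv_pi_id ca aW) (piE _ _ _ ca bW) (piE _ _ _ ca' aW) (daddv_pi_id ca' bW).
  by rewrite oppr0 addr0 add0r.
have hS : twisted_Bhom (fB la) (fB la) h.
  move=> i v im; have : v \in (W + W')%VS by rewrite su memvf.
  case/memv_addP => [a aW [b bW' ->]]; rewrite (hE a b) // opBvD opBvB.
  have [lt|mi] := ltnP i m.
    have e x : opB (fB la) (tN C m i) x = Dop (fB la) (inord i) x.
      by rewrite /Dop D_in_B_lt ?inordK // ltnW.
    by rewrite !e hE ?(Ws, tWs) // /last_sign lt scale1r.
  have -> : i = m by lia.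
  have taW' : opB (fB la) t a \in W' by rewrite memv_img.
  have tbW : opB (fB la) t b \in W.
    by case/memv_imgP: bW' => x xW ->; rewrite op_tt.
  by rewrite addrC hE // /last_sign ltnn scaleN1r opprB.
have h0 : h != 0.
  have [w0 wW] : vpick W != 0 /\ vpick W \in W.
    by rewrite vpick0 memv_pick; split=> //; apply/eqP.
  apply: contraNneq w0 => h0; have := hE _ _ wW (mem0v W').
  by rewrite addr0 subr0 h0 zero_lfunE => <-.
have [rho hrho] := S_embedding_ex C m_gt0.
have [h' [h'0 h'T]] := twisted_coefficient m_gt0 n_even hrho
  (fun s v => last_sign_rho m_gt0 (fs la) (fs la) hS s v hrho) h0.
by case/eqP: cla; apply/esym/(Specht_sign_eq hla hla h'T h'0).
Qed.

End Dlambda.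

(** * Graded submodules as supermodules *)

Section SubModule.
Variables (C : numClosedFieldType) (A : superalg C) (M : supermod A) (W : {vspace M}).
Hypothesis Wsub : submodule W.
Hypothesis Wgr : forall v, v \in W -> sv_proj M false v \in W.

Definition sub_incl : 'Hom(subvs_of W, M) := linfun vsval.
Lemma sub_inclE w : sub_incl w = vsval w. Proof. by rewrite lfunE. Qed.

Definition sub_gr (p : bool) : {vspace subvs_of W} := (sub_incl @^-1: sv_gr M p)%VS.

Lemma mem_sub_gr p w : (w \in sub_gr p) = (vsval w \in sv_gr M p).
Proof. by rewrite -memv_preim sub_inclE. Qed.

Fact sub_gr_sum : (sub_gr false + sub_gr true = fullv)%VS.
Proof.
apply/eqP; rewrite eqEsubv subvf /=; apply/subvP => w _.
have w0 := Wgr (subvsP w).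
have w1 : sv_proj M true (vsval w) \in W.
  by rewrite -(addKr (sv_proj M false (vsval w)) (sv_proj _ _ _)) sv_proj_sum memvD ?memvN ?subvsP.
have -> : w = vsproj W (sv_proj M false (vsval w)) + vsproj W (sv_proj M true (vsval w)).
  by apply: subvs_inj; rewrite linearD /= !vsprojK // sv_proj_sum.
by rewrite memv_add // mem_sub_gr vsprojK // sv_proj_mem.
Qed.

Fact sub_gr_cap : (sub_gr false :&: sub_gr true = 0)%VS.
Proof.
apply/eqP; rewrite -subv0; apply/subvP => w /memv_capP[].
rewrite !mem_sub_gr memv0 => w0 w1; apply/eqP; apply: subvs_inj.
by rewrite linear0; apply/eqP; rewrite -memv0 -(sv_gr_cap M) memv_cap w0.
Qed.

Definition sub_svect : svect C := SVect sub_gr_sum sub_gr_cap.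

Definition sub_op (a : A) : end_ring sub_svect :=
  linfun (fun w : subvs_of W => vsproj W (act M a (vsval w))).

Lemma sub_opE a (w : sub_svect) : vsval ((sub_op a : 'End(sub_svect)) w) = act M a (vsval w).
Proof.
rewrite /sub_op linfun_linE => [|c x y]; last by rewrite !linearP.
by rewrite vsprojK // Wsub // subvsP.
Qed.

Fact sub_op_zmod : zmod_morphism sub_op.
Proof.
move=> a b; apply/lfunP => w; apply: subvs_inj.
by rewrite sub_lfunE linearB /= !sub_opE /act rmorphB sub_lfunE.
Qed.
Fact sub_op_monoid : monoid_morphism sub_op.
Proof.
split=> [|a b]; apply/lfunP => w; apply: subvs_inj.
  by rewrite sub_opE /act rmorph1 !id_lfunE.
by rewrite comp_lfunE !sub_opE /act rmorphM comp_lfunE.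
Qed.
HB.instance Definition _ := GRing.isZmodMorphism.Build A (end_ring sub_svect) sub_op
  sub_op_zmod.
HB.instance Definition _ := GRing.isMonoidMorphism.Build A (end_ring sub_svect) sub_op
  sub_op_monoid.

Fact sub_op_scal c : sub_op (sa_scal A c) = sa_scal (send sub_svect) c.
Proof.
apply/lfunP => w; apply: subvs_inj.
by rewrite sub_opE /act sh_scal /= !scale_lfunE linearZ /= !id_lfunE.
Qed.
Fact sub_op_gr p a : sa_gr p a -> sa_gr (s := send sub_svect) p (sub_op a).
Proof.
move=> pa q w; rewrite !mem_sub_gr sub_opE => wq.
have h : end_gr p (sm_act M a) := sh_gr (sm_act M) pa.
exact: h.
Qed.

Definition sub_mod : supermod A :=
  SuperMod (@SaHom C A (send sub_svect) sub_op sub_op_scal sub_op_gr).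

Lemma sub_modE a (w : sub_mod) : vsval (act sub_mod a w) = act M a (vsval w).
Proof. exact: sub_opE. Qed.

Lemma sub_incl_hom : homog_hom (M := sub_mod) (N := M) false (sub_incl : 'Hom(sub_mod, M)).
Proof.
split=> [q w|q a w _]; first by rewrite mem_sub_gr sub_inclE.
by rewrite !sub_inclE sub_modE scale1r.
Qed.

Lemma sub_incl_ker : lker sub_incl = 0%VS.
Proof.
apply/eqP; rewrite -subv0; apply/subvP => w; rewrite memv_ker memv0 sub_inclE => /eqP e.
by apply/eqP; apply: subvs_inj; rewrite e linear0.
Qed.

Lemma sub_incl_img : limg sub_incl = W.
Proof.
apply/eqP; rewrite eqEsubv; apply/andP; split; apply/subvP => v.
  by case/memv_imgP => w _ ->; rewrite sub_inclE subvsP.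
by move=> vW; rewrite -(vsprojK vW) -sub_inclE memv_img ?memvf.
Qed.

(** Submodules of [sub_mod] are the submodules of [M] contained in [W]. *)
Lemma sub_mod_simple : W <> 0%VS ->
  (forall X, (X <= W)%VS -> submodule X -> X = 0%VS \/ X = W) -> ungraded_simple sub_mod.
Proof.
move=> W0 Wi; split=> [e|X Xs].
  apply: W0; rewrite -sub_incl_img; apply/eqP; rewrite -subv0.
  apply/subvP => _ /memv_imgP[w _ ->].
  have /eqP -> : w == 0 by rewrite -memv0 -e memvf.
  by rewrite linear0 mem0v.
have XW : (sub_incl @: X <= W)%VS by rewrite -[X in (_ <= X)%VS]sub_incl_img limgS ?subvf.
have Xsub : submodule (sub_incl @: X)%VS.
  move=> a _ /memv_imgP[w wX ->].
  by rewrite sub_inclE -sub_modE -sub_inclE memv_img ?Xs.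
have inj w : (sub_incl w \in (sub_incl @: X)%VS) = (w \in X).
  apply/idP/idP => [/memv_imgP[u uX]|/(memv_img sub_incl) //].
  by rewrite !sub_inclE => /subvs_inj ->.
case: (Wi _ XW Xsub) => e; [left|right]; apply/eqP.
  rewrite -subv0; apply/subvP => w; rewrite -inj e !memv0 sub_inclE => /eqP h.
  by apply/eqP; apply: subvs_inj; rewrite h linear0.
rewrite eqEsubv subvf /=; apply/subvP => w _.
by rewrite -inj e sub_inclE subvsP.
Qed.

End SubModule.

(** * Splitting of B^la for self-conjugate la *)

Section Split.
Variables (C : numClosedFieldType) (m : nat).
Hypothesis m_gt0 : (0 < m)%N.
Hypothesis n_even : ~~ odd m.+1.
Local Notation n := m.+1.
Variable U : supermod (Clifford C n).
Hypothesis U_simple : simple U.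
Local Notation fB la := (sh_fun (sm_act (Bmod U la))).
Local Notation t := (tN C m m).

Lemma gens_Dmod la (i : 'I_n) v :
  gens (r := Relations (@D_homog C n)) (Dmod U la) i v = Dop (fB la) i v.
Proof.
rewrite -[LHS]/(opB (fB la) (D_incl C n (tD C i)) v).
by rewrite D_incl_gen.
Qed.

Lemma gens_DmodE la (W : {vspace BV U la}) :
  submodule (M := Dmod U la) W <-> stable (Dop (fB la)) W.
Proof.
by split=> [/submodule_gens h i w /(h i)|h]; rewrite ?gens_Dmod //; apply/submodule_gens => i w wW;
  rewrite gens_Dmod; apply: h.
Qed.

Section SelfConj.
Variable la : seq nat.
Hypothesis hla : is_part n la.
Hypothesis cla : conj_part la = la.
Local Notation V := (BV U la).
Local Notation f := (fB la).
Let fs := fB_scal U la.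
Let iV := B_irred m_gt0 n_even U_simple hla.

Section Eigen.
Variables (H : 'End(V)) (a : C).
Hypothesis H_S : twisted_Bhom f f H.
Hypothesis H_gr : forall q T, T \in sv_gr V q -> H T \in sv_gr V q.
Hypothesis HH : forall v, H (H v) = a ^+ 2 *: v.
Hypothesis a0 : a != 0.

(** The two square roots of [a ^+ 2], indexed by the sign of the half. *)
Definition eig (s : bool) : C := if s then a else - a.
Definition eigspace (s : bool) : {vspace V} := lker (H - eig s *: \1%VF).

Lemma mem_eigspace s v : (v \in eigspace s) = (H v == eig s *: v).
Proof. by rewrite memv_ker sub_lfunE scale_lfunE id_lfunE subr_eq0. Qed.

Lemma eig_neq0 s : eig s != 0. Proof. by case: s; rewrite /= ?oppr_eq0. Qed.
Lemma eig_sq s : eig s ^+ 2 = a ^+ 2. Proof. by case: s; rewrite /= ?sqrrN. Qed.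
Lemma eigN s : eig (~~ s) = - eig s. Proof. by case: s; rewrite /= ?opprK. Qed.

Lemma eigspace_D s : stable (Dop f) (eigspace s).
Proof.
move=> i w; rewrite !mem_eigspace (twisted_Bhom_Dhom m_gt0 H_S) => /eqP ->.
by rewrite linearZ.
Qed.

(** As [H] anticommutes with the last generator, the latter exchanges the two
    eigenspaces. *)
Lemma eigspace_t s w : w \in eigspace s -> opB f t w \in eigspace (~~ s).
Proof.
rewrite !mem_eigspace H_S // /last_sign ltnn scaleN1r => /eqP ->.
by rewrite linearZ eigN scaleNr.
Qed.

Lemma H_proj q v : H (sv_proj V q v) = sv_proj V q (H v).
Proof.
rewrite -{2}[v](sv_proj_sum (V := V)) !linearD /=.
have h q' := H_gr (sv_proj_mem (V := V) q' v).
case: q.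
  by rewrite (@sv_proj_0 _ V true (H (sv_proj V false v))) ?(sv_proj_id (h true)) ?add0r // h.
by rewrite (@sv_proj_0 _ V false (H (sv_proj V true v))) ?(sv_proj_id (h false)) ?addr0 // h.
Qed.

(** The operator [H] preserves parity, so its eigenspaces are graded. *)
Lemma eigspace_gr s v : v \in eigspace s -> sv_proj V false v \in eigspace s.
Proof. by rewrite !mem_eigspace H_proj => /eqP ->; rewrite linearZ. Qed.

Definition eig_proj (s : bool) : 'End(V) := (2 * eig s)^-1 *: (eig s *: \1%VF + H).

Lemma eig_projE s v : eig_proj s v = (2 * eig s)^-1 *: (eig s *: v + H v).
Proof. by rewrite scale_lfunE add_lfunE scale_lfunE id_lfunE. Qed.

Lemma eig_proj_mem s v : eig_proj s v \in eigspace s.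
Proof.
rewrite mem_eigspace eig_projE linearZ linearD linearZ /= HH -(eig_sq s) expr2.
by rewrite -[(eig s * eig s) *: v]scalerA -scalerDr !scalerA mulrC addrC.
Qed.

Lemma two_eig_neq0 s : 2 * eig s != 0.
Proof. by rewrite mulf_neq0 ?eig_neq0 // pnatr_eq0. Qed.

Lemma eig_double s : eig s + eig s = 2 * eig s.
Proof. by rewrite mulr_natl mulr2n. Qed.

Lemma eig_proj_id s v : v \in eigspace s -> eig_proj s v = v.
Proof.
rewrite mem_eigspace eig_projE => /eqP ->; rewrite -scalerDl eig_double scalerA.
by rewrite mulVf ?two_eig_neq0 // scale1r.
Qed.

Lemma eig_proj_sum v : eig_proj true v + eig_proj false v = v.
Proof.
rewrite !eig_projE (eigN true) mulrN invrN !scaleNr -scalerN opprD opprK -scalerDr addrACA subrr addr0.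
by rewrite -scalerDl eig_double scalerA mulVf ?scale1r // (two_eig_neq0 true).
Qed.

Lemma eigspace_cap s : (eigspace s :&: eigspace (~~ s) = 0)%VS.
Proof.
apply/eqP; rewrite -subv0; apply/subvP => v /memv_capP[]; rewrite !mem_eigspace memv0.
move=> /eqP -> ; rewrite eigN scaleNr -addr_eq0 -scalerDl eig_double scaler_eq0.
by rewrite (negbTE (two_eig_neq0 s)).
Qed.

Lemma eigspace_sum : (eigspace true + eigspace false = fullv)%VS.
Proof.
apply/eqP; rewrite eqEsubv subvf /=; apply/subvP => v _.
by rewrite -(eig_proj_sum v) memv_add ?eig_proj_mem.
Qed.

Lemma eigspace_neq0 s : eigspace s <> 0%VS.
Proof.
move=> e; have e' : eigspace (~~ s) = 0%VS.
  apply/eqP; rewrite -subv0; apply/subvP => w /eigspace_t.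
  rewrite negbK e !memv0 => /eqP h; have := op_tt f w.
  by rewrite h linear0 => <-.
apply: iV.1; rewrite -eigspace_sum; case: (s) e e' => /= -> ->; exact: addv0.
Qed.

(** By [D_split_sum], [X] and its image under the last generator span everything, and
    this image lies in the other eigenspace. *)
Lemma eigspace_irred s X : (X <= eigspace s)%VS -> stable (Dop f) X -> X = 0%VS \/ X = eigspace s.
Proof.
move=> XW Xs; have [->|/eqP X0] := eqVneq X 0%VS; [by left|right].
have su := D_split_sum m_gt0 iV Xs X0.
apply/eqP; rewrite eqEsubv XW /=; apply/subvP => w wW.
have : w \in (X + opB f t @: X)%VS by rewrite su memvf.
case/memv_addP => [x xX [y yX e]].
have yW : y \in eigspace (~~ s).
  by case/memv_imgP: yX => z zX ->; apply/eigspace_t/(subvP XW).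
have : y \in (eigspace s :&: eigspace (~~ s))%VS.
  rewrite memv_cap yW andbT (_ : y = w - x); last by rewrite e addrAC subrr add0r.
  by rewrite memvB // (subvP XW).
by rewrite eigspace_cap memv0 e => /eqP ->; rewrite addr0.
Qed.

Lemma eigspace_sub s : submodule (M := Dmod U la) (eigspace s).
Proof. exact/gens_DmodE/eigspace_D. Qed.

Definition D_half (s : bool) : supermod (CD C n) :=
  sub_mod (@eigspace_sub s) (@eigspace_gr s).

Lemma D_half_simple s : ungraded_simple (D_half s).
Proof.
apply: sub_mod_simple; first exact: eigspace_neq0.
by move=> X XW /gens_DmodE; apply: eigspace_irred.
Qed.

Lemma D_half_sum : direct_sum (Dmod U la) (D_half true) (D_half false).
Proof.
exists (sub_incl (M := Dmod U la) (eigspace true)), (sub_incl (M := Dmod U la) (eigspace false)).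
split; rewrite ?sub_incl_img ?eigspace_sum ?(eigspace_cap true) //.
  by split; apply: sub_incl_hom.
by rewrite !sub_incl_ker.
Qed.

(** An isomorphism extends by zero to a [CD]-linear endomorphism [G]. By Schur's lemma
    over [CB], [G + t G t] is a scalar and [H (G - t G t)] is a scalar, so [G] preserves
    each eigenspace of [H], although it maps one of them into the other. *)
Lemma D_half_not_iso : ~ isomorphic (D_half true) (D_half false).
Proof.
move=> /(isomorphic_intertwiner (r := Relations (@D_homog C n)))[g [gT gb]].
pose ip : 'Hom(D_half false, V) := sub_incl (M := Dmod U la) (eigspace false).
pose G : 'End(V) := (ip \o g \o linfun (vsproj (eigspace true)) \o eig_proj true)%VF.
have GE v : G v = vsval (g (vsproj (eigspace true) (eig_proj true v))).
  by rewrite !comp_lfunE sub_inclE lfunE.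
have gval i (w : D_half true) : vsval (g (gens (r := Relations (@D_homog C n)) (D_half true) i w)) =
    Dop f i (vsval (g w)).
  by rewrite gT /gens sub_modE -gens_Dmod.
have prD i v : eig_proj true (Dop f i v) = Dop f i (eig_proj true v).
  rewrite !eig_projE (twisted_Bhom_Dhom m_gt0 H_S) [RHS]linearZ; congr (_ *: _).
  by rewrite [RHS]linearD [in RHS]linearZ.
have GD : Dhom f f G.
  move=> i v; rewrite !GE -gval; congr (vsval (g _)); apply: subvs_inj.
  rewrite prD vsprojK; last by apply: eigspace_D; apply: eig_proj_mem.
  by rewrite /gens sub_modE -gens_Dmod vsprojK ?eig_proj_mem.
have GW v : G v \in eigspace false by rewrite GE subvsP.
have Bscal K : Bhom f f K -> exists c, K = c *: \1%VF.
  move=> hK; apply: (schur_scalar iV) => i v.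
  exact: (Bhom_all fs fs hK).
have [x ex] := Bscal _ (Dhom_plus m_gt0 GD).
have GS := Dhom_minus m_gt0 GD.
have [y ey] : exists c, (H \o (G - t_conj f f G))%VF = c *: \1%VF.
  apply: Bscal => i v im; rewrite !comp_lfunE GS // linearZ /= H_S // scalerA.
  by rewrite /last_sign; case: ifP; rewrite ?mulrNN mul1r scale1r.
(* The vector [G v] lies in the eigenspace of [- a]; the two Schur scalars put it
   into the eigenspace of [a] as well. *)
have G0 v : v \in eigspace true -> G v = 0.
  move=> vW; have e : 2%:R *: (H (G v)) = x *: H v + y *: v.
    have -> : x *: H v = H ((G + t_conj f f G) v).
      by rewrite ex scale_lfunE id_lfunE linearZ.
    have -> : y *: v = H ((G - t_conj f f G) v).
      by rewrite -comp_lfunE ey scale_lfunE id_lfunE.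
    by rewrite -linearD -linearZ add_lfunE sub_lfunE addrACA subrr addr0 scaler_nat mulr2n.
  have : 2%:R *: H (G v) \in eigspace true.
    rewrite e; move: (vW); rewrite mem_eigspace => /eqP ->.
    by rewrite memvD // !memvZ.
  have := GW v; rewrite mem_eigspace => /eqP eG; rewrite eG scalerA => h.
  have GW' : G v \in eigspace true.
    by rewrite -[G v](scalerK (two_eig_neq0 false)) memvZ.
  have : G v \in (eigspace true :&: eigspace (~~ true))%VS by rewrite memv_cap GW' GW.
  by rewrite eigspace_cap memv0 => /eqP.
have [v vW vn] : exists2 v, v \in eigspace true & v != 0.
  exists (vpick (eigspace true)); first exact: memv_pick.
  by rewrite vpick0; apply/eqP; apply: eigspace_neq0.
have := G0 _ vW; rewrite GE eig_proj_id // => e.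
have gz : g (vsproj (eigspace true) v) = g 0.
  by rewrite linear0; apply: subvs_inj; rewrite e linear0.
have := bij_inj gb gz => /(congr1 vsval); rewrite vsprojK // linear0.
by move=> v0; rewrite v0 eqxx in vn.
Qed.

End Eigen.

(** The square of [H] is [CB]-linear, hence a scalar, and nonzero because the kernel of
    [H] is a [CB]-submodule. *)
Theorem D_splits_ex : exists Dp Dm : supermod (CD C n), D_splits U la Dp Dm.
Proof.
have := Specht_sign C hla; rewrite cla => -[th [th0 thT]].
have [H [H0 HS Hgr]] := twisted_Bhom_ex m_gt0 n_even U_simple th0 thT.
have kst : stable (fun i => opB f (tB C i)) (lker H).
  by move=> i w; rewrite !memv_ker tN_ord HS -1?ltnS // => /eqP ->; rewrite linear0 scaler0.
have k0 : lker H = 0%VS by case: (iV.2 _ kst) => // /(lker_neq_full H0).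
have [a [v [v0 va]]] := eigen_ex H iV.1.
have a0 : a != 0.
  apply: contraNneq v0 => a0; have : v \in lker H by rewrite memv_ker va a0 scale0r.
  by rewrite k0 memv0.
have [c ec] : exists c, (H \o H)%VF = c *: \1%VF.
  apply: (schur_scalar iV) => i w; rewrite !comp_lfunE tN_ord !HS -1?ltnS // linearZ /=.
  rewrite HS -1?ltnS // scalerA /last_sign.
  by case: ifP; rewrite ?mulrNN mul1r scale1r.
have HH w : H (H w) = a ^+ 2 *: w.
  rewrite -comp_lfunE ec scale_lfunE id_lfunE; congr (_ *: _).
  have := congr1 (fun K : 'End(V) => K v) ec; rewrite comp_lfunE va linearZ /= va.
  rewrite scale_lfunE id_lfunE scalerA -expr2 => /eqP.
  by rewrite -subr_eq0 -scalerBl scaler_eq0 (negbTE v0) orbF subr_eq0 => /eqP.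
exists (D_half a HS Hgr true), (D_half a HS Hgr false); split.
- exact: D_half_sum.
- exact: D_half_not_iso.
- exact: D_half_simple.
- exact: D_half_simple.
Qed.

End SelfConj.
End Split.

(** * The module induced from CD to CB *)

Section TrivialGrading.
Variables (C : numClosedFieldType) (V : vectType C).
Definition triv_gr (p : bool) : {vspace V} := if p then 0%VS else fullv.
Fact triv_gr_sum : (triv_gr false + triv_gr true = fullv)%VS.
Proof. exact: addv0. Qed.
Fact triv_gr_cap : (triv_gr false :&: triv_gr true = 0)%VS.
Proof. exact: capv0. Qed.
Definition triv_svect : svect C := SVect triv_gr_sum triv_gr_cap.
End TrivialGrading.

Section Lift.
Variables (C : numClosedFieldType) (n : nat) (V : svect C) (b : 'I_n -> send V).
Hypothesis b_rel : forall x y : ncpoly C n, B_eqn x y ->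
  ev (sa_scal (send V)) b x = ev (sa_scal (send V)) b y.

(** The universal property of [CB] for algebras of operators, without reference to a
    grading. *)
Lemma CB_lift : exists f : {rmorphism CB C n -> end_ring V},
  (forall i, f (tB C i) = b i) /\ (forall c, f (sa_scal (CB C n) c) = c *: \1%VF).
Proof.
pose rB := Relations (@B_homog C n).
pose cen := @sa_central C (send V).
pose F : CB C n -> end_ring V := pres_ev (r := rB) (sa_scal (send V)) b.
have b_rel' : forall x y, rB x y -> ev (sa_scal (send V)) b x = ev (sa_scal (send V)) b y := b_rel.
pose Fz := GRing.isZmodMorphism.Build _ _ F (pres_ev_zmod cen b_rel').
pose Fm := GRing.isMonoidMorphism.Build _ _ F (pres_ev_monoid cen b_rel').
pose f : {rmorphism CB C n -> end_ring V} := HB.pack F Fz Fm.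
exists f; split=> [i|c].
  exact: (pres_evE cen b_rel' (Gen C i)).
exact: (pres_evE cen b_rel' (Cst n c)).
Qed.
End Lift.

Section Induced.
Variables (C : numClosedFieldType) (m : nat).
Hypothesis m_gt0 : (2 < m)%N.
Local Notation n := m.+1.
Variable M : supermod (CD C n).
Local Notation gM := (gens (r := Relations (@D_homog C n)) M).

Local Notation rD := (Relations (@D_homog C n)).

Lemma tD_sq i : tD C i * tD C i = 1 :> CD C n.
Proof.
have /= := gen_rel (r := rD) (D_sq C i).
by rewrite rmorph1 mulr1.
Qed.

Lemma tD_anti i j : D_eqn (('t_i * 't_j) ^+ 2 : ncpoly C n)%NC (- 1)%NC ->
  tD C i * tD C j = - (tD C j * tD C i) :> CD C n.
Proof.
move=> h; apply: anti_of_sq; rewrite ?expr2 ?tD_sq //.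
have /= := gen_rel (r := rD) h.
by rewrite rmorphN rmorph1 mulr1.
Qed.

Lemma D_gen_sq i v : gM i (gM i v) = v.
Proof. by rewrite -actM tD_sq /act rmorph1 id_lfunE. Qed.

Lemma D_gen_braid (i j : 'I_n) v : j = i.+1 :> nat -> (j < m)%N ->
  gM i (gM j (gM i v)) = gM j (gM i (gM j v)).
Proof.
move=> ij jm; rewrite -!actM.
by congr (act M _ v); apply: (gen_rel (r := rD) (D_braid C ij jm)).
Qed.

Lemma D_gen_last (i j : 'I_n) v : j = m :> nat -> i.+2 = m ->
  gM i (gM j (gM i v)) = gM j (gM i (gM j v)).
Proof.
move=> jm im; have jm' : j.+1 = n by rewrite jm.
have im' : i.+3 = n by rewrite im.
rewrite -!actM.
by congr (act M _ v); apply: (gen_rel (r := rD) (D_last C jm' im')).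
Qed.

Lemma D_gen_anti_of i j v : D_eqn (('t_i * 't_j) ^+ 2 : ncpoly C n)%NC (- 1)%NC ->
  gM i (gM j v) = - gM j (gM i v).
Proof.
by move=> h; rewrite -!actM (tD_anti h) /act rmorphN opp_lfunE.
Qed.

Lemma D_gen_far (i j : 'I_n) v : (i < m)%N -> (j < m)%N -> far i j -> gM i (gM j v) = - gM j (gM i v).
Proof. by move=> im jm ij; apply: D_gen_anti_of; apply: D_far. Qed.

Lemma D_gen_far_last (i j : 'I_n) v : j = m :> nat -> i != j -> i.+2 <> m ->
  gM i (gM j v) = - gM j (gM i v).
Proof.
move=> jm ij im; apply: D_gen_anti_of; apply: D_far_last => //; first by rewrite jm.
by move=> [].
Qed.

Lemma D_gen_last_far (i j : 'I_n) v : j = m :> nat -> i != j -> i.+2 <> m ->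
  gM j (gM i v) = - gM i (gM j v).
Proof. by move=> jm ij im; rewrite (D_gen_far_last _ jm ij im) opprK. Qed.

Definition ind_space : vectType C := (M * M)%type.
Local Notation IndT := (triv_svect ind_space).

(** The opposite of the action of [t_n t_i t_n] on [M], where [t_n] is the last
    generator of [CB]: conjugation by [t_n] negates the generators [t_i] with [i < n -
    1] and exchanges [t_(n-1)] with the opposite of the last generator of [CD]. *)
Definition twisted_gen (i : 'I_n) : 'End(M) := if (i.+1 < m)%N then gM i else gM ord_max.

(** The first summand is [M], the second is [M] twisted by conjugation by the last
    generator of [CB], which exchanges the summands. *)
Definition ind_fun (i : 'I_n) (p : M * M) : M * M :=
  if (i < m)%N then (gM i p.1, - twisted_gen i p.2) else (p.2, p.1).

Definition ind_op (i : 'I_n) : end_ring IndT := linfun (ind_fun i : ind_space -> ind_space).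

Lemma ind_opE i (p : M * M) : (ind_op i : 'End(ind_space)) p = ind_fun i p.
Proof.
apply: linfun_linE => c x y; rewrite /ind_fun; case: ifP => _ //.
by congr pair; rewrite /= !linearP // opprD scalerN.
Qed.

Lemma D_genN i v : gM i (- v) = - gM i v. Proof. exact: linearN. Qed.
Lemma twisted_genN i v : twisted_gen i (- v) = - twisted_gen i v. Proof. exact: linearN. Qed.

Lemma twisted_gen_sq i v : twisted_gen i (twisted_gen i v) = v.
Proof. by rewrite /twisted_gen; case: ifP => _; rewrite D_gen_sq. Qed.

Lemma twisted_gen_braid (i j : 'I_n) v : j = i.+1 :> nat -> (j < m)%N ->
  twisted_gen i (twisted_gen j (twisted_gen i v)) = twisted_gen j (twisted_gen i (twisted_gen j v)).
Proof.
move=> ij jm; rewrite /twisted_gen -ij jm; case: ifP => jm'; first exact: D_gen_braid.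
by apply: D_gen_last => //=; lia.
Qed.

Lemma twisted_gen_far (i j : 'I_n) v : (i < m)%N -> (j < m)%N -> far i j -> twisted_gen i (twisted_gen j v) = - twisted_gen j (twisted_gen i v).
Proof.
move=> im jm; rewrite /far /twisted_gen => ij; case: ifP => im'; case: ifP => jm'.
- exact: D_gen_far.
- by apply: D_gen_far_last; rewrite -?val_eqE /=; lia.
- by apply: D_gen_last_far; rewrite -?val_eqE /=; lia.
- by lia.
Qed.

(** On each summand the relations between the first generators are relations of [CD];
    the last two generators of [CD] are far from each other, which gives the relation of
    order eight. *)
Lemma ind_rel x y : B_eqn x y ->
  ev (sa_scal (send IndT)) ind_op x = ev (sa_scal (send IndT)) ind_op y.
Proof.
have one (p : M * M) : (1 : end_ring IndT) p = p by exact: id_lfunE.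
have mul (f g : end_ring IndT) p : (f * g : end_ring IndT) p = f (g p) by exact: comp_lfunE.
have negone (p : M * M) : (-1 : end_ring IndT) p = (- p.1, - p.2).
  by rewrite -[LHS]/((- \1%VF : 'End(ind_space)) p) opp_lfunE id_lfunE.
case=> {x y} [i|i j ij jn|i j ij|i j ij jn]; apply/lfunP => -[x y];
  rewrite ?ev_pow /= ?rmorphN ?rmorph1 ?negone ?one.
- rewrite expr2 mul !ind_opE /ind_fun; case: (i < m)%N => //=.
  by rewrite D_gen_sq twisted_genN opprK twisted_gen_sq.
- rewrite ltnS in jn; have im : (i < m)%N by lia.
  rewrite !mul !ind_opE /ind_fun jn im /=; congr pair; first exact: D_gen_braid.
  by rewrite !twisted_genN !opprK; congr (- _); apply: twisted_gen_braid.
- rewrite expr2 !mul !ind_opE /ind_fun.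
  have li := ltn_ord i; have lj := ltn_ord j; move: (ij); rewrite /far => ij'.
  have tgE (k : 'I_n) : (k.+1 < m)%N -> twisted_gen k = gM k by rewrite /twisted_gen => ->.
  case im: (i < m)%N; case jm: (j < m)%N => /=.
  + congr pair; first by rewrite (D_gen_far _ im jm ij) !D_gen_sq.
    by rewrite !twisted_genN !opprK (twisted_gen_far _ im jm ij) !twisted_gen_sq.
  + by rewrite tgE ?D_genN ?D_gen_sq //; lia.
  + by rewrite tgE ?D_genN ?D_gen_sq //; lia.
  + by lia.
- have im : (i < m)%N by lia.
  have jm : j = m :> nat by lia.
  have jm' : (j < m)%N = false by lia.
  have jE : ord_max = j by apply: ord_inj.
  rewrite -[4%N]/(2 * 2)%N exprM !expr2 !mul !ind_opE /ind_fun im jm' /=.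
  have -> : twisted_gen i = gM j by rewrite /twisted_gen jE ltn_neqAle -ij jm eqxx.
  have ne : i != j by rewrite -val_eqE /= ij; lia.
  have ni : i.+2 <> m by lia.
  rewrite !D_genN !opprK; congr pair.
    by rewrite (D_gen_far_last _ jm ne ni) !D_gen_sq.
  by rewrite (D_gen_last_far _ jm ne ni) !D_gen_sq.
Qed.

End Induced.

(** * Every module over CD receives a map from some B^la *)

Section Factor.
Variables (C : numClosedFieldType) (m : nat).
Hypothesis m_gt0 : (0 < m)%N.
Hypothesis n_even : ~~ odd m.+1.
Local Notation n := m.+1.
Variable U : supermod (Clifford C n).
Hypothesis U_simple : simple U.
Local Notation cU := (gens (r := Relations (@Clifford_homog C n)) U).
Local Notation fB la := (sh_fun (sm_act (Bmod U la))).
Local Notation CB := (CB C n).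

(** Each generator of [CB] is a product of a Clifford element and of an element [sB i].
    *)
Lemma Bhom_of_factors la (N : svect C) (f : {rmorphism CB -> end_ring N})
    (h : 'Hom(BV U la, N)) :
  (forall c, f (sa_scal CB c) = c *: \1%VF) ->
  (forall i u v, (i <= m)%N -> h (tens_pure (cU (inord i) u) v) = opB f (cB C m i) (h (tens_pure u v))) ->
  (forall i u v, (i < m)%N ->
     h (tens_pure u (Specht_op C la (adj m i) v)) = opB f (sB C m i) (h (tens_pure u v))) ->
  Bhom (fB la) f h.
Proof.
move=> fs hc hs i T im; have fs' := fB_scal U la.
have hcT j T' : (j <= m)%N -> h (opB (fB la) (cB C m j) T') = opB f (cB C m j) (h T').
  move=> jm; rewrite [T']tens_decomp !linear_sum; apply: eq_bigr => k _ /=.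
  by rewrite opB_cB_pure // hc.
have hsT j T' : (j < m)%N -> h (opB (fB la) (sB C m j) T') = opB f (sB C m j) (h T').
  move=> jm; rewrite [T']tens_decomp !linear_sum; apply: eq_bigr => k _ /=.
  by rewrite opB_sB_pure // hs.
have [lt|ge] := ltnP i m; last first.
  have -> : i = m by lia.
  by rewrite -(clgen_last m (tN C m)); apply: hcT.
have e := T_cperm (@tN_sq C m) (tN_braid C m_gt0) (tN_anti C m_gt0) (tN_last C m_gt0)
  (@isqrt2_central C m) (isqrt2_half C m) lt.
rewrite e -/(sB C m i) (opBM _ _ (sB C m i)) (opBM f _ (sB C m i)).
rewrite -(hsT _ _ lt); move: (opB (fB la) (sB C m i) T) => T'.
rewrite /cldiff !(opBM _ (isqrt2 C m)) (opB_scal fs) (opB_scal fs') !opBD !opBN.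
by rewrite linearZ linearB /= !hcT // ltnW.
Qed.

(** The Clifford maps from [U] to [N] form a nonzero space on which the symmetric group
    acts, and it contains a Specht module; evaluation at vectors of [U] gives the map
    out of the tensor product. *)
Theorem B_factor (N : svect C) (f : {rmorphism CB -> end_ring N}) :
  (forall c, f (sa_scal CB c) = c *: \1%VF) -> (fullv : {vspace N}) <> 0%VS ->
  exists la (h : 'Hom(BV U la, N)), [/\ is_part n la, h != 0 & Bhom (fB la) f h].
Proof.
move=> fs N0; have [rho hrho] := S_embedding_ex C m_gt0.
have iU := Clifford_irred n_even (ltn0Sn m) U_simple.
pose d (i : 'I_n) := opB f (cB C m i).
have hd : cliff_rep d := opB_cliff m_gt0 f.
(* [K] is the space of Clifford maps, the common kernel of the commutators [br i]. *)
pose br (i : 'I_n) (phi : 'Hom(U, N)) : 'Hom(U, N) := ((phi \o cU i) - (d i \o phi))%VF.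
have brl i : linear (br i).
  move=> c x y; apply/lfunP => u; rewrite /br !(add_lfunE, scale_lfunE, opp_lfunE, comp_lfunE).
  by rewrite linearP scalerBr opprD addrACA.
pose K := (\bigcap_(i : 'I_n) lker (linfun (br i)))%VS.
have KP phi : reflect (intertwines cU d phi) (phi \in K).
  apply: (iffP idP) => [|h].
    rewrite memvE => /subv_bigcapP h i u; have := h i isT.
    rewrite -memvE memv_ker (linfun_linE (brl i)) => /eqP /(congr1 (fun q : 'Hom(U, N) => q u)).
    by rewrite zero_lfunE sub_lfunE !comp_lfunE => /eqP; rewrite subr_eq0 => /eqP.
  rewrite memvE; apply/subv_bigcapP => i _; rewrite -memvE memv_ker (linfun_linE (brl i)).
  by apply/eqP/lfunP => u; rewrite zero_lfunE sub_lfunE !comp_lfunE h subrr.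
have K0 : K <> 0%VS.
  have st : stable d fullv by move=> i w _; apply: memvf.
  have [phi [p0 _ pT]] := cliff_hom n_even (Clifford_cliff_rep U) hd iU.1 N0 st.
  move=> e; case/negP: p0; rewrite -memv0 -e.
  exact/KP.
pose Rf (s : 'S_n) (phi : 'Hom(U, N)) : 'Hom(U, N) := (opB f (rho s) \o phi)%VF.
have Rl s : linear (Rf s).
  by move=> c x y; apply/lfunP => u; rewrite /Rf !(add_lfunE, scale_lfunE, comp_lfunE) linearP.
pose R (s : 'S_n) : 'End('Hom(U, N)) := linfun (Rf s).
have RE s phi u : R s phi u = opB f (rho s) (phi u).
  by rewrite /R (linfun_linE (Rl s)) comp_lfunE.
have [f1 fM] := opB_rep f hrho.
have hR : op_rep R.
  split; first by apply/lfunP => phi; apply/lfunP => u; rewrite RE f1 !id_lfunE.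
  move=> s s'; apply/lfunP => phi; apply/lfunP => u.
  by rewrite comp_lfunE !RE -fM comp_lfunE.
have Kst : stable R K.
  move=> s phi /KP h; apply/KP => i u; rewrite !RE h /d (opB_commute m_gt0) //.
  by rewrite -ltnS.
have [la [xi [hla xi0 xiT xiK]]] := Specht_complete hR K0 Kst.
have [Xi XiE] : exists Xi : 'Hom(tens U (Specht C n la), N),
    forall u v, Xi (tens_pure u v) = (xi v : 'Hom(U, N)) u.
  apply: tens_lift => [v c x y|u c x y]; first by rewrite linearP.
  by rewrite linearP add_lfunE scale_lfunE.
exists la, Xi; split=> //.
  apply: contra_neq xi0 => X0; apply/lfunP => v; apply/lfunP => u.
  by rewrite -XiE X0 !zero_lfunE.
apply: Bhom_of_factors => // [i u v im|i u v im].
  rewrite !XiE; have /KP h : xi v \in K by apply: (subvP xiK); rewrite memv_img ?memvf.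
  by rewrite h /d inordK.
case: hrho => _ _ ra.
by rewrite !XiE xiT RE ra.
Qed.

End Factor.

Section Exhaust.
Variables (C : numClosedFieldType) (m : nat).
Hypothesis m_gt2 : (2 < m)%N.
Hypothesis n_even : ~~ odd m.+1.
Local Notation n := m.+1.
Variable U : supermod (Clifford C n).
Hypothesis U_simple : simple U.
Local Notation fB la := (sh_fun (sm_act (Bmod U la))).
Local Notation rD := (Relations (@D_homog C n)).

(** Frobenius reciprocity: a nonzero map into the induced module has a nonzero first
    component, since the last generator exchanges the two components. *)
Theorem D_factor (M : supermod (CD C n)) : (fullv : {vspace M}) <> 0%VS ->
  exists la (g : 'Hom(BV U la, M)),
    [/\ is_part n la, g != 0 & intertwines (Dop (fB la)) (gens (r := rD) M) g].
Proof.
move=> M0; have m0 : (0 < m)%N by lia.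
have [f [fg fs]] := CB_lift (@ind_rel C m m_gt2 M).
have opf i (p : M * M) : opB f (tB C i) p = ind_fun i p.
  by rewrite /opB fg ind_opE.
have N0 : (fullv : {vspace triv_svect (ind_space M)}) <> 0%VS.
  move=> e; apply: M0; apply/eqP; rewrite -subv0; apply/subvP => x _.
  have : ((x, 0) : triv_svect (ind_space M)) \in 0%VS by rewrite -e memvf.
  by rewrite !memv0 => /eqP[->].
have [la [h [hla h0 hB]]] := B_factor m0 n_even U_simple fs N0.
have hx := Bhom_all (fB_scal U la) fs hB.
have fst_lin : linear (fst : ind_space M -> M) by [].
pose g : 'Hom(BV U la, M) := ((linfun (fst : ind_space M -> M) : 'Hom(ind_space M, M)) \o h)%VF.
have gE v : g v = (h v : M * M).1 by rewrite comp_lfunE (linfun_linE fst_lin).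
have ft (p : M * M) : opB f (tN C m m) p = (p.2, p.1).
  by rewrite /tN opf /ind_fun inordK // ltnn.
exists la, g; split=> //.
  apply: contra_neq h0 => g0; apply/lfunP => v; rewrite zero_lfunE.
  have e1 := gE v; have e2 := gE (opB (fB la) (tN C m m) v).
  rewrite g0 zero_lfunE in e1; rewrite g0 zero_lfunE hx ft /= in e2.
  by rewrite [h v]surjective_pairing -e1 -e2.
move=> i v; rewrite !gE /Dop hx.
have [im|mi] := ltnP i m.
  by rewrite D_in_B_lt // opf /ind_fun im.
have e : i = m :> nat by apply/eqP; rewrite eqn_leq mi -ltnS ltn_ord.
rewrite D_in_B_last // opBN !opBM ft.
rewrite /tN opf -/(tN C m m) /ind_fun inordK; last by lia.
have -> : (m.-1 < m)%N by lia.
rewrite ft /= opprK /twisted_gen inordK; last by lia.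
have -> : (m.-1.+1 < m)%N = false by lia.
by congr (gens _ _ _); apply: ord_inj.
Qed.

End Exhaust.

(** * The classification *)

Section Sums.
Variables (C : numClosedFieldType) (n : nat) (r : relations C n).
Local Notation A := (presented r).
Implicit Types M N : supermod A.

Lemma bij_lker M N (g : 'Hom(M, N)) : bijective g -> lker g = 0%VS /\ limg g = fullv.
Proof.
case=> g' gK g'K; split; apply/eqP.
  rewrite -subv0; apply/subvP => v; rewrite memv_ker memv0 => /eqP e.
  by rewrite -[v]gK e -(gK 0) linear0.
rewrite eqEsubv subvf; apply/subvP => v _.
by rewrite -[v]g'K memv_img ?memvf.
Qed.

Lemma isomorphic_refl M : simple M -> isomorphic M M.
Proof.
move=> sM; apply: (intertwiner_iso (f := \1%VF)) => //.
  by move=> i m; rewrite !id_lfunE.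
apply/eqP => e; apply: sM.1; apply/eqP; rewrite -subv0; apply/subvP => v _.
by rewrite memv0 -[v]id_lfunE e zero_lfunE.
Qed.

Lemma isomorphic_sym M N : simple M -> simple N -> isomorphic M N -> isomorphic N M.
Proof.
move=> sM sN /isomorphic_intertwiner[g [gT gb]]; have [gk gi] := bij_lker gb.
have gV := twisted_inv (fun i => oner_neq0 C) gk gi ((twisted_homE _ _ _).1 gT).
apply: (intertwiner_iso (f := g^-1%VF)) => //.
  by move=> i v; rewrite gV invr1 scale1r.
apply/eqP => e; apply: sM.1; apply/eqP; rewrite -subv0; apply/subvP => v _.
by rewrite memv0 -[v](lker0_lfunK (f := g)) ?gk // e zero_lfunE.
Qed.

Lemma even_hom_intertwines M N (f : 'Hom(M, N)) : homog_hom false f ->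
  intertwines (gens M) (gens N) f.
Proof. by move=> /homog_hom_gens[_ h] i m; rewrite h scale1r. Qed.

(** The projection along the complementary summand. *)
Lemma summand_retraction M N1 N2 (f1 : 'Hom(N1, M)) (f2 : 'Hom(N2, M)) :
  intertwines (gens N1) (gens M) f1 -> intertwines (gens N2) (gens M) f2 ->
  lker f1 = 0%VS -> (limg f1 + limg f2 = fullv)%VS -> (limg f1 :&: limg f2 = 0)%VS ->
  exists p : 'Hom(M, N1), intertwines (gens M) (gens N1) p /\ forall v, p (f1 v) = v.
Proof.
move=> T1 T2 k1 su ca; have k1' : lker f1 == 0%VS by apply/eqP.
pose q := daddv_pi (limg f1) (limg f2).
pose p : 'Hom(M, N1) := (f1^-1 \o q)%VF.
have p1 v : p (f1 v) = v.
  by rewrite comp_lfunE (daddv_pi_id ca) ?lker0_lfunK // memv_img ?memvf.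
have p2 v : p (f2 v) = 0.
  have e : q (f2 v) = 0.
    have vM : f2 v \in (limg f1 + limg f2)%VS by rewrite su memvf.
    have := daddv_pi_add ca vM; rewrite (daddv_pi_id (U := limg f2) (V := limg f1)) ?memv_img ?memvf //;
      last by rewrite capvC.
    by move/(canRL (addrK _)); rewrite subrr.
  by rewrite comp_lfunE e linear0.
exists p; split=> // i v.
have : v \in (limg f1 + limg f2)%VS by rewrite su memvf.
case/memv_addP => [_ /memv_imgP[x _ ->] [_ /memv_imgP[y _ ->] ->]].
by rewrite !linearD /= -T1 -T2 !p1 !p2 linear0 !addr0.
Qed.

End Sums.

Section Final.
Variables (C : numClosedFieldType) (m : nat).
Hypothesis m_gt2 : (2 < m)%N.
Hypothesis n_even : ~~ odd m.+1.
Local Notation n := m.+1.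
Variable U : supermod (Clifford C n).
Hypothesis U_simple : simple U.
Local Notation fB la := (sh_fun (sm_act (Bmod U la))).
Local Notation rD := (Relations (@D_homog C n)).
Local Notation gensD := (gens (r := rD)).
Variable Dsign : bool -> seq nat -> supermod (CD C n).
Hypothesis Dsign_splits : forall la, is_part n la -> conj_part la = la ->
  D_splits U la (Dsign true la) (Dsign false la).

Let m_gt0 : (0 < m)%N. Proof. by lia. Qed.

Definition label_part (l : Dlabel) : seq nat :=
  match l with DPair la => la | DSign _ la => la end.

Lemma label_is_part l : Dlabel_valid n l -> is_part n (label_part l).
Proof. by case: l => [la|s la] /= /andP[]. Qed.

Lemma Dlist_ungraded_simple l : Dlabel_valid n l -> ungraded_simple (Dlist U Dsign l).
Proof.
case: l => [la|s la] /= /andP[hla cla].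
  apply/(ungraded_simple_irred (r := rD)).
  have [V0 iV] := D_irred m_gt0 n_even U_simple hla cla.
  split=> // W Ws; apply: iV => i w wW.
  by rewrite -gens_Dmod; apply: Ws.
by have [_ _ ? ?] := Dsign_splits hla (eqP cla); case: s.
Qed.

Lemma Dlist_simple l : Dlabel_valid n l -> simple (Dlist U Dsign l).
Proof. by move=> hl; apply/simple_irred/Dlist_ungraded_simple. Qed.

(** Every listed module is a direct summand of the restriction of some [B^la]. *)
Lemma Dlist_retract l : Dlabel_valid n l ->
  exists (i : 'Hom(Dlist U Dsign l, Dmod U (label_part l)))
         (p : 'Hom(Dmod U (label_part l), Dlist U Dsign l)),
    [/\ intertwines (gensD (Dlist U Dsign l)) (gensD (Dmod U (label_part l))) i,
        intertwines (gensD (Dmod U (label_part l))) (gensD (Dlist U Dsign l)) p &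
        forall v, p (i v) = v].
Proof.
case: l => [la|s la] /= /andP[hla cla].
  by exists \1%VF, \1%VF; split=> [j v|j v|v]; rewrite !id_lfunE.
have [[f1 [f2 [[h1 h2] [k1 k2] su ca]]] _ _ _] := Dsign_splits hla (eqP cla).
have T1 := even_hom_intertwines (r := rD) h1.
have T2 := even_hom_intertwines (r := rD) h2.
case: s.
  by have [p [pT pf]] := summand_retraction T1 T2 k1 su ca; exists f1, p.
rewrite addvC in su; rewrite capvC in ca.
by have [p [pT pf]] := summand_retraction T2 T1 k2 su ca; exists f2, p.
Qed.

(** An isomorphism between summands extends by zero to a nonzero map between the
    restrictions of the [B^la]. *)
Lemma Dlist_iso_part l l' : Dlabel_valid n l -> Dlabel_valid n l' ->
  isomorphic (Dlist U Dsign l) (Dlist U Dsign l') ->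
  label_part l' = label_part l \/ label_part l' = conj_part (label_part l).
Proof.
move=> hl hl' /(isomorphic_intertwiner (r := rD))[g [gT gb]].
have [i [p [iT pT pi]]] := Dlist_retract hl.
have [i' [p' [iT' pT' pi']]] := Dlist_retract hl'.
pose h : 'Hom(BV U (label_part l), BV U (label_part l')) := (i' \o g \o p)%VF.
apply: (D_hom_labels m_gt0 n_even (h := h)); try exact: label_is_part.
  by move=> j v; rewrite -!gens_Dmod !comp_lfunE pT gT iT'.
have [V0 _] := Dlist_simple hl.
apply/eqP => h0; apply: V0; apply/eqP; rewrite -subv0; apply/subvP => v _.
rewrite memv0; apply/eqP/(bij_inj gb); rewrite linear0.
have : h (i v) = 0 by rewrite h0 zero_lfunE.
by rewrite !comp_lfunE pi => /(congr1 p'); rewrite pi' linear0.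
Qed.

Lemma Dlist_iso l l' : Dlabel_valid n l -> Dlabel_valid n l' ->
  isomorphic (Dlist U Dsign l) (Dlist U Dsign l') <-> same_Dlabel l l'.
Proof.
move=> hl hl'; split.
  move=> iso; have := Dlist_iso_part hl hl' iso.
  case: l l' hl hl' iso => [la|s la] [mu|s' mu] /=.
  - by [].
  - move=> /andP[hla /eqP cla] /andP[hmu /eqP cmu] _ [e|e].
      by apply: cla; rewrite -e.
    by apply: cla; rewrite -e -cmu e (conj_partK hla).
  - move=> /andP[hla /eqP cla] /andP[hmu /eqP cmu] _ [e|e].
      by apply: cmu; rewrite e.
    by apply: cmu; rewrite e cla.
  move=> hl hl' iso e; have [/andP[hla /eqP cla] /andP[hmu _]] := (hl, hl').
  have e' : mu = la by case: e => ->.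
  split; last by [].
  rewrite {}e' {e hmu hl'} in iso *.
  have [_ ni s1 s2] := Dsign_splits hla cla.
  case: s s' {hl} iso => [] [] // iso.
  case: ni; apply: (isomorphic_sym (r := rD)) iso; exact: simple_irred.
case: l l' hl hl' => [la|s la] [mu|s' mu] hl hl' //=; last first.
  by move=> [<- <-]; apply: (isomorphic_refl (r := rD)); apply: Dlist_simple hl.
have [hla _] := andP hl.
case=> [->|e]; first by apply: (isomorphic_refl (r := rD)); apply: Dlist_simple hl.
have := Specht_sign C (is_part_conj hla); rewrite (conj_partK hla) -e => -[th [th0 thT]].
have [H [H0 HS _]] := twisted_Bhom_ex m_gt0 n_even U_simple th0 thT.
apply: (@intertwiner_iso C n rD (Dmod U la) (Dmod U mu) H) => //.
- exact: (Dlist_simple hl).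
- exact: (Dlist_simple hl').
- by move=> i v; rewrite !gens_Dmod; apply: (twisted_Bhom_Dhom m_gt0 HS).
Qed.

(** The nonzero map from [B^la] provided by [D_factor] does not vanish on all simple
    summands. *)
Lemma Dlist_complete M : simple M ->
  exists2 l, Dlabel_valid n l & isomorphic M (Dlist U Dsign l).
Proof.
move=> sM; have [la [g [hla g0 gT]]] := D_factor m_gt2 n_even U_simple sM.1.
have gT' : intertwines (gensD (Dmod U la)) (gensD M) g.
  by move=> i v; rewrite gens_Dmod gT.
suff [l hl [h [hT h0]]] : exists2 l, Dlabel_valid n l &
    exists h : 'Hom(Dlist U Dsign l, M), intertwines (gensD (Dlist U Dsign l)) (gensD M) h /\ h != 0.
  exists l => //; have sl := Dlist_simple hl.
  by apply: (isomorphic_sym (r := rD)) => //; apply: intertwiner_iso hT h0.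
have [cla|cla] := eqVneq (conj_part la) la; last first.
  by exists (DPair la); [rewrite /= hla | exists g].
have [[f1 [f2 [[h1 h2] _ su _]]] _ _ _] := Dsign_splits hla cla.
have T1 := even_hom_intertwines (r := rD) h1.
have T2 := even_hom_intertwines (r := rD) h2.
have hv s : Dlabel_valid n (DSign s la) by rewrite /= hla cla eqxx.
have [e1|n1] := eqVneq (g \o f1)%VF 0; last first.
  exists (DSign true la) => //; exists (g \o f1)%VF; split=> // i v.
  by rewrite !comp_lfunE T1 gT'.
have [e2|n2] := eqVneq (g \o f2)%VF 0; last first.
  exists (DSign false la) => //; exists (g \o f2)%VF; split=> // i v.
  by rewrite !comp_lfunE T2 gT'.
case/eqP: g0; apply/lfunP => v; rewrite zero_lfunE.
have : v \in (limg f1 + limg f2)%VS by rewrite su memvf.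
case/memv_addP => [_ /memv_imgP[x _ ->] [_ /memv_imgP[y _ ->] ->]].
by rewrite linearD /= -!comp_lfunE e1 e2 !zero_lfunE addr0.
Qed.

End Final.

Theorem proposition7p3 (R : realType) (n : nat) (n_ge4 : (4 <= n)%N)
    (n_even : ~~ odd n) (U : supermod (Clifford R[i] n)) (U_simple : simple U) :
  (forall la : seq nat, is_part n la -> conj_part la = la ->
     exists Dp Dm : supermod (CD R[i] n), D_splits U la Dp Dm)
  /\
  (forall Dsign : bool -> seq nat -> supermod (CD R[i] n),
     (forall la : seq nat, is_part n la -> conj_part la = la ->
        D_splits U la (Dsign true la) (Dsign false la)) ->
     [/\ forall l, Dlabel_valid n l -> simple (Dlist U Dsign l),
         forall l, Dlabel_valid n l -> type_M (Dlist U Dsign l),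
         forall l l', Dlabel_valid n l -> Dlabel_valid n l' ->
           (isomorphic (Dlist U Dsign l) (Dlist U Dsign l') <->
            same_Dlabel l l')
       & forall M : supermod (CD R[i] n), simple M ->
           exists2 l, Dlabel_valid n l & isomorphic M (Dlist U Dsign l)]).
Proof.
case: n n_ge4 n_even U U_simple => // m m_gt2 n_even U U_simple.
have m_gt0 : (0 < m)%N by lia.
split=> [la hla cla|Dsign hD]; first exact: D_splits_ex.
split=> [l hl|l hl|l l' hl hl'|M sM].
- exact: Dlist_simple.
- exact/irred_type_M/Dlist_ungraded_simple.
- exact: Dlist_iso.
- exact: Dlist_complete.
Qed.
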